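(* Let $\bar G$ be a reference potential with $2N$ critical points, and let $\bar I_1^i$ and $\bar{\mathtt E}^i$ ($0\le i\le2N$) be the action functions and energy functions of the Hamiltonian $\bar{\mathsf H}(p_1,q_1)=p_1^2+\bar G(q_1)$. (i) If $i=0,2N$, then, for every $E>\bar E_i$, one has $\partial^2_{I_1}\bar{\mathtt E}^i(\bar I_1^i(E))\ge2$. (ii) If $\bar G$ is $\mathtt g$-cosine-like with $\mathtt g\le2^{-40}$, then $$\partial^2_{I_1}\bar{\mathtt E}^1(\bar I_1^1(E))\le-\frac1{27},\qquad\forall\,E\in(\bar E_1,\bar E_2).$$
   Context: $\mathbb T=\mathbb R/(2\pi\mathbb Z)$; for $s>0$, $\mathbb T_s:=\{x\in\mathbb C:|\mathrm{Im}\,x|<s\}/(2\pi\mathbb Z)$. A $C^2(\mathbb T,\mathbb R)$ Morse function $F$ with distinct critical values is $\beta$-Morse ($\beta>0$) if $\min_{\theta\in\mathbb T}(|F'(\theta)|+|F''(\theta)|)\ge\beta$ and $\min_{i\ne j}|F(\theta_i)-F(\theta_j)|\ge\beta$, where $\theta_i$ are its critical points. A reference potential $\bar G$ is a real analytic function on $\mathbb T_{\mathsf s}$ (some $\mathsf s>0$), with zero average on $\mathbb T$, that is $\beta$-Morse for some $\beta>0$. Let $\bar\theta_0$ be the unique absolute maximum point of $\bar G$ in $[0,2\pi)$ and $\bar\theta_0<\bar\theta_1<\dots<\bar\theta_{2N}:=\bar\theta_0+2\pi$ its critical points in $[\bar\theta_0,\bar\theta_0+2\pi]$ (relative maxima for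 $i$ even, relative minima for $i$ odd); $\bar E_i:=\bar G(\bar\theta_i)$, so $\bar E_0=\bar E_{2N}=\max\bar G$. The action functions of $\bar{\mathsf H}=p_1^2+\bar G(q_1)$ are $\bar I_1^i(E):=\frac1{2\pi}\oint p_1\,dq_1$ along the level curve of energy $E$ contained in the $i$-th phase space region (regions being delimited by the separatrices). In particular, for $i=0,2N$ (the regions below the lowest and above the highest separatrix), $\bar I_1^{0}(E)=\bar I_1^{2N}(E)=\frac1{2\pi}\int_0^{2\pi}\sqrt{E-\bar G(x)}\,dx$ for $E>\max\bar G$; for $i=1$, the region is the one whose closure contains the equilibrium $(p_1,q_1)=(0,\bar\theta_1)$, and $\bar I_1^1(E)=\frac1\pi\int\sqrt{E-\bar G(x)}\,dx$, the integral being over the maximal interval around $\bar\theta_1$ on which $\bar G\le E$. The functions $E\mapsto\bar I_1^i(E)$ are strictly increasing; $\bar{\mathtt E}^i$ denotes the inverse function of $\bar I_1^i$. Cosine-like: let $0<\mathtt g<1/4$; a real analytic function $G:\mathbb T_1\to\mathbb C$ is $\mathtt g$-cosine-like if, for some $\eta>0$ and $\theta_0\in\mathbb R$, $\sup_{\theta\in\mathbb T_1}|G(\theta)-\eta\cos(\theta+\theta_0)|\le\eta\,\mathtt g$. *)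

(* Defs.v *)
From Stdlib Require Import Reals ClassicalEpsilon.
From Coquelicot Require Import Coquelicot.
Open Scope R_scope.

Definition Cexp (z : C) : C :=
  (exp (fst z) * cos (snd z), exp (fst z) * sin (snd z)).

Definition Ccos (z : C) : C :=
  Cdiv (Cplus (Cexp (Cmult Ci z)) (Cexp (Copp (Cmult Ci z)))) (RtoC 2).

Definition analytic_at (F : C -> C) (z0 : C) : Prop :=
  exists (a : nat -> C) (r : R), 0 < r /\
    forall z : C, Cmod (Cminus z z0) < r ->
      @is_pseries C_AbsRing C_NormedModule a (Cminus z z0) (F z).

(* The lift to [R] of a real analytic function on T_s is a real function [G]
   having an extension [F] of this kind.  By analytic continuation [F] is
   determined by [G] on the strip; outside the strip it is irrelevant. *)
Definition analytic_extension (s : R) (G : R -> R) (F : C -> C) : Prop :=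
  (forall z : C, Rabs (Im z) < s -> analytic_at F z) /\
  (forall z : C, Rabs (Im z) < s -> F (Cplus z (RtoC (2 * PI))) = F z) /\
  (forall x : R, F (RtoC x) = RtoC (G x)).

Definition C2 (F : R -> R) : Prop :=
  forall x, ex_derive F x /\ ex_derive (Derive F) x /\
            continuous (Derive (Derive F)) x.

Definition critical (F : R -> R) (x : R) : Prop := Derive F x = 0.

Definition periodic (F : R -> R) : Prop := forall x, F (x + 2 * PI) = F x.

(* Critical points on T are represented in [0, 2 * PI). *)
Definition distinct_critical (F : R -> R) (x y : R) : Prop :=
  0 <= x < 2 * PI /\ 0 <= y < 2 * PI /\ x <> y /\ critical F x /\ critical F y.

Definition beta_Morse (beta : R) (F : R -> R) : Prop :=
  C2 F /\ periodic F /\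
  (forall x, critical F x -> Derive (Derive F) x <> 0) /\
  (forall x y, distinct_critical F x y -> F x <> F y) /\
  (forall x, beta <= Rabs (Derive F x) + Rabs (Derive (Derive F) x)) /\
  (forall x y, distinct_critical F x y -> beta <= Rabs (F x - F y)).

Definition reference_potential (G : R -> R) : Prop :=
  (exists (s : R) (F : C -> C), 0 < s /\ analytic_extension s G F) /\
  / (2 * PI) * RInt G 0 (2 * PI) = 0 /\
  (exists beta : R, 0 < beta /\ beta_Morse beta G).

Definition cosine_like (g : R) (G : R -> R) : Prop :=
  0 < g < 1 / 4 /\
  exists F : C -> C, analytic_extension 1 G F /\
  exists eta theta0 : R, 0 < eta /\
    forall z : C, Rabs (Im z) < 1 ->
      Cmod (Cminus (F z) (Cmult (RtoC eta) (Ccos (Cplus z (RtoC theta0)))))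
        <= eta * g.

(* [theta 0 < ... < theta (2 * N)] are the critical points of [G] in one period
   starting from its maximum point; values [theta i] with [i > 2 * N] are
   irrelevant. *)
Definition critical_points (G : R -> R) (N : nat) (theta : nat -> R) : Prop :=
  0 <= theta 0%nat < 2 * PI /\
  (forall x, G x <= G (theta 0%nat)) /\
  (forall i, (i < 2 * N)%nat -> theta i < theta (S i)) /\
  theta (2 * N)%nat = theta 0%nat + 2 * PI /\
  (forall x, theta 0%nat <= x <= theta 0%nat + 2 * PI ->
     (critical G x <-> exists i, (i <= 2 * N)%nat /\ x = theta i)).

(* [x] lies in the maximal interval around [c] on which [G <= E]. *)
Definition in_well (G : R -> R) (E c x : R) : Prop :=
  forall y, Rmin c x <= y <= Rmax c x -> G y <= E.

Definition well_left (G : R -> R) (E c : R) : R :=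
  real (Glb_Rbar (in_well G E c)).

Definition well_right (G : R -> R) (E c : R) : R :=
  real (Lub_Rbar (in_well G E c)).

(* Energies of the [i]-th phase space region.  It is bounded from below by the
   equilibrium (odd [i]) or separatrix (even [i]) of energy [G (theta i)], and
   from above by the first separatrix through a critical point reached by the
   level curve around [theta i] and having energy larger than [G (theta i)].
   Thus the range is (G (theta 0), +oo) for i = 0, 2 * N, and
   (G (theta i), min (G (theta (i - 1))) (G (theta (i + 1)))) for odd i; in
   particular it is (G (theta 1), G (theta 2)) for i = 1. *)
Definition energy_range (G : R -> R) (N : nat) (theta : nat -> R)
    (i : nat) (E : R) : Prop :=
  G (theta i) < E /\
  forall j, (j <= 2 * N)%nat -> in_well G E (theta i) (theta j) ->
    G (theta j) <= G (theta i).

(* On the level curve of energy E one has p = sqrt (E - G q) or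
   p = - sqrt (E - G q).  For i = 0, 2 * N the curve winds once around the
   circle with p of constant sign; otherwise it is a closed curve over the
   well around [theta i], which is covered twice. *)
Definition action (G : R -> R) (N : nat) (theta : nat -> R)
    (i : nat) (E : R) : R :=
  if (Nat.eqb i 0 || Nat.eqb i (2 * N))%bool then
    / (2 * PI) * RInt (fun x => sqrt (E - G x)) 0 (2 * PI)
  else
    / PI * RInt (fun x => sqrt (E - G x))
             (well_left G E (theta i)) (well_right G E (theta i)).

(* The inverse function of [action G N theta i] on its energy range; it is
   arbitrary outside the image of that range. *)
Definition energy (G : R -> R) (N : nat) (theta : nat -> R)
    (i : nat) (I : R) : R :=
  epsilon (inhabits 0)
    (fun E => energy_range G N theta i E /\ action G N theta i E = I).

(* [Derive] is total and [ex_derive_n f 2 x] does not assert that [f] is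
   differentiable near [x], so this is required separately. *)
Definition twice_derivable (f : R -> R) (x : R) : Prop :=
  locally x (fun y => ex_derive f y) /\ ex_derive (Derive f) x.

(* Main.v *)
Require Import Defs.
From Stdlib Require Import Reals Lra Lia ClassicalEpsilon Ranalysis5 Bool.
From Coquelicot Require Import Coquelicot.
Open Scope R_scope.

(** Write [I] for the action and [E''] for the second derivative of its
    inverse, so that [E'' = - I'' / I' ^ 3] ([energy_second_derivative]); both
    claims bound [I''] against [I' ^ 3].

    On the circle, differentiating under the integral gives, with
    [f = (E - G) ^ (-1/2)] and [< >] the mean over a period,
    [I' = <f> / 2] and [I'' = - <f ^ 3> / 4], so that
    [E'' = 2 <f ^ 3> / <f> ^ 3 >= 2] by Jensen ([rotation_energy_convex]).

    In the well around the minimum [c], put [V = G - G c], let [u] be the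
    signed square root of [V] and [X] the inverse function of [u]
    ([inverse_coordinate]).  With [u = r sin t] and [r = sqrt (E - G c)] the
    action becomes an integral over a fixed interval with a smooth integrand;
    [I'] is, up to the factor [1 / (2 PI)], the integral of [X' (r sin t)] over
    [- PI / 2 <= t <= PI / 2], and [I''] is read off from [X'']
    ([is_derive_abel_integral]).  If [S] is the even part of [X'] and
    [S' u >= k u (S u) ^ 3], then Chebyshev's and Jensen's inequalities give
    [I'' >= k I' ^ 3], that is [E'' <= - k] ([period_convexity],
    [well_energy_concave]).

    From [V (X u) = u ^ 2] one gets [X' = 2 u / V'] and [X'' = 2 W / V' ^ 3]
    with [W = V' ^ 2 - 2 V V''].  For a pure cosine [W = V ^ 2], and the
    condition on [S] holds with [k = 1/4]; the slack down to [k = 1/27] absorbs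
    the perturbation.  Since [W' = - 2 V V'''], in units with [eta = 1] the
    difference [W - V ^ 2] is [-2] times the integral of [V (V''' + V')] from
    [c], which is small against [V ^ 2] as soon as [V] is not tiny ([ncw_far]):
    the separatrix is harmless.  Near the bottom
    the leading part of [W - V ^ 2] is cubic and dominates [V ^ 2], but it is a
    multiple of [V' ^ 3] with the same factor on both sides of [c], so it
    cancels in [X'' u - X'' (- u)] ([ncw_near], [ncw_two_sided]).

    What remains is that [G / eta] is close to a cosine together with its first
    four derivatives on the real line.  This follows from the sup bound on the
    strip by iterating Cauchy's estimate for the first derivative
    ([cauchy_estimate], [cosine_like_derivatives]), which is proved here from
    the local power series. *)

(** Integration and differentiation lemmas leave equations in carriers that are
    only convertible to [R]; [ring] and [field] need the literal type. *)
Ltac real_eq := match goal with |- @eq _ ?l ?r => change (@eq R l r) end.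

(** * Derivatives of complex power series *)

Lemma norm_series_le {K : AbsRing} {V : NormedModule K} (u : nat -> V) (b : nat -> R) (l : V) (B : R) :
  is_series u l -> is_series b B -> (forall n, norm (u n) <= b n) -> norm l <= B.
Proof.
  intros Hu Hb Hub.
  assert (Hs : forall n, norm (sum_n u n) <= sum_n b n).
  { induction n as [|n IH].
    - rewrite !sum_O; apply Hub.
    - rewrite !sum_Sn.
      apply Rle_trans with (1 := norm_triangle _ _).
      apply Rplus_le_compat; [exact IH | apply Hub]. }
  assert (H1 : is_lim_seq (fun n => norm (sum_n u n)) (norm l)).
  { apply (filterlim_comp _ _ _ (sum_n u) norm _ _ _ Hu). apply filterlim_norm. }
  exact (is_lim_seq_le _ _ (norm l) B Hs H1 Hb).
Qed.

(** The first-order Taylor remainder of the monomials, with a constant whose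
    sum against the coefficients still converges inside the disc; this is what
    allows termwise differentiation. *)
Lemma pow_n_C_bound (h k : C) (s : R) (n : nat) :
  Cmod h <= s -> Cmod k <= s ->
  Cmod (pow_n k (S n) - pow_n h (S n) - RtoC (INR (S n)) * pow_n h n * (k - h))%C
    <= INR (S n) * INR n * s ^ (pred n) * Cmod (k - h)%C ^ 2
  /\ Cmod (pow_n h n) <= s ^ n.
Proof.
  intros Hh Hk.
  assert (Hs : 0 <= s) by (apply Rle_trans with (2 := Hh), Cmod_ge_0).
  assert (Hp : forall n, Cmod (pow_n h n) <= s ^ n).
  { clear n; induction n as [|n IH].
    - simpl; change (Cmod (RtoC 1) <= 1); rewrite Cmod_1; lra.
    - change (Cmod (h * pow_n h n)%C <= s * s ^ n); rewrite Cmod_mult.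
      apply Rmult_le_compat; auto using Cmod_ge_0. }
  split; [|apply Hp].
  induction n as [|n IH].
  - simpl pow_n.
    match goal with |- Cmod ?z <= _ => replace z with (RtoC 0) end.
    rewrite Cmod_0; simpl; lra.
    change (RtoC 0 = (k * RtoC 1 - h * RtoC 1 - RtoC (INR 1) * RtoC 1 * (k - h))%C).
    simpl INR; ring.
  - set (e := (pow_n k (S n) - pow_n h (S n) - RtoC (INR (S n)) * pow_n h n * (k - h))%C) in *.
    match goal with |- Cmod ?z <= _ =>
      replace z with (k * e + RtoC (INR (S n)) * pow_n h n * ((k - h) * (k - h)))%C end.
    2:{ unfold e. change (pow_n k (S (S n))) with (k * pow_n k (S n))%C.
        change (pow_n h (S (S n))) with (h * pow_n h (S n))%C.
        change (pow_n h (S n)) with (h * pow_n h n)%C.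
        rewrite (S_INR (S n)), RtoC_plus. ring. }
    apply Rle_trans with (1 := Cmod_triangle _ _).
    rewrite !Cmod_mult, Cmod_R, (Rabs_pos_eq (INR (S n))) by apply pos_INR.
    set (d := Cmod (k - h)%C) in *. assert (Hd : 0 <= d) by apply Cmod_ge_0.
    assert (Hke : Cmod k * Cmod e <= s * (INR (S n) * INR n * s ^ pred n * d ^ 2)).
    { apply Rmult_le_compat; auto using Cmod_ge_0. }
    assert (Hss : s * (INR (S n) * INR n * s ^ pred n * d ^ 2) <= INR (S n) * INR n * s ^ n * d ^ 2).
    { destruct n as [|n]; [simpl; lra|]. simpl pred. change (s ^ S n) with (s * s ^ n). right; ring. }
    assert (Hn : INR (S n) * Cmod (pow_n h n) * (d * d) <= INR (S n) * s ^ n * (d * d)).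
    { apply Rmult_le_compat_r; [nra|]. apply Rmult_le_compat_l; [apply pos_INR|apply Hp]. }
    simpl pred. rewrite (S_INR (S n)). 
    assert (0 <= INR (S n) * s ^ n * d ^ 2).
    { apply Rmult_le_pos; [apply Rmult_le_pos; [apply pos_INR | apply pow_le; auto]|nra]. }
    rewrite (S_INR n) in *. nra.
Qed.

Lemma is_C_derive_quadratic (f : C -> C) (h l : C) (d K : R) :
  0 < d -> 
  (forall k, Cmod (k - h)%C < d -> Cmod (f k - f h - l * (k - h))%C <= K * Cmod (k - h)%C ^ 2) ->
  @is_derive C_AbsRing C_NormedModule f h l.
Proof.
  intros Hd Hq. split; [apply is_linear_scal_l|].
  intros x Hx eps. apply (@is_filter_lim_locally_unique C_AbsRing (AbsRing_NormedModule C_AbsRing)) in Hx. subst x.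
  assert (HK : 0 < Rabs K + 1) by (generalize (Rabs_pos K); lra).
  assert (Hd' : 0 < Rmin d (eps / (Rabs K + 1))).
  { apply Rmin_pos; auto. apply Rdiv_lt_0_compat; auto. apply cond_pos. }
  apply (@locally_le_locally_norm C_AbsRing (AbsRing_NormedModule C_AbsRing)). exists (mkposreal _ Hd').
  intros k Hk. simpl in Hk.
  change (Cmod (k - h)%C < Rmin d (eps / (Rabs K + 1))) in Hk.
  change (Cmod ((f k - f h) - (k - h) * l)%C <= eps * Cmod (k - h)%C).
  replace (f k - f h - (k - h) * l)%C with (f k - f h - l * (k - h))%C by ring.
  apply Rle_trans with (1 := Hq k (Rlt_le_trans _ _ _ Hk (Rmin_l _ _))).
  assert (Cmod (k - h)%C < eps / (Rabs K + 1)) as H by (apply Rlt_le_trans with (1 := Hk), Rmin_r).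
  apply Rmult_lt_compat_r with (1 := HK) in H. unfold Rdiv in H.
  rewrite Rmult_assoc, Rinv_l, Rmult_1_r in H by lra.
  generalize (Cmod_ge_0 (k - h)%C) (Rle_abs K). nra.
Qed.

(** Bounded terms at radius [rho] make the moduli of the coefficients a real
    power series of radius at least [rho], to which the real theory of derived
    series applies. *)
Lemma ex_series_scaled_derivs (b : nat -> R) (rho s : R) :
  0 < s < rho -> (exists M, forall n, Rabs (b n * rho ^ n) <= M) ->
  ex_series (fun n => INR (S n) * b (S n) * s ^ n) /\
  ex_series (fun n => INR (S n) * INR n * b (S n) * s ^ (pred n)).
Proof.
  intros Hs HM.
  assert (Hlt : Rbar_lt (Rabs s) (CV_radius b)).
  { apply Rbar_lt_le_trans with rho.
    - simpl. rewrite Rabs_pos_eq; lra.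
    - apply (CV_radius_bounded b), HM. }
  assert (Hlt1 : Rbar_lt (Rabs s) (CV_radius (PS_derive b))) by (rewrite CV_radius_derive; auto).
  assert (E1 := ex_pseries_derive _ _ Hlt).
  assert (E2 := ex_pseries_derive _ _ Hlt1).
  split.
  - revert E1. apply ex_series_ext. intros n. unfold PS_derive.
    rewrite pow_n_pow. apply Rmult_comm.
  - apply ex_series_incr_1. revert E2. apply ex_series_ext. intros n. unfold PS_derive.
    rewrite pow_n_pow. change (@eq R (s ^ n * (INR (S n) * (INR (S (S n)) * b (S (S n)))))
      (INR (S (S n)) * INR (S n) * b (S (S n)) * s ^ n)). generalize (s^n) (INR (S n)) (INR (S (S n))); intros; ring.
Qed.

Lemma is_pseries_bounded_coef (a : nat -> C) (rho : R) (l : C) :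
  0 < rho -> @is_pseries C_AbsRing C_NormedModule a (RtoC rho) l ->
  exists M, forall n, Rabs (Cmod (a n) * rho ^ n) <= M.
Proof.
  intros Hr Hl.
  destruct (filterlim_bounded (K := C_AbsRing) (V := C_NormedModule) _ (ex_intro _ l Hl)) as [M HM].
  assert (Hp : forall n, Cmod (a n) * rho ^ n = Cmod (@scal C_AbsRing C_NormedModule (pow_n (RtoC rho) n) (a n))).
  { intros n. change (Cmod (a n) * rho ^ n = Cmod (pow_n (RtoC rho) n * a n)%C).
    rewrite Cmod_mult, Rmult_comm. f_equal. induction n as [|n IH].
    - change (1 = Cmod (RtoC 1)). now rewrite Cmod_1.
    - change (rho * rho ^ n = Cmod (RtoC rho * pow_n (RtoC rho) n)%C).
      rewrite Cmod_mult, <- IH, Cmod_R, Rabs_pos_eq; lra. }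
  exists (2 * M). intros n.
  rewrite Rabs_pos_eq by (apply Rmult_le_pos; [apply Cmod_ge_0 | apply pow_le; lra]).
  rewrite Hp.
  set (u := fun k => @scal C_AbsRing C_NormedModule (pow_n (RtoC rho) k) (a k)).
  change (forall n, @norm C_AbsRing C_NormedModule (sum_n u n) <= M) in HM.
  change (Cmod (u n) <= 2 * M). clearbody u.
  destruct n as [|n].
  - assert (H1 := HM 0%nat). assert (H2 := Cmod_ge_0 (u 0%nat)). rewrite sum_O in H1.
    change (Cmod (u 0%nat) <= M) in H1. lra.
  - assert (H1 := HM (S n)). assert (H2 := HM n). rewrite sum_Sn in H1.
    change (Cmod (sum_n u n + u (S n))%C <= M) in H1. change (Cmod (sum_n u n) <= M) in H2.
    replace (u (S n)) with ((sum_n u n + u (S n)) + - (sum_n u n))%C by ring.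
    apply Rle_trans with (1 := Cmod_triangle _ _). rewrite Cmod_opp. lra.
Qed.

(** The derivative is delivered as a quadratic estimate and not as a
    differentiability statement, so that the centre of the series can be moved
    by plain substitution. *)
Lemma is_C_derive_pseries (a : nat -> C) (r : R) (f : C -> C) :
  (forall h, Cmod h < r -> @is_pseries C_AbsRing C_NormedModule a h (f h)) ->
  forall h, Cmod h < r -> exists l,
    @is_pseries C_AbsRing C_NormedModule (fun n => RtoC (INR (S n)) * a (S n))%C h l /\
    exists d K, 0 < d /\ forall k, Cmod (k - h)%C < d ->
      Cmod (f k - f h - l * (k - h))%C <= K * Cmod (k - h)%C ^ 2.
Proof.
  intros Hf h Hh.
  assert (H0 := Cmod_ge_0 h).
  (* the series converges at rho, and its derived series absolutely at s < rho *)
  set (rho := (Cmod h + 2 * r) / 3). set (s := (2 * Cmod h + r) / 3).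
  assert (Hs : 0 < s < rho) by (unfold s, rho; lra).
  assert (Hrho : rho < r) by (unfold rho; lra).
  assert (Hhs : Cmod h < s) by (unfold s; lra).
  assert (Hb : exists M, forall n, Rabs (Cmod (a n) * rho ^ n) <= M).
  { apply is_pseries_bounded_coef with (f (RtoC rho)); [lra|].
    apply Hf. rewrite Cmod_R, Rabs_pos_eq; lra. }
  destruct (ex_series_scaled_derivs _ _ _ Hs Hb) as [E1 [K E2]].
  assert (Hl : ex_series (fun n => @scal C_AbsRing C_NormedModule (pow_n h n) (RtoC (INR (S n)) * a (S n))%C)).
  { apply (@ex_series_le C_AbsRing C_CompleteNormedModule) with (2 := E1). intros n.
    change (Cmod (pow_n h n * (RtoC (INR (S n)) * a (S n)))%C <= INR (S n) * Cmod (a (S n)) * s ^ n).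
    rewrite !Cmod_mult, Cmod_R, Rabs_pos_eq by apply pos_INR.
    destruct (pow_n_C_bound h h s n) as [_ Hp]; try lra.
    rewrite Rmult_comm. apply Rmult_le_compat_l; auto.
    apply Rmult_le_pos; auto using pos_INR, Cmod_ge_0. }
  destruct Hl as [l Hl]. exists l. split; [exact Hl|].
  exists (s - Cmod h), K. split; [lra|].
  intros k Hk.
  assert (Hks : Cmod k < s).
  { replace k with ((k - h) + h)%C by ring. apply Rle_lt_trans with (1 := Cmod_triangle _ _). lra. }
  assert (Hfk := Hf k (Rlt_trans _ _ _ Hks (Rlt_trans _ _ _ (proj2 Hs) Hrho))).
  assert (Hfh := Hf h Hh).
  assert (D0 := is_series_minus _ _ _ _ Hfk Hfh).
  assert (D : @is_series C_AbsRing C_NormedModule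
    (fun n => (pow_n k (S n) * a (S n) - pow_n h (S n) * a (S n))%C) (f k - f h)%C).
  { apply (@is_series_incr_1 C_AbsRing C_NormedModule
      (fun n => (pow_n k n * a n - pow_n h n * a n)%C)).
    change (@is_series C_AbsRing C_NormedModule (fun n => (pow_n k n * a n - pow_n h n * a n)%C)
      (f k - f h + (RtoC 1 * a 0%nat - RtoC 1 * a 0%nat))%C).
    replace (f k - f h + (RtoC 1 * a 0%nat - RtoC 1 * a 0%nat))%C with (f k - f h)%C by ring.
    exact D0. }
  assert (D2 := is_series_minus _ _ _ _ D (is_series_scal_l (K := C_AbsRing) (k - h)%C _ _ Hl)).
  replace (f k - f h - l * (k - h))%C with (f k - f h - (k - h) * l)%C by ring.
  apply norm_series_le with (1 := D2) (b := fun n => INR (S n) * INR n * Cmod (a (S n)) * s ^ pred n * Cmod (k - h)%C ^ 2).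
  - rewrite Rmult_comm. apply is_series_ext with (2 := is_series_scal_l (Cmod (k - h)%C ^ 2) _ _ E2).
    intros n. apply Rmult_comm.
  - intros n.
    change (Cmod ((pow_n k (S n) * a (S n) - pow_n h (S n) * a (S n)) - (k - h) * (pow_n h n * (RtoC (INR (S n)) * a (S n))))%C <= 
       INR (S n) * INR n * Cmod (a (S n)) * s ^ pred n * Cmod (k - h)%C ^ 2).
    replace ((pow_n k (S n) * a (S n) - pow_n h (S n) * a (S n)) - (k - h) * (pow_n h n * (RtoC (INR (S n)) * a (S n))))%C
     with ((pow_n k (S n) - pow_n h (S n) - RtoC (INR (S n)) * pow_n h n * (k - h)) * a (S n))%C by ring.
    rewrite Cmod_mult.
    destruct (pow_n_C_bound h k s n) as [Hp _]; try lra.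
    apply Rmult_le_compat_r with (r := Cmod (a (S n))) in Hp; [|apply Cmod_ge_0].
    apply Rle_trans with (1 := Hp). right; ring.
Qed.

Lemma analytic_at_derive (F : C -> C) (z0 : C) :
  analytic_at F z0 ->
  analytic_at (C_derive F) z0 /\ @is_derive C_AbsRing C_NormedModule F z0 (C_derive F z0).
Proof.
  intros (a & r & Hr & Ha).
  assert (H : forall z, Cmod (z - z0)%C < r ->
    @is_pseries C_AbsRing C_NormedModule (fun n => RtoC (INR (S n)) * a (S n))%C (z - z0)%C (C_derive F z) /\
    @is_derive C_AbsRing C_NormedModule F z (C_derive F z)).
  { intros z Hz.
    destruct (is_C_derive_pseries a r (fun h => F (h + z0)%C)) with (z - z0)%C as (l & Hl & d & K & Hd & HK); auto.
    { intros h Hh. specialize (Ha (h + z0)%C). replace (h + z0 - z0)%C with h in Ha by ring. auto. }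
    assert (HdF : @is_derive C_AbsRing C_NormedModule F z l).
    { apply is_C_derive_quadratic with d K; auto. intros k Hk. specialize (HK (k - z0)%C).
      replace (k - z0 - (z - z0))%C with (k - z)%C in HK by ring.
      replace (k - z0 + z0)%C with k in HK by ring.
      replace (z - z0 + z0)%C with z in HK by ring. auto. }
    rewrite (is_C_derive_unique _ _ _ HdF). auto. }
  split.
  - exists (fun n => RtoC (INR (S n)) * a (S n))%C, r. split; auto. intros z Hz. apply H; auto.
  - apply H. replace (z0 - z0)%C with (RtoC 0) by ring. rewrite Cmod_0. auto.
Qed.

(** * Holomorphic functions along real curves *)

(** Complex differentiability in the form in which it is used: the chain rule
    along real curves, componentwise.  In this form the cosine is handled by
    real differentiation of its two components. *)
Definition curve_derive (F F1 : C -> C) (z : C) : Prop :=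
  forall (x y : R -> R) (t dx dy : R),
    is_derive x t dx -> is_derive y t dy -> (x t, y t) = z ->
    is_derive (fun s => fst (F (x s, y s))) t (fst (F1 z * (dx, dy))%C) /\
    is_derive (fun s => snd (F (x s, y s))) t (snd (F1 z * (dx, dy))%C).

Definition continuous_2d (F : C -> C) (z : C) : Prop :=
  continuity_2d_pt (fun x y => fst (F (x, y))) (fst z) (snd z) /\
  continuity_2d_pt (fun x y => snd (F (x, y))) (fst z) (snd z).

Definition holomorphic_C1 (F F1 : C -> C) (z : C) : Prop :=
  curve_derive F F1 z /\ continuous_2d F1 z.

Lemma snd_le_Cmod (z : C) : Rabs (snd z) <= Cmod z.
Proof. apply Rle_trans with (2 := Rmax_Cmod z), Rmax_r. Qed.

Lemma fst_le_Cmod (z : C) : Rabs (fst z) <= Cmod z.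
Proof. apply Rle_trans with (2 := Rmax_Cmod z), Rmax_l. Qed.

Lemma is_C_derive_real_bound (F : C -> C) (z l : C) (eps : posreal) :
  @is_derive C_AbsRing C_NormedModule F z l ->
  locally_2d (fun u v =>
    Cmod (F (u, v) - F z - l * ((u, v) - z))%C <=
      eps * Rmax (Rabs (u - fst z)) (Rabs (v - snd z))) (fst z) (snd z).
Proof.
  intros [_ H].
  assert (Hs : 0 < sqrt 2) by (apply sqrt_lt_R0; lra).
  assert (He : 0 < eps / sqrt 2) by (apply Rdiv_lt_0_compat; [apply cond_pos|auto]).
  specialize (H z (fun P HP => HP) (mkposreal _ He)).
  apply (@locally_norm_le_locally C_AbsRing (AbsRing_NormedModule C_AbsRing)) in H.
  destruct H as [d Hd].
  assert (Hd' : 0 < d / sqrt 2) by (apply Rdiv_lt_0_compat; [apply cond_pos|auto]).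
  exists (mkposreal _ Hd'). simpl. intros u v Hu Hv.
  assert (Hm : Cmod ((u, v) - z)%C <= sqrt 2 * Rmax (Rabs (u - fst z)) (Rabs (v - snd z))).
  { apply (Cmod_2Rmax ((u, v) - z)%C). }
  assert (HM : Rmax (Rabs (u - fst z)) (Rabs (v - snd z)) < d / sqrt 2) by (apply Rmax_lub_lt; auto).
  assert (Hlt : Cmod ((u, v) - z)%C < d).
  { apply Rle_lt_trans with (1 := Hm). apply Rmult_lt_compat_l with (1 := Hs) in HM.
    replace (sqrt 2 * (d / sqrt 2)) with (pos d) in HM by (field; lra). auto. }
  specialize (Hd (u, v) Hlt). simpl in Hd.
  change (Cmod ((F (u, v) - F z) - ((u, v) - z) * l)%C <= eps / sqrt 2 * Cmod ((u, v) - z)%C) in Hd.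
  replace (F (u, v) - F z - l * ((u, v) - z))%C with ((F (u, v) - F z) - ((u, v) - z) * l)%C by ring.
  apply Rle_trans with (1 := Hd).
  apply Rmult_le_compat_l with (r := eps / sqrt 2) in Hm; [|lra].
  apply Rle_trans with (1 := Hm). right. field. lra.
Qed.

Lemma is_C_derive_curve (F F1 : C -> C) (z : C) :
  @is_derive C_AbsRing C_NormedModule F z (F1 z) -> curve_derive F F1 z.
Proof.
  intros H x y t dx dy Hx Hy Hz.
  apply is_derive_Reals in Hx. apply is_derive_Reals in Hy.
  assert (E1 : fst z = x t) by now rewrite <- Hz.
  assert (E2 : snd z = y t) by now rewrite <- Hz.
  set (l := F1 z) in *. destruct l as [l1 l2] eqn:El.
  split; apply is_derive_Reals.
  - replace (fst ((l1, l2) * (dx, dy))%C) with (l1 * dx + (- l2) * dy) by (simpl; ring).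
    apply (derivable_pt_lim_comp_2d (fun u v => fst (F (u, v)))); auto.
    intros eps. destruct (is_C_derive_real_bound _ _ _ eps H) as [d Hd].
    exists d. rewrite <- E1, <- E2. intros u v Hu Hv.
    apply Rle_trans with (2 := Hd u v Hu Hv).
    apply Rle_trans with (2 := fst_le_Cmod _). right. f_equal.
    rewrite <- surjective_pairing. simpl. ring.
  - replace (snd ((l1, l2) * (dx, dy))%C) with (l2 * dx + l1 * dy) by (simpl; ring).
    apply (derivable_pt_lim_comp_2d (fun u v => snd (F (u, v)))); auto.
    intros eps. destruct (is_C_derive_real_bound _ _ _ eps H) as [d Hd].
    exists d. rewrite <- E1, <- E2. intros u v Hu Hv.
    apply Rle_trans with (2 := Hd u v Hu Hv).
    apply Rle_trans with (2 := snd_le_Cmod _). right. f_equal.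
    rewrite <- surjective_pairing. simpl. ring.
Qed.

Lemma is_C_derive_continuous_2d (F : C -> C) (z l : C) :
  @is_derive C_AbsRing C_NormedModule F z l -> continuous_2d F z.
Proof.
  intros H.
  assert (K : forall eps : posreal, locally_2d (fun u v => Cmod (F (u, v) - F z)%C < eps) (fst z) (snd z)).
  { intros eps. destruct (is_C_derive_real_bound _ _ _ (mkposreal 1 Rlt_0_1) H) as [d Hd].
    assert (Hs : 0 < sqrt 2) by (apply sqrt_lt_R0; lra).
    assert (Hl := Cmod_ge_0 l).
    assert (Hk : 0 < 1 + Cmod l * sqrt 2) by nra.
    assert (Hd' : 0 < Rmin d (eps / (1 + Cmod l * sqrt 2))).
    { apply Rmin_pos; [apply cond_pos|]. apply Rdiv_lt_0_compat; [apply cond_pos|auto]. }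
    exists (mkposreal _ Hd'). simpl. intros u v Hu Hv.
    assert (HM : Rmax (Rabs (u - fst z)) (Rabs (v - snd z)) < eps / (1 + Cmod l * sqrt 2)).
    { apply Rmax_lub_lt; eapply Rlt_le_trans; try eassumption; apply Rmin_r. }
    specialize (Hd u v (Rlt_le_trans _ _ _ Hu (Rmin_l _ _)) (Rlt_le_trans _ _ _ Hv (Rmin_l _ _))).
    simpl in Hd. 
    assert (Hm : Cmod ((u, v) - z)%C <= sqrt 2 * Rmax (Rabs (u - fst z)) (Rabs (v - snd z))).
    { apply (Cmod_2Rmax ((u, v) - z)%C). }
    set (m := Rmax (Rabs (u - fst z)) (Rabs (v - snd z))) in *.
    replace (F (u, v) - F z)%C with ((F (u, v) - F z - l * ((u, v) - z)) + l * ((u, v) - z))%C by ring.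
    apply Rle_lt_trans with (1 := Cmod_triangle _ _). rewrite Cmod_mult.
    apply Rle_lt_trans with ((1 + Cmod l * sqrt 2) * m). nra.
    apply Rmult_lt_compat_l with (1 := Hk) in HM.
    replace ((1 + Cmod l * sqrt 2) * (eps / (1 + Cmod l * sqrt 2))) with (pos eps) in HM by (field; lra). auto. }
  split; intros eps; destruct (K eps) as [d Hd]; exists d; intros u v Hu Hv;
   apply Rle_lt_trans with (2 := Hd u v Hu Hv); rewrite <- surjective_pairing.
  - apply (fst_le_Cmod (F (u, v) - F z)%C).
  - apply (snd_le_Cmod (F (u, v) - F z)%C).
Qed.

Lemma analytic_holomorphic_C1 (F : C -> C) (z : C) :
  analytic_at F z -> holomorphic_C1 F (C_derive F) z.
Proof.
  intros H. destruct (analytic_at_derive F z H) as [H1 H2]. split.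
  - apply is_C_derive_curve, H2.
  - apply is_C_derive_continuous_2d with (C_derive (C_derive F) z).
    apply analytic_at_derive, H1.
Qed.

Lemma holomorphic_C1_scal (k : C) (F F1 : C -> C) (z : C) :
  holomorphic_C1 F F1 z ->
  holomorphic_C1 (fun w => k * F w)%C (fun w => k * F1 w)%C z.
Proof.
  intros [Hd [Hc1 Hc2]]. destruct k as [k1 k2]. split.
  - intros x y t dx dy Hx Hy Hz. destruct (Hd x y t dx dy Hx Hy Hz) as [H1 H2].
    split; simpl in *.
    + match goal with |- is_derive _ _ ?l => replace l with
        (k1 * (fst (F1 z) * dx - snd (F1 z) * dy) - k2 * (fst (F1 z) * dy + snd (F1 z) * dx)) by ring end.
      exact (is_derive_minus _ _ _ _ _ (is_derive_scal _ _ k1 _ H1) (is_derive_scal _ _ k2 _ H2)).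
    + match goal with |- is_derive _ _ ?l => replace l with
        (k1 * (fst (F1 z) * dy + snd (F1 z) * dx) + k2 * (fst (F1 z) * dx - snd (F1 z) * dy)) by ring end.
      exact (is_derive_plus _ _ _ _ _ (is_derive_scal _ _ k1 _ H2) (is_derive_scal _ _ k2 _ H1)).
  - split; simpl.
    + apply continuity_2d_pt_minus; apply continuity_2d_pt_mult; auto using continuity_2d_pt_const.
    + apply continuity_2d_pt_plus; apply continuity_2d_pt_mult; auto using continuity_2d_pt_const.
Qed.

Lemma holomorphic_C1_minus (F F1 G G1 : C -> C) (z : C) :
  holomorphic_C1 F F1 z -> holomorphic_C1 G G1 z ->
  holomorphic_C1 (fun w => F w - G w)%C (fun w => F1 w - G1 w)%C z.
Proof.
  intros [Hd [Hc1 Hc2]] [Kd [Kc1 Kc2]]. split.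
  - intros x y t dx dy Hx Hy Hz.
    destruct (Hd x y t dx dy Hx Hy Hz) as [H1 H2].
    destruct (Kd x y t dx dy Hx Hy Hz) as [K1 K2].
    split; simpl in *.
    + replace ((fst (F1 z) + - fst (G1 z)) * dx - (snd (F1 z) + - snd (G1 z)) * dy)
        with ((fst (F1 z) * dx - snd (F1 z) * dy) - (fst (G1 z) * dx - snd (G1 z) * dy)) by ring.
      exact (is_derive_minus _ _ _ _ _ H1 K1).
    + replace ((fst (F1 z) + - fst (G1 z)) * dy + (snd (F1 z) + - snd (G1 z)) * dx)
        with ((fst (F1 z) * dy + snd (F1 z) * dx) - (fst (G1 z) * dy + snd (G1 z) * dx)) by ring.
      exact (is_derive_minus _ _ _ _ _ H2 K2).
  - split; simpl; apply continuity_2d_pt_plus; auto; apply continuity_2d_pt_opp; auto.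
Qed.

(** * Cauchy's estimate *)

Lemma is_derive_eq (f : R -> R) (x l l' : R) : is_derive f x l -> l = l' -> is_derive f x l'.
Proof. intros H <-; exact H. Qed.

Lemma is_derive_continuity_pt (f : R -> R) (x l : R) : is_derive f x l -> continuity_pt f x.
Proof. intros H. apply continuity_pt_filterlim. apply (ex_derive_continuous f x). now exists l. Qed.


(** Euler's equation [r A' = A] makes [A r / r] constant on [r > 0], and the
    constant is identified by the derivative at [0]. *)
Lemma linear_of_euler_equation (A B : R -> R) (rho : R) :
  (forall r, Rabs r < rho -> is_derive A r (B r)) ->
  (forall r, Rabs r < rho -> A r = r * B r) ->
  forall r, 0 < r < rho -> A r = r * B 0.
Proof.
  intros HA HAB r Hr.
  set (c := A r / r).
  assert (Hc : forall s, 0 < s <= r -> A s = s * c).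
  { intros s Hs. 
    destruct (MVT_gen (fun u => A u / u) s r (fun _ => 0)) as [x [_ Hx]].
    - intros x. rewrite Rmin_left, Rmax_right by lra. intros Hx.
      assert (Hxr : Rabs x < rho) by (rewrite Rabs_pos_eq; lra).
      assert (D := is_derive_mult A (fun u => / u) x (B x) (- / x ^ 2) (HA x Hxr)).
      refine (is_derive_eq _ _ _ _ (D _ _) _).
      + auto_derive; [lra | field; lra].
      + intros; apply Rmult_comm.
      + rewrite (HAB x Hxr). change (B x * / x + x * B x * - / x ^ 2 = 0). field. lra.
    - intros x. rewrite Rmin_left, Rmax_right by lra. intros Hx.
      assert (Hxr : Rabs x < rho) by (rewrite Rabs_pos_eq; lra).
      apply (continuity_pt_mult A (fun u => / u)).
      + apply is_derive_continuity_pt with (B x); auto.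
      + apply continuity_pt_inv; [apply continuity_pt_id | lra].
    - unfold c. replace (A r / r) with (A s / s) by lra. field. lra. }
  assert (H0 : B 0 = c).
  { assert (D := HA 0). assert (H00 : Rabs 0 < rho) by (rewrite Rabs_R0; lra).
    specialize (D H00). specialize (HAB 0 H00).
    apply is_derive_Reals in D.
    destruct (Req_dec (B 0) c) as [E|E]; [exact E|exfalso].
    assert (Heps : 0 < Rabs (B 0 - c)) by (apply Rabs_pos_lt; lra).
    destruct (D _ Heps) as [d Hd].
    assert (Hm : 0 < Rmin (d / 2) r) by (apply Rmin_pos; [generalize (cond_pos d)|]; lra).
    set (s := Rmin (d / 2) r) in *.
    assert (Hs : s <= r) by apply Rmin_r. assert (Hs' : s <= d / 2) by apply Rmin_l.
    specialize (Hd s). rewrite Rplus_0_l, (Rabs_minus_sym (B 0) c) in Hd.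
    replace ((A s - A 0) / s - B 0) with (c - B 0) in Hd.
    2:{ rewrite HAB, (Hc s) by lra. field. lra. }
    apply (Rlt_irrefl (Rabs (c - B 0))), Hd; [lra|].
    rewrite Rabs_pos_eq by lra. generalize (cond_pos d); lra. }
  rewrite H0. unfold c. field. lra.
Qed.

(** Cauchy's formula for [F1 z0], in real form: the integrand is the real part
    of [F] on the circle times [exp (- i t)].  With [A r] the integral, the
    radial derivative of the integrand is the real part of [F1], and integrating
    the angular derivative of the imaginary part of the same product over the
    period shows [r A' r = A r]. *)
Lemma cauchy_mean (F F1 : C -> C) (z0 : C) (rho : R) :
  (forall z, Cmod (z - z0)%C < rho -> holomorphic_C1 F F1 z) ->
  forall r, 0 < r < rho ->
  is_RInt (fun t => fst (F (fst z0 + r * cos t, snd z0 + r * sin t)) * cos t +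
                 snd (F (fst z0 + r * cos t, snd z0 + r * sin t)) * sin t) 0 (2 * PI)
    (r * (2 * PI * fst (F1 z0))).
Proof.
  intros HF.
  set (g := fun r t => (fst z0 + r * cos t, snd z0 + r * sin t) : C).
  assert (Hg : forall r t, Rabs r < rho -> Cmod (g r t - z0)%C < rho).
  { intros r t Hr. apply Rle_lt_trans with (2 := Hr). right.
    unfold Cmod, g. simpl. rewrite <- sqrt_Rsqr_abs. f_equal. unfold Rsqr.
    generalize (sin2_cos2 t). unfold Rsqr. nra. }
  set (f := fun r t => fst (F (g r t)) * cos t + snd (F (g r t)) * sin t).
  set (h := fun r t => snd (F (g r t)) * cos t - fst (F (g r t)) * sin t).
  assert (Dr : forall r t, Rabs r < rho -> is_derive (fun s => f s t) r (fst (F1 (g r t)))).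
  { intros r t Hr. destruct (HF _ (Hg r t Hr)) as [Hd _].
    destruct (Hd (fun s => fst z0 + s * cos t) (fun s => snd z0 + s * sin t) r (cos t) (sin t)) as [H1 H2].
    - auto_derive; [auto | ring].
    - auto_derive; [auto | ring].
    - reflexivity.
    - refine (is_derive_eq _ _ _ _ (is_derive_plus _ _ _ _ _ (is_derive_scal_l _ _ _ (cos t) H1) (is_derive_scal_l _ _ _ (sin t) H2)) _).
      real_eq.
      unfold plus, scal; simpl. unfold mult; simpl.
      generalize (sin2_cos2 t). unfold Rsqr. intros E.
      transitivity (fst (F1 (g r t)) * (sin t * sin t + cos t * cos t)); [ring | rewrite E; ring]. }
  assert (Dt : forall r t, Rabs r < rho -> is_derive (fun s => h r s) t (r * fst (F1 (g r t)) - f r t) /\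
      is_derive (fun s => f r s) t (- r * snd (F1 (g r t)) + h r t)).
  { intros r t Hr. destruct (HF _ (Hg r t Hr)) as [Hd _].
    destruct (Hd (fun s => fst z0 + r * cos s) (fun s => snd z0 + r * sin s) t (- r * sin t) (r * cos t)) as [H1 H2].
    - auto_derive; [auto | ring].
    - auto_derive; [auto | ring].
    - reflexivity.
    - assert (Dc : is_derive cos t (- sin t)) by (auto_derive; [auto|ring]).
      assert (Ds : is_derive sin t (cos t)) by (auto_derive; [auto|ring]).
      assert (HC : forall x y : R, mult x y = mult y x) by (intros; apply Rmult_comm).
      assert (P1 := is_derive_mult _ _ _ _ _ H1 Dc HC).
      assert (P2 := is_derive_mult _ _ _ _ _ H2 Dc HC).
      assert (P3 := is_derive_mult _ _ _ _ _ H1 Ds HC).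
      assert (P4 := is_derive_mult _ _ _ _ _ H2 Ds HC).
      split.
      + refine (is_derive_eq _ _ _ _ (is_derive_minus _ _ _ _ _ P2 P3) _).
        real_eq.
        unfold f, minus, plus, opp, mult; simpl. unfold g.
        generalize (sin2_cos2 t). unfold Rsqr. intros E.
        match goal with |- _ = r * ?a - _ => set (A := a) end.
        replace (r * A) with (r * A * (sin t * sin t + cos t * cos t)) by (rewrite E; ring). ring.
      + refine (is_derive_eq _ _ _ _ (is_derive_plus _ _ _ _ _ P1 P4) _).
        real_eq.
        unfold h, minus, plus, opp, mult; simpl. unfold g.
        generalize (sin2_cos2 t). unfold Rsqr. intros E.
        match goal with |- _ = - r * ?a + _ => set (A := a) end.
        replace (- r * A) with (- r * A * (sin t * sin t + cos t * cos t)) by (rewrite E; ring). ring. }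
  assert (C1 : forall r t, Rabs r < rho -> continuity_2d_pt (fun r t => fst (F1 (g r t))) r t).
  { intros r t Hr. destruct (HF _ (Hg r t Hr)) as [_ [Hc _]].
    apply continuity_2d_pt_filterlim in Hc. apply continuity_2d_pt_filterlim.
    apply (filterlim_comp _ _ _ (fun z : R * R => g (fst z) (snd z)) (fun w => fst (F1 (fst w, snd w))) _ (locally (g r t))); [|exact Hc].
    apply (filterlim_ext (fun z : R * R => (fst (g (fst z) (snd z)), snd (g (fst z) (snd z))))); [reflexivity|].
    intros P [e HP].
    assert (K1 : continuity_2d_pt (fun r t => fst z0 + r * cos t) r t).
    { apply continuity_2d_pt_plus; [apply continuity_2d_pt_const|].
      apply continuity_2d_pt_mult; [apply continuity_2d_pt_id1|].
      apply continuity_1d_2d_pt_comp; [apply continuity_cos | apply continuity_2d_pt_id2]. }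
    assert (K2 : continuity_2d_pt (fun r t => snd z0 + r * sin t) r t).
    { apply continuity_2d_pt_plus; [apply continuity_2d_pt_const|].
      apply continuity_2d_pt_mult; [apply continuity_2d_pt_id1|].
      apply continuity_1d_2d_pt_comp; [apply continuity_sin | apply continuity_2d_pt_id2]. }
    destruct (K1 e) as [d1 H1]. destruct (K2 e) as [d2 H2].
    assert (Hd : 0 < Rmin d1 d2) by (apply Rmin_pos; apply cond_pos).
    exists (mkposreal _ Hd). intros [u v] [Hu Hv]. simpl in Hu, Hv.
    change (Rabs (u - r) < Rmin d1 d2) in Hu. change (Rabs (v - t) < Rmin d1 d2) in Hv.
    apply HP. split.
    - apply H1; eapply Rlt_le_trans; try eassumption; apply Rmin_l.
    - apply H2; eapply Rlt_le_trans; try eassumption; apply Rmin_r. }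
  assert (C2 : forall r t, Rabs r < rho -> continuous (fun t => fst (F1 (g r t))) t).
  { intros r t Hr. apply continuity_pt_filterlim. intros eps Heps.
    destruct (C1 r t Hr (mkposreal _ Heps)) as [d Hd]. exists d. split; [apply cond_pos|].
    intros x [_ Hx]. apply Hd; [rewrite Rminus_diag, Rabs_R0; apply cond_pos | apply Hx]. }
  assert (Cf : forall r t, Rabs r < rho -> continuous (fun t => f r t) t).
  { intros r t Hr. apply (ex_derive_continuous (fun t => f r t)). eexists. apply Dt; auto. }
  set (A := fun r => RInt (f r) 0 (2 * PI)).
  set (B := fun r => RInt (fun t => fst (F1 (g r t))) 0 (2 * PI)).
  assert (HA : forall r, Rabs r < rho -> is_derive A r (B r)).
  { intros r Hr. unfold A, B.
    assert (Hloc : locally r (fun s => Rabs s < rho)).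
    { assert (Hd : 0 < rho - Rabs r) by lra. exists (mkposreal _ Hd). intros s Hs.
      change (Rabs (s - r) < rho - Rabs r) in Hs.
      replace s with ((s - r) + r) by ring. apply Rle_lt_trans with (1 := Rabs_triang _ _). lra. }
    rewrite (RInt_ext (fun t => fst (F1 (g r t))) (fun t => Derive (fun u => f u t) r)).
    2:{ intros t _. symmetry. apply is_derive_unique; auto. }
    apply is_derive_RInt_param.
    - apply filter_imp with (2 := Hloc). intros s Hs t _. eexists; apply Dr; auto.
    - intros t _. apply continuity_2d_pt_ext_loc with (2 := C1 r t Hr).
      destruct Hloc as [d Hd]. exists d. intros u v Hu _. symmetry. apply is_derive_unique, Dr, Hd, Hu.
    - apply filter_imp with (2 := Hloc). intros s Hs. apply (ex_RInt_continuous (f s)). auto. }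
  assert (HAB : forall r, Rabs r < rho -> A r = r * B r).
  { intros r Hr. unfold A, B.
    assert (I : is_RInt (fun t => r * fst (F1 (g r t)) - f r t) 0 (2 * PI) (h r (2 * PI) - h r 0)).
    { apply (is_RInt_derive (fun t => h r t)).
      - intros t _. apply Dt; auto.
      - intros t _. apply (continuous_minus (fun t => r * fst (F1 (g r t))) (f r)); auto.
        apply (continuous_scal_r r (fun t => fst (F1 (g r t)))); auto. }
    replace (h r (2 * PI) - h r 0) with 0 in I.
    2:{ unfold h, g. rewrite cos_2PI, sin_2PI, cos_0, sin_0. ring. }
    assert (J1 : ex_RInt (fun t => fst (F1 (g r t))) 0 (2 * PI)) by (apply (ex_RInt_continuous (V := R_CompleteNormedModule)); auto).
    assert (J2 : ex_RInt (f r) 0 (2 * PI)) by (apply (ex_RInt_continuous (f r)); auto).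
    apply (RInt_correct (V := R_CompleteNormedModule)) in J1.
    apply (RInt_correct (V := R_CompleteNormedModule)) in J2.
    assert (J := is_RInt_minus _ _ _ _ _ _ (is_RInt_scal _ _ _ r _ J1) J2).
    apply (is_RInt_unique (V := R_CompleteNormedModule)) in I.
    apply (is_RInt_unique (V := R_CompleteNormedModule)) in J.
    assert (E : 0 = r * RInt (fun t : R => fst (F1 (g r t))) 0 (2 * PI) - RInt (f r) 0 (2 * PI)).
    { exact (eq_trans (eq_sym I) J). }
    lra. }
  intros r Hr.
  replace (r * (2 * PI * fst (F1 z0))) with (A r).
  { apply (RInt_correct (V := R_CompleteNormedModule) (f r)), (ex_RInt_continuous (f r)).
    intros t _. apply Cf. rewrite Rabs_pos_eq; lra. }
  rewrite (linear_of_euler_equation A B rho HA HAB r Hr). f_equal. unfold B.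
  rewrite (RInt_ext _ (fun _ => fst (F1 z0))).
  - rewrite RInt_const. unfold scal; simpl. unfold mult; simpl. ring.
  - intros t _. unfold g. rewrite !Rmult_0_l, !Rplus_0_r. now rewrite <- surjective_pairing.
Qed.

(** Multiply [F] by the unit number that makes [F1 z0] real and nonnegative,
    and bound the integrand of [cauchy_mean] by [M]. *)
Lemma cauchy_estimate (F F1 : C -> C) (z0 : C) (rho r M : R) :
  0 < r < rho ->
  (forall z, Cmod (z - z0)%C < rho -> holomorphic_C1 F F1 z /\ Cmod (F z) <= M) ->
  Cmod (F1 z0) <= M / r.
Proof.
  intros Hr HF.
  assert (HM : 0 <= M).
  { apply Rle_trans with (1 := Cmod_ge_0 (F z0)). apply HF.
    replace (z0 - z0)%C with (RtoC 0) by ring. rewrite Cmod_0. lra. }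
  destruct (Req_dec (Cmod (F1 z0)) 0) as [E0|E0].
  { rewrite E0. apply Rdiv_le_0_compat; lra. }
  assert (Hp : 0 < Cmod (F1 z0)) by (generalize (Cmod_ge_0 (F1 z0)); lra).
  set (k := (Cconj (F1 z0) / RtoC (Cmod (F1 z0)))%C).
  assert (Hk : Cmod k = 1).
  { unfold k. rewrite Cmod_div by (intros K; apply RtoC_inj in K; lra).
    rewrite Cmod_conj, Cmod_R, Rabs_pos_eq by lra. field. lra. }
  assert (Hk1 : fst (k * F1 z0)%C = Cmod (F1 z0)).
  { assert (E : (k * F1 z0)%C = RtoC (Cmod (F1 z0))).
    { unfold k. replace (Cconj (F1 z0) / Cmod (F1 z0) * F1 z0)%C with ((F1 z0 * Cconj (F1 z0)) / Cmod (F1 z0))%C.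
      2:{ unfold Cdiv. ring. }
      rewrite <- Cmod2_conj. rewrite RtoC_pow. field. intros K; apply RtoC_inj in K; lra. }
    rewrite E. reflexivity. }
  assert (H := cauchy_mean (fun w => k * F w)%C (fun w => k * F1 w)%C z0 rho
     (fun z Hz => holomorphic_C1_scal k _ _ _ (proj1 (HF z Hz))) r Hr).
  cbv beta in H. rewrite Hk1 in H.
  match type of H with is_RInt ?u _ _ _ => set (f := u) in H end.
  assert (Hb : forall t, Rabs (f t) <= M).
  { intros t. unfold f. set (w := (fst z0 + r * cos t, snd z0 + r * sin t)).
    assert (Hw : Cmod (w - z0)%C < rho).
    { apply Rle_lt_trans with r; [|lra]. right. transitivity (sqrt (Rsqr r)); [|apply sqrt_Rsqr; lra].
      unfold Cmod, w. f_equal. unfold Rsqr. generalize (sin2_cos2 t). unfold Rsqr. intros E.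
      transitivity (r * r * (sin t * sin t + cos t * cos t)); [simpl; ring | rewrite E; ring]. }
    apply Rle_trans with (2 := proj2 (HF w Hw)).
    assert (Ec : Cmod (cos t, - sin t) = 1).
    { unfold Cmod. rewrite <- sqrt_1. f_equal. change (cos t ^ 2 + (- sin t) ^ 2 = 1). generalize (sin2_cos2 t). unfold Rsqr. nra. }
    replace (Cmod (F w)) with (Cmod (k * F w * (cos t, (- sin t)%R))%C) by (rewrite !Cmod_mult, Hk, Ec; ring).
    apply Rle_trans with (2 := fst_le_Cmod _). right. f_equal.
    simpl. ring. }
  assert (HPI := PI_RGT_0).
  assert (Hi : ex_RInt f 0 (2 * PI)) by (eexists; exact H).
  apply (is_RInt_unique (V := R_CompleteNormedModule)) in H.
  assert (Hle := abs_RInt_le_const f 0 (2 * PI) M ltac:(lra) Hi (fun t _ => Hb t)).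
  rewrite H, Rabs_pos_eq in Hle.
  2:{ apply Rmult_le_pos; [lra|]. apply Rmult_le_pos; [lra|apply Cmod_ge_0]. }
  apply Rmult_le_reg_r with (2 * PI * r). { apply Rmult_lt_0_compat; lra. }
  replace (M / r * (2 * PI * r)) with ((2 * PI - 0) * M) by (field; lra). lra.
Qed.

(** * Derivatives of cosine-like potentials *)

(** The components of the complex cosine of [z + theta].  Differentiation is the
    shift of [theta] by [PI / 2]. *)
Definition shifted_cos (theta : R) (z : C) : C :=
  (cos (fst z + theta) * ((exp (snd z) + exp (- snd z)) / 2),
   - sin (fst z + theta) * ((exp (snd z) - exp (- snd z)) / 2)).

Lemma Ccos_shift (theta : R) (z : C) : Ccos (z + RtoC theta)%C = shifted_cos theta z.
Proof.
  destruct z as [x y]. unfold Ccos, shifted_cos, Cexp, Cdiv. simpl.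
  rewrite !Rplus_0_r.
  replace (0 * (x + theta) - 1 * y) with (- y) by ring.
  replace (0 * y + 1 * (x + theta)) with (x + theta) by ring.
  replace (- - y) with y by ring. rewrite cos_neg, sin_neg.
  unfold Cmult, Cinv; simpl. f_equal; field.
Qed.

Lemma shifted_cos_holomorphic (theta : R) (z : C) :
  holomorphic_C1 (shifted_cos theta) (shifted_cos (theta + PI / 2)) z.
Proof.
  split.
  - intros x y t dx dy Hx Hy <-. unfold shifted_cos; simpl.
    replace (cos (x t + (theta + PI / 2))) with (- sin (x t + theta))
      by (rewrite <- Rplus_assoc, (cos_plus _ (PI / 2)), cos_PI2, sin_PI2; ring).
    replace (sin (x t + (theta + PI / 2))) with (cos (x t + theta))
      by (rewrite <- Rplus_assoc, (sin_plus _ (PI / 2)), cos_PI2, sin_PI2; ring).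
    assert (X : ex_derive x t) by (eexists; eassumption).
    assert (Y : ex_derive y t) by (eexists; eassumption).
    assert (Ex := is_derive_unique x t dx Hx). assert (Ey := is_derive_unique y t dy Hy).
    change (Derive (fun s : R => x s) t = dx) in Ex. change (Derive (fun s : R => y s) t = dy) in Ey.
    split; auto_derive; auto; rewrite Ex, Ey; field.
  - unfold shifted_cos; split; simpl.
    + apply (continuity_2d_pt_mult (fun x _ => cos (x + (theta + PI / 2))) (fun _ y => (exp y + exp (- y)) / 2)).
      * apply (continuity_1d_2d_pt_comp (fun x => cos (x + (theta + PI / 2))) (fun x _ => x)); [|apply continuity_2d_pt_id1].
        eapply is_derive_continuity_pt. auto_derive; auto.
      * apply (continuity_1d_2d_pt_comp (fun y => (exp y + exp (- y)) / 2) (fun _ y => y)); [|apply continuity_2d_pt_id2].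
        eapply is_derive_continuity_pt. auto_derive; auto.
    + apply (continuity_2d_pt_mult (fun x _ => - sin (x + (theta + PI / 2))) (fun _ y => (exp y - exp (- y)) / 2)).
      * apply (continuity_1d_2d_pt_comp (fun x => - sin (x + (theta + PI / 2))) (fun x _ => x)); [|apply continuity_2d_pt_id1].
        eapply is_derive_continuity_pt. auto_derive; auto.
      * apply (continuity_1d_2d_pt_comp (fun y => (exp y - exp (- y)) / 2) (fun _ y => y)); [|apply continuity_2d_pt_id2].
        eapply is_derive_continuity_pt. auto_derive; auto.
Qed.

Lemma Nat_iter_analytic (F : C -> C) (z : C) (k : nat) :
  analytic_at F z -> analytic_at (Nat.iter k C_derive F) z.
Proof.
  intros H. induction k as [|k IH]; [exact H|]. apply (analytic_at_derive _ _ IH).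
Qed.

(** Each application of Cauchy's estimate costs [1/8] of the width of the strip
    and a factor [16]. *)
Lemma cosine_like_close (F : C -> C) (eta theta g : R) :
  (forall z, Rabs (Im z) < 1 -> analytic_at F z) ->
  (forall z, Rabs (Im z) < 1 -> Cmod (F z - RtoC eta * shifted_cos theta z)%C <= eta * g) ->
  forall k z, Rabs (Im z) < 1 - INR k / 8 ->
    Cmod (Nat.iter k C_derive F z - RtoC eta * shifted_cos (theta + INR k * (PI / 2)) z)%C
      <= eta * g * 16 ^ k.
Proof.
  intros Ha Hc. induction k as [|k IH]; intros z Hz.
  - simpl in *. rewrite Rmult_0_l, Rplus_0_r, Rmult_1_r. apply Hc. lra.
  - replace (eta * g * 16 ^ S k) with ((eta * g * 16 ^ k) / (1 / 16)) by (simpl; field).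
    rewrite S_INR in *.
    replace (theta + (INR k + 1) * (PI / 2)) with (theta + INR k * (PI / 2) + PI / 2) by ring.
    apply (cauchy_estimate (fun w => Nat.iter k C_derive F w - RtoC eta * shifted_cos (theta + INR k * (PI / 2)) w)%C
      (fun w => Nat.iter (S k) C_derive F w - RtoC eta * shifted_cos (theta + INR k * (PI / 2) + PI / 2) w)%C z (1 / 8)); [lra|].
    intros w Hw.
    assert (Hi : Rabs (Im w) < 1 - INR k / 8).
    { replace (Im w) with (Im (w - z)%C + Im z) by (unfold Im; simpl; ring).
      apply Rle_lt_trans with (1 := Rabs_triang _ _).
      apply Rle_lt_trans with (Cmod (w - z)%C + Rabs (Im z)); [|lra].
      apply Rplus_le_compat_r, snd_le_Cmod. }
    split; [|apply IH; exact Hi].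
    apply holomorphic_C1_minus.
    + apply analytic_holomorphic_C1, Nat_iter_analytic, Ha.
      generalize (pos_INR k); lra.
    + apply holomorphic_C1_scal, shifted_cos_holomorphic.
Qed.

Lemma cosine_like_derivatives (G : R -> R) (g : R) :
  cosine_like g G -> g <= / 2 ^ 40 ->
  exists (eta theta : R) (D : nat -> R -> R), 0 < eta /\
    (forall x, D 0%nat x = G x) /\
    (forall k x, is_derive (D k) x (D (S k) x)) /\
    (forall k x, (k <= 4)%nat ->
       Rabs (D k x - eta * cos (x + theta + INR k * (PI / 2))) <= eta * / 2 ^ 24).
Proof.
  intros (Hg & F & (Ha & _ & HG) & eta & theta & He & Hc) Hg40.
  exists eta, theta, (fun k x => fst (Nat.iter k C_derive F (x, 0))).
  assert (Hx : forall x : R, Rabs (Im (x, 0)) < 1) by (intros x; simpl; rewrite Rabs_R0; lra).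
  split; [exact He|]. split; [|split].
  - intros x. change (Nat.iter 0 C_derive F (x, 0)) with (F (RtoC x)). now rewrite HG.
  - intros k x.
    destruct (analytic_holomorphic_C1 _ _ (Nat_iter_analytic F (x, 0) k (Ha _ (Hx x)))) as [Hd _].
    destruct (Hd (fun s => s) (fun _ => 0) x 1 0) as [H1 _].
    + auto_derive; auto.
    + auto_derive; auto.
    + reflexivity.
    + refine (is_derive_eq _ _ _ _ H1 _). simpl. ring.
  - intros k x Hk.
    assert (H := cosine_like_close F eta theta g Ha
      ltac:(intros z Hz; rewrite <- Ccos_shift; apply Hc, Hz) k (x, 0)).
    assert (Hk' : INR k <= 4) by (apply le_INR in Hk; simpl in Hk; lra).
    assert (H16 : 16 ^ k <= 16 ^ 4) by (apply Rle_pow; [lra|exact Hk]).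
    apply Rle_trans with (eta * g * 16 ^ k).
    + refine (Rle_trans _ _ _ _ (H _)).
      2:{ simpl Im. rewrite Rabs_R0. lra. }
      refine (Rle_trans _ _ _ _ (fst_le_Cmod _)). right. f_equal.
      unfold shifted_cos; simpl. rewrite Ropp_0, exp_0, Rplus_assoc. field.
    + rewrite Rmult_assoc. apply Rmult_le_compat_l; [lra|].
      apply Rle_trans with (/ 2 ^ 40 * 16 ^ 4).
      * apply Rmult_le_compat; try lra. apply pow_le; lra.
      * right. field.
Qed.

(** * The bottom-to-separatrix inequality for a nearly cosine well *)

Lemma le_of_derive_le (f g f' g' : R -> R) (c x : R) :
  c <= x ->
  (forall t, c <= t <= x -> is_derive f t (f' t)) ->
  (forall t, c <= t <= x -> is_derive g t (g' t)) ->
  (forall t, c <= t <= x -> f' t <= g' t) ->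
  f c <= g c -> f x <= g x.
Proof.
  intros Hx Hf Hg Hfg Hc.
  destruct (MVT_gen (fun t => g t - f t) c x (fun t => g' t - f' t)) as [t [Ht E]].
  - intros t. rewrite Rmin_left, Rmax_right by auto. intros Ht.
    apply (is_derive_minus g f t (g' t) (f' t)); [apply Hg | apply Hf]; lra.
  - intros t. rewrite Rmin_left, Rmax_right by auto. intros Ht.
    apply is_derive_continuity_pt with (g' t - f' t).
    apply (is_derive_minus g f t (g' t) (f' t)); [apply Hg | apply Hf]; lra.
  - rewrite Rmin_left, Rmax_right in Ht by auto. specialize (Hfg t Ht). nra.
Qed.

(** Iterating this bound replaces Taylor's formula at the bottom of the well. *)
Lemma Rabs_primitive_le (f f' : R -> R) (c x K : R) (n : nat) :
  c <= x ->
  (forall t, c <= t <= x -> is_derive f t (f' t)) ->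
  (forall t, c <= t <= x -> Rabs (f' t) <= K * (t - c) ^ n) ->
  f c = 0 -> Rabs (f x) <= K / INR (S n) * (x - c) ^ S n.
Proof.
  intros Hx Hf Hb Hc.
  assert (Hn : INR (S n) <> 0) by (apply not_0_INR; discriminate).
  assert (D : forall t, is_derive (fun t => K / INR (S n) * (t - c) ^ S n) t (K * (t - c) ^ n)).
  { intros t. apply is_derive_eq with (K / INR (S n) * (INR (S n) * 1 * (t - c) ^ n)); [|field; auto].
    apply is_derive_scal. apply (is_derive_pow (fun t => t - c) (S n)). auto_derive; auto; ring. }
  apply Rabs_le. split.
  - apply (le_of_derive_le (fun t => - (K / INR (S n) * (t - c) ^ S n)) f (fun t => - (K * (t - c) ^ n)) f' c); auto.
    + intros t _. apply (is_derive_opp (fun t => K / INR (S n) * (t - c) ^ S n)), D.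
    + intros t Ht. specialize (Hb t Ht). apply Rabs_le_between in Hb. lra.
    + rewrite Rminus_diag, Hc. simpl. lra.
  - apply (le_of_derive_le f (fun t => K / INR (S n) * (t - c) ^ S n) f' (fun t => (K * (t - c) ^ n)) c); auto.
    + intros t Ht. specialize (Hb t Ht). apply Rabs_le_between in Hb. lra.
    + rewrite Rminus_diag, Hc. simpl. lra.
Qed.

(** A well [v] with its first four derivatives, in units in which the potential
    is close to a cosine.  Besides rough bounds, only the smallness of
    [v''' + v'] and [v'''' + v''] matters: these vanish for [v = 1 - cos]. *)
Record near_cosine_well (v v1 v2 v3 v4 : R -> R) (c : R) : Prop := {
  ncw_d1 : forall x, is_derive v x (v1 x);
  ncw_d2 : forall x, is_derive v1 x (v2 x);
  ncw_d3 : forall x, is_derive v2 x (v3 x);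
  ncw_d4 : forall x, is_derive v3 x (v4 x);
  ncw_0 : v c = 0;
  ncw_1 : v1 c = 0;
  ncw_2 : Rabs (v2 c - 1) <= / 100;
  ncw_3 : forall x, Rabs (v3 x) <= 2;
  ncw_odd : forall x, Rabs (v3 x + v1 x) <= / 2 ^ 23;
  ncw_even : forall x, Rabs (v4 x + v2 x) <= / 2 ^ 23 }.

Lemma ncw_taylor v v1 v2 v3 v4 c : near_cosine_well v v1 v2 v3 v4 c ->
  forall x, c <= x ->
    Rabs (v2 x - v2 c) <= 2 * (x - c) /\
    Rabs (v1 x - v2 c * (x - c)) <= (x - c) ^ 2 /\
    Rabs (v x - v2 c / 2 * (x - c) ^ 2) <= (x - c) ^ 3 / 3 /\
    Rabs (v3 x + v1 x - v3 c) <= / 2 ^ 23 * (x - c).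
Proof.
  intros [D1 D2 D3 D4 H0 H1 H2 H3 Ho He].
  set (a := v2 c).
  assert (A2 : forall x, c <= x -> Rabs (v2 x - a) <= 2 * (x - c)).
  { intros x Hx. replace (2 * (x - c)) with (2 / INR 1 * (x - c) ^ 1) by (simpl; field).
    apply (Rabs_primitive_le (fun t => v2 t - a) v3); auto.
    - intros t _. refine (is_derive_eq _ _ _ _ (is_derive_minus v2 (fun _ => a) t _ 0 (D3 t) _) _); [auto_derive; auto|].
      change (v3 t - 0 = v3 t); ring.
    - intros t _. simpl. rewrite Rmult_1_r; auto.
    - unfold a; ring. }
  assert (A1 : forall x, c <= x -> Rabs (v1 x - a * (x - c)) <= (x - c) ^ 2).
  { intros x Hx. replace ((x - c) ^ 2) with (2 / INR 2 * (x - c) ^ 2) by (simpl; field).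
    apply (Rabs_primitive_le (fun t => v1 t - a * (t - c)) (fun t => v2 t - a)); auto.
    - intros t _. refine (is_derive_eq _ _ _ _ (is_derive_minus v1 (fun t => a * (t - c)) t _ a (D2 t) _) _); [auto_derive; auto; ring|].
      reflexivity.
    - intros t Ht. rewrite pow_1. apply A2; lra.
    - rewrite H1; ring. }
  intros x Hx. split; [auto|]. split; [auto|]. split.
  - replace ((x - c) ^ 3 / 3) with (1 / INR 3 * (x - c) ^ 3) by (simpl; field).
    apply (Rabs_primitive_le (fun t => v t - a / 2 * (t - c) ^ 2) (fun t => v1 t - a * (t - c))); auto.
    + intros t _. refine (is_derive_eq _ _ _ _ (is_derive_minus v (fun t => a / 2 * (t - c) ^ 2) t _ (a * (t - c)) (D1 t) _) _); [auto_derive; auto; field|].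
      reflexivity.
    + intros t Ht. rewrite Rmult_1_l. apply A1; lra.
    + rewrite H0; ring.
  - replace (/ 2 ^ 23 * (x - c)) with (/ 2 ^ 23 / INR 1 * (x - c) ^ 1) by (simpl INR; field).
    apply (Rabs_primitive_le (fun t => v3 t + v1 t - v3 c) (fun t => v4 t + v2 t)); auto.
    + intros t _. refine (is_derive_eq _ _ _ _ (is_derive_minus (fun t => v3 t + v1 t) (fun _ => v3 c) t _ 0 (is_derive_plus v3 v1 t _ _ (D4 t) (D2 t)) _) _); [auto_derive; auto|].
      change (v4 t + v2 t - 0 = v4 t + v2 t); ring.
    + intros t Ht. rewrite pow_O, Rmult_1_r. apply He.
    + rewrite H1; ring.
Qed.

(** The expression vanishes at [c], so it suffices to sign the derivative.  The
    factor of [v1 ^ 3] is chosen so that the quadratic terms of the derivative cancel,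
    which leaves [46/27 v v1], of order [(x - c) ^ 3], plus an error of the same
    order with a tiny constant. *)
Lemma ncw_near v v1 v2 v3 v4 c : near_cosine_well v v1 v2 v3 v4 c ->
  forall x, c <= x <= c + / 16 ->
  0 <= v1 x ^ 2 - 2 * v x * v2 x - 4 / 27 * v x ^ 2 + v3 c / (3 * v2 c ^ 2) * v1 x ^ 3.
Proof.
  intros H x Hx. assert (HT := ncw_taylor _ _ _ _ _ _ H).
  destruct H as [D1 D2 D3 D4 H0 H1 H2 H3 Ho He].
  set (a := v2 c) in *. set (h0 := v3 c) in *.
  assert (Ha : 99 / 100 <= a <= 101 / 100) by (apply Rabs_le_between in H2; lra).
  assert (Hh0 : Rabs h0 <= / 2 ^ 23) by (generalize (Ho c); rewrite H1, Rplus_0_r; auto).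
  set (k := h0 / (3 * a ^ 2)).
  apply (le_of_derive_le (fun _ => 0) (fun x => v1 x ^ 2 - 2 * v x * v2 x - 4 / 27 * v x ^ 2 + k * v1 x ^ 3)
     (fun _ => 0) (fun x => 46 / 27 * v x * v1 x - 2 * v x * (v3 x + v1 x) + 3 * k * v1 x ^ 2 * v2 x) c); [lra| | | |].
  - intros; auto_derive; auto.
  - intros t _. 
    assert (X0 : ex_derive v t) by (eexists; apply D1). assert (E0 := is_derive_unique _ _ _ (D1 t)).
    assert (X1 : ex_derive v1 t) by (eexists; apply D2). assert (E1 := is_derive_unique _ _ _ (D2 t)).
    assert (X2 : ex_derive v2 t) by (eexists; apply D3). assert (E2 := is_derive_unique _ _ _ (D3 t)).
    change (Derive (fun x : R => v x) t = v1 t) in E0.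
    change (Derive (fun x : R => v1 x) t = v2 t) in E1.
    change (Derive (fun x : R => v2 x) t = v3 t) in E2.
    auto_derive; [tauto|]. rewrite E0, E1, E2. field.
  - intros t Ht. destruct (HT t) as (T2 & T1 & T0 & Th); [lra|].
    set (y := t - c) in *. assert (Hy : 0 <= y <= / 16) by (unfold y; lra).
    assert (Hy2 : 0 <= y ^ 2) by nra. assert (Hy3 : 0 <= y ^ 3) by (apply pow_le; lra).
    assert (Hy23 : y ^ 3 <= y ^ 2 / 16) by (simpl in *; nra).
    assert (Hy12 : y ^ 2 <= y / 16) by (simpl in *; nra).
    apply Rabs_le_between in T1. apply Rabs_le_between in T0.
    assert (B1 : 92 / 100 * y <= v1 t <= 11 / 10 * y) by nra.
    assert (B0 : 47 / 100 * y ^ 2 <= v t <= 6 / 10 * y ^ 2) by nra.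
    assert (P : 43 / 100 * y ^ 3 <= v t * v1 t).
    { apply Rle_trans with (47 / 100 * y ^ 2 * (92 / 100 * y)); [simpl; nra|].
      apply Rmult_le_compat; lra. }
    set (Z := v1 t ^ 2 * v2 t - 2 * a ^ 2 * v t).
    assert (BZ : Rabs Z <= 6 * y ^ 3).
    { replace Z with (v1 t ^ 2 * (v2 t - a) + a * ((v1 t - a * y) * (v1 t + a * y)) + - (2 * a ^ 2) * (v t - a / 2 * y ^ 2))
        by (unfold Z; field).
      apply Rle_trans with (1 := Rabs_triang _ _).
      replace (6 * y ^ 3) with ((242 / 100 * y ^ 3 + 223 / 100 * y ^ 3) + 135 / 100 * y ^ 3) by field.
      apply Rplus_le_compat; [apply Rle_trans with (1 := Rabs_triang _ _); apply Rplus_le_compat|]; rewrite !Rabs_mult.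
      - rewrite (Rabs_pos_eq (v1 t ^ 2)) by nra.
        replace (242 / 100 * y ^ 3) with ((11 / 10 * y) ^ 2 * (2 * y)) by field.
        apply Rmult_le_compat; auto using Rabs_pos. nra. apply pow_incr. lra.
      - rewrite (Rabs_pos_eq a), (Rabs_pos_eq (v1 t + a * y)) by nra.
        apply Rle_trans with (101 / 100 * (y ^ 2 * (22 / 10 * y))); [|simpl; nra].
        apply Rmult_le_compat; try lra.
        { apply Rmult_le_pos; [apply Rabs_pos|nra]. }
        apply Rmult_le_compat; try nra; [apply Rabs_pos | apply Rabs_le; lra].
      - rewrite Rabs_Ropp, Rabs_mult, (Rabs_pos_eq 2), (Rabs_pos_eq (a ^ 2)) by nra.
        apply Rle_trans with (2 * (101 / 100) ^ 2 * (y ^ 3 / 3)); [|nra].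
        apply Rmult_le_compat; [nra | apply Rabs_pos | nra | apply Rabs_le; lra]. }
    replace (46 / 27 * v t * v1 t - 2 * v t * (v3 t + v1 t) + 3 * k * v1 t ^ 2 * v2 t)
      with (46 / 27 * (v t * v1 t) + (- (2 * v t * (v3 t + v1 t - h0)) + h0 / a ^ 2 * Z)).
    2:{ unfold k, Z. field. lra. }
    assert (Q1 : Rabs (2 * v t * (v3 t + v1 t - h0)) <= 2 * y ^ 3 * / 2 ^ 23).
    { rewrite Rabs_mult, (Rabs_pos_eq (2 * v t)) by nra.
      apply Rle_trans with ((12 / 10 * y ^ 2) * (/ 2 ^ 23 * y)).
      - apply Rmult_le_compat; try nra. apply Rabs_pos.
      - replace (12 / 10 * y ^ 2 * (/ 2 ^ 23 * y)) with (12 / 10 * (y ^ 3 * / 2 ^ 23)) by ring.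
        assert (0 <= y ^ 3 * / 2 ^ 23) by (apply Rmult_le_pos; [auto|lra]). lra. }
    assert (Q2 : Rabs (h0 / a ^ 2 * Z) <= 12 * y ^ 3 * / 2 ^ 23).
    { unfold Rdiv. rewrite !Rabs_mult.
      assert (Hia : Rabs (/ a ^ 2) <= 2).
      { rewrite Rabs_pos_eq. 2:{ apply Rlt_le, Rinv_0_lt_compat; nra. }
        replace 2 with (/ (1 / 2)) by field. apply Rinv_le_contravar; nra. }
      replace (12 * y ^ 3 * / 2 ^ 23) with (/ 2 ^ 23 * 2 * (6 * y ^ 3)) by field.
      apply Rmult_le_compat; auto using Rabs_pos.
      - apply Rmult_le_pos; apply Rabs_pos.
      - apply Rmult_le_compat; auto using Rabs_pos. }
    apply Rabs_le_between in Q1. apply Rabs_le_between in Q2.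
    assert (Hs : 14 * y ^ 3 * / 2 ^ 23 <= y ^ 3 / 100).
    { replace (14 * y ^ 3 * / 2 ^ 23) with (y ^ 3 * (14 * / 2 ^ 23)) by ring.
      unfold Rdiv. apply Rmult_le_compat_l; lra. }
    lra.
  - rewrite H0, H1. lra.
Qed.

(** The derivative of [v1 ^ 2 - 2 v v2 - v ^ 2] is [- 2 v (v3 + v1)], so this
    quantity is at least [- 2 ^ (-22) (x - c) v]; for [v >= 2 ^ (-18)] that is
    absorbed by [23/27 v ^ 2]. *)
Lemma ncw_far v v1 v2 v3 v4 c b : near_cosine_well v v1 v2 v3 v4 c ->
  (forall x, c < x < b -> 0 < v1 x) -> b - c <= 2 * PI ->
  forall x, c < x < b -> / 2 ^ 18 <= v x ->
  0 <= v1 x ^ 2 - 2 * v x * v2 x - 4 / 27 * v x ^ 2.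
Proof.
  intros [D1 D2 D3 D4 H0 H1 H2 H3 Ho He] Hpos Hb x Hx Hv.
  assert (Hv1 : forall t, c <= t <= x -> 0 <= v1 t).
  { intros t [[Ht|Ht] Ht']; [apply Rlt_le, Hpos; lra | rewrite <- Ht; lra]. }
  assert (Hv0 : forall t, c <= t <= x -> 0 <= v t).
  { intros t Ht. apply (le_of_derive_le (fun _ => 0) v (fun _ => 0) v1 c); [lra| | | |lra].
    - intros; auto_derive; auto.
    - auto.
    - intros s Hs; apply Hv1; lra. }
  assert (HR : 0 <= v1 x ^ 2 - 2 * v x * v2 x - v x ^ 2 + / 2 ^ 22 * ((x - c) * v x)).
  { apply (le_of_derive_le (fun _ => 0) (fun x => v1 x ^ 2 - 2 * v x * v2 x - v x ^ 2 + / 2 ^ 22 * ((x - c) * v x))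
     (fun _ => 0) (fun x => - 2 * v x * (v3 x + v1 x) + / 2 ^ 22 * (v x + (x - c) * v1 x)) c); [lra| | | |].
    - intros; auto_derive; auto.
    - intros t _. 
      assert (X0 : ex_derive v t) by (eexists; apply D1). assert (E0 := is_derive_unique _ _ _ (D1 t)).
      assert (X1 : ex_derive v1 t) by (eexists; apply D2). assert (E1 := is_derive_unique _ _ _ (D2 t)).
      assert (X2 : ex_derive v2 t) by (eexists; apply D3). assert (E2 := is_derive_unique _ _ _ (D3 t)).
      change (Derive (fun x : R => v x) t = v1 t) in E0.
      change (Derive (fun x : R => v1 x) t = v2 t) in E1.
      change (Derive (fun x : R => v2 x) t = v3 t) in E2.
      generalize (/ 2 ^ 22). intros q.
      auto_derive; [tauto|]. rewrite E0, E1, E2. ring.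
    - intros t Ht. specialize (Hv1 t Ht). specialize (Hv0 t Ht). specialize (Ho t).
      apply Rabs_le_between in Ho.
      replace (/ 2 ^ 22) with (2 * / 2 ^ 23) by field.
      assert (0 <= / 2 ^ 23) by lra. set (q := / 2 ^ 23) in *. 
      assert (v t * (v3 t + v1 t) <= v t * q) by (apply Rmult_le_compat_l; lra).
      assert (0 <= q * ((t - c) * v1 t)) by (apply Rmult_le_pos; [auto|apply Rmult_le_pos; lra]).
      lra.
    - rewrite H0, H1. lra. }
  assert (HPI := PI_4).
  assert (Hl : / 2 ^ 22 * ((x - c) * v x) <= 23 / 27 * v x ^ 2).
  { replace (/ 2 ^ 22 * ((x - c) * v x)) with ((/ 2 ^ 22 * (x - c)) * v x) by ring.
    replace (23 / 27 * v x ^ 2) with (23 / 27 * v x * v x) by ring.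
    apply Rmult_le_compat_r; lra. }
  lra.
Qed.

Lemma ncw_reflect v v1 v2 v3 v4 c : near_cosine_well v v1 v2 v3 v4 c ->
  near_cosine_well (fun x => v (2 * c - x)) (fun x => - v1 (2 * c - x)) (fun x => v2 (2 * c - x))
    (fun x => - v3 (2 * c - x)) (fun x => v4 (2 * c - x)) c.
Proof.
  intros [D1 D2 D3 D4 H0 H1 H2 H3 Ho He].
  assert (Refl : forall f f' : R -> R, (forall x, is_derive f x (f' x)) ->
    forall x, is_derive (fun t => f (2 * c - t)) x (- f' (2 * c - x))).
  { intros f f' H x. apply is_derive_eq with (-1 * f' (2 * c - x)); [|ring].
    apply (is_derive_comp f (fun t => 2 * c - t)); [apply H|]. auto_derive; auto; ring. }
  assert (Refl' : forall f f' : R -> R, (forall x, is_derive f x (f' x)) ->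
    forall x, is_derive (fun t => - f (2 * c - t)) x (f' (2 * c - x))).
  { intros f f' H x. apply is_derive_eq with (- - f' (2 * c - x)); [|ring].
    apply (is_derive_opp (fun t => f (2 * c - t))), Refl, H. }
  assert (Ec : 2 * c - c = c) by ring.
  constructor; try (apply Refl; assumption); try (apply Refl'; assumption); cbv beta; rewrite ?Ec; auto.
  - rewrite H1; ring.
  - intros x. rewrite Rabs_Ropp. auto.
  - intros x. replace (- v3 (2 * c - x) + - v1 (2 * c - x)) with (- (v3 (2 * c - x) + v1 (2 * c - x))) by ring.
    rewrite Rabs_Ropp. auto.
Qed.

(** The regimes of [ncw_near] and [ncw_far] overlap: at distance [1/16] from the
    bottom the well is already higher than [2 ^ (-18)]. *)
Lemma ncw_small v v1 v2 v3 v4 c b : near_cosine_well v v1 v2 v3 v4 c ->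
  (forall x, c < x < b -> 0 < v1 x) ->
  forall x, c < x < b -> v x < / 2 ^ 18 -> x <= c + / 16.
Proof.
  intros H Hpos x Hx Hv. apply Rnot_lt_le. intros Hlt.
  destruct (ncw_taylor _ _ _ _ _ _ H (c + / 16)) as (_ & _ & T & _); [lra|].
  destruct H as [D1 D2 D3 D4 H0 H1 H2 H3 Ho He].
  replace (c + / 16 - c) with (/ 16) in T by ring.
  apply Rabs_le_between in T. apply Rabs_le_between in H2.
  assert (v (c + / 16) <= v x).
  { apply (le_of_derive_le (fun _ => v (c + / 16)) v (fun _ => 0) v1 (c + / 16)); try lra.
    - intros; auto_derive; auto.
    - auto.
    - intros t Ht. apply Rlt_le, Hpos. lra. }
  lra.
Qed.

(** Near the bottom the correction of [ncw_near] contributes the same constant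
    on the two sides, because reflection in [c] changes the sign of the third
    derivative; hence it disappears from the difference. *)
Lemma ncw_two_sided v v1 v2 v3 v4 a c b : near_cosine_well v v1 v2 v3 v4 c ->
  (forall x, c < x < b -> 0 < v1 x) -> (forall x, a < x < c -> v1 x < 0) ->
  b - c <= 2 * PI -> c - a <= 2 * PI ->
  forall x y, c < x < b -> a < y < c -> v x = v y ->
  0 <= (v1 x ^ 2 - 2 * v x * v2 x - 4 / 27 * v x ^ 2) / v1 x ^ 3
     - (v1 y ^ 2 - 2 * v y * v2 y - 4 / 27 * v y ^ 2) / v1 y ^ 3.
Proof.
  intros H Hpos Hneg Hb Ha x y Hx Hy Hxy.
  assert (H' := ncw_reflect _ _ _ _ _ _ H).
  assert (Hpos' : forall x, c < x < 2 * c - a -> 0 < - v1 (2 * c - x)).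
  { intros t Ht. specialize (Hneg (2 * c - t)). lra. }
  assert (Ey : 2 * c - (2 * c - y) = y) by ring.
  assert (Px : 0 < v1 x ^ 3) by (apply pow_lt, Hpos; auto).
  assert (Py : v1 y ^ 3 < 0).
  { assert (K : 0 < (- v1 y) ^ 3) by (apply pow_lt; specialize (Hneg y Hy); lra).
    replace (v1 y ^ 3) with (- (- v1 y) ^ 3) by ring. lra. }
  destruct (Rle_or_lt (/ 2 ^ 18) (v x)) as [Hv|Hv].
  - assert (Fx := ncw_far _ _ _ _ _ _ b H Hpos Hb x Hx Hv).
    assert (Fy := ncw_far _ _ _ _ _ _ (2 * c - a) H' Hpos' ltac:(lra) (2 * c - y) ltac:(lra)).
    cbv beta in Fy. rewrite Ey in Fy. specialize (Fy ltac:(lra)).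
    assert (Q1 : 0 <= (v1 x ^ 2 - 2 * v x * v2 x - 4 / 27 * v x ^ 2) / v1 x ^ 3) by (apply Rdiv_le_0_compat; auto).
    assert (Q2 : 0 <= (v1 y ^ 2 - 2 * v y * v2 y - 4 / 27 * v y ^ 2) / - v1 y ^ 3).
    { apply Rdiv_le_0_compat; lra. }
    replace ((v1 y ^ 2 - 2 * v y * v2 y - 4 / 27 * v y ^ 2) / - v1 y ^ 3) with
      (- ((v1 y ^ 2 - 2 * v y * v2 y - 4 / 27 * v y ^ 2) / v1 y ^ 3)) in Q2 by (field; intros E; rewrite E in Py; lra).
    lra.
  - assert (Sx := ncw_small _ _ _ _ _ _ b H Hpos x Hx Hv).
    assert (Sy := ncw_small _ _ _ _ _ _ (2 * c - a) H' Hpos' (2 * c - y) ltac:(lra)).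
    cbv beta in Sy. rewrite Ey in Sy. specialize (Sy ltac:(lra)).
    assert (Nx := ncw_near _ _ _ _ _ _ H x ltac:(lra)).
    assert (Ny := ncw_near _ _ _ _ _ _ H' (2 * c - y) ltac:(lra)).
    cbv beta in Ny. rewrite Ey in Ny. replace (2 * c - c) with c in Ny by ring.
    set (k := v3 c / (3 * v2 c ^ 2)) in *.
    replace (- v3 c / (3 * v2 c ^ 2)) with (- k) in Ny by (unfold k, Rdiv; ring).
    set (Wx := v1 x ^ 2 - 2 * v x * v2 x - 4 / 27 * v x ^ 2) in *.
    replace ((- v1 y) ^ 2 - 2 * v y * v2 y - 4 / 27 * v y ^ 2) with
      (v1 y ^ 2 - 2 * v y * v2 y - 4 / 27 * v y ^ 2) in Ny by ring.
    set (Wy := v1 y ^ 2 - 2 * v y * v2 y - 4 / 27 * v y ^ 2) in *.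
    replace (- k * (- v1 y) ^ 3) with (k * v1 y ^ 3) in Ny by ring.
    assert (Q1 : 0 <= (Wx + k * v1 x ^ 3) / v1 x ^ 3) by (apply Rdiv_le_0_compat; auto).
    assert (Q2 : 0 <= (Wy + k * v1 y ^ 3) / - v1 y ^ 3) by (apply Rdiv_le_0_compat; lra).
    replace ((Wx + k * v1 x ^ 3) / v1 x ^ 3) with (Wx / v1 x ^ 3 + k) in Q1 by (field; intros E; rewrite E in Px; lra).
    replace ((Wy + k * v1 y ^ 3) / - v1 y ^ 3) with (- (Wy / v1 y ^ 3) - k) in Q2 by (field; intros E; rewrite E in Py; lra).
    lra.
Qed.

Lemma is_derive_div_const (f : R -> R) (x l k : R) :
  is_derive f x l -> is_derive (fun t => f t / k) x (l / k).
Proof. intros H. exact (is_derive_scal_l (V := R_NormedModule) f x l (/ k) H). Qed.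

(** [D 1 c = 0] makes the sine of [c + theta] tiny, hence its cosine close to 1
    or to -1, and [0 <= D 2 c] selects -1. *)
Lemma ncw_of_close (D : nat -> R -> R) (eta theta c : R) : 0 < eta ->
  (forall k x, is_derive (D k) x (D (S k) x)) ->
  (forall k x, (k <= 4)%nat ->
     Rabs (D k x - eta * cos (x + theta + INR k * (PI / 2))) <= eta * / 2 ^ 24) ->
  D 1%nat c = 0 -> 0 <= D 2%nat c ->
  near_cosine_well (fun x => (D 0%nat x - D 0%nat c) / eta) (fun x => D 1%nat x / eta)
    (fun x => D 2%nat x / eta) (fun x => D 3%nat x / eta) (fun x => D 4%nat x / eta) c.
Proof.
  intros He HD Hclose Hc1 Hc2.
  assert (Hd : forall k x, is_derive (fun x => D k x / eta) x (D (S k) x / eta)).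
  { intros k x. apply is_derive_div_const, HD. }
  assert (Hn : forall k x, (k <= 4)%nat -> Rabs (D k x / eta - cos (x + theta + INR k * (PI / 2))) <= / 2 ^ 24).
  { intros k x Hk. specialize (Hclose k x Hk).
    apply Rmult_le_reg_l with eta; auto. rewrite <- (Rabs_pos_eq eta) at 1 by lra.
    rewrite <- Rabs_mult. replace (eta * (D k x / eta - cos (x + theta + INR k * (PI / 2))))
     with (D k x - eta * cos (x + theta + INR k * (PI / 2))) by (field; lra). exact Hclose. }
  assert (S1 : forall u, cos (u + INR 1 * (PI / 2)) = - sin u).
  { intros u. simpl. rewrite Rmult_1_l, cos_plus, cos_PI2, sin_PI2. ring. }
  assert (S2 : forall u, cos (u + INR 2 * (PI / 2)) = - cos u).
  { intros u. simpl. replace (u + (1 + 1) * (PI / 2)) with (u + PI) by field. apply neg_cos. }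
  assert (S3 : forall u, cos (u + INR 3 * (PI / 2)) = sin u).
  { intros u. simpl. replace (u + (1 + 1 + 1) * (PI / 2)) with ((u + PI) + PI / 2) by field.
    rewrite cos_plus, cos_PI2, sin_PI2, neg_sin. ring. }
  assert (S4 : forall u, cos (u + INR 4 * (PI / 2)) = cos u).
  { intros u. simpl. replace (u + (1 + 1 + 1 + 1) * (PI / 2)) with ((u + PI) + PI) by field.
    now rewrite !neg_cos, Ropp_involutive. }
  assert (B1 : forall x, Rabs (D 1%nat x / eta + sin (x + theta)) <= / 2 ^ 24).
  { intros x. generalize (Hn 1%nat x ltac:(lia)). rewrite S1. unfold Rminus. now rewrite Ropp_involutive. }
  assert (B2 : forall x, Rabs (D 2%nat x / eta + cos (x + theta)) <= / 2 ^ 24).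
  { intros x. generalize (Hn 2%nat x ltac:(lia)). rewrite S2. unfold Rminus. now rewrite Ropp_involutive. }
  assert (B3 : forall x, Rabs (D 3%nat x / eta - sin (x + theta)) <= / 2 ^ 24).
  { intros x. generalize (Hn 3%nat x ltac:(lia)). now rewrite S3. }
  assert (B4 : forall x, Rabs (D 4%nat x / eta - cos (x + theta)) <= / 2 ^ 24).
  { intros x. generalize (Hn 4%nat x ltac:(lia)). now rewrite S4. }
  constructor; auto.
  - intros x. apply is_derive_div_const.
    apply (is_derive_eq _ _ (minus (D 1%nat x) 0)); [|change (D 1%nat x - 0 = D 1%nat x); ring].
    apply (is_derive_minus (D 0%nat) (fun _ => D 0%nat c)); [apply HD | auto_derive; auto].
  - unfold Rminus, Rdiv. rewrite Rplus_opp_r. ring.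
  - rewrite Hc1. unfold Rdiv. ring.
  - specialize (B1 c). specialize (B2 c). rewrite Hc1 in B1. unfold Rdiv in B1 at 1. rewrite Rmult_0_l, Rplus_0_l in B1.
    assert (P2 : 0 <= D 2%nat c / eta) by (apply Rdiv_le_0_compat; lra).
    apply Rabs_le_between in B1. apply Rabs_le_between in B2.
    generalize (sin2_cos2 (c + theta)) (COS_bound (c + theta)). unfold Rsqr. intros E [C1 _].
    set (s := sin (c + theta)) in *. set (q := cos (c + theta)) in *. set (p := D 2%nat c / eta) in *.
    assert (Es : s * s <= / 1000) by nra.
    assert (Eq : q <= - (995 / 1000)).
    { apply Rnot_lt_le. intros K. assert (q * q < 999 / 1000); [|lra].
      assert (q <= 1 / 1000) by lra. nra. }
    apply Rabs_le. lra.
  - intros x. specialize (B3 x). apply Rabs_le_between in B3. generalize (SIN_bound (x + theta)). intros.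
    apply Rabs_le. lra.
  - intros x. specialize (B1 x). specialize (B3 x). apply Rabs_le_between in B1. apply Rabs_le_between in B3.
    apply Rabs_le. replace (/ 2 ^ 23) with (2 * / 2 ^ 24) by field. lra.
  - intros x. specialize (B2 x). specialize (B4 x). apply Rabs_le_between in B2. apply Rabs_le_between in B4.
    apply Rabs_le. replace (/ 2 ^ 23) with (2 * / 2 ^ 24) by field. lra.
Qed.

(** * Inverse functions and the region of rotations *)

Lemma strictly_increasing_on (D : R -> Prop) (f f1 : R -> R) :
  (forall x y z, D x -> D z -> x <= y <= z -> D y) ->
  (forall x, D x -> is_derive f x (f1 x)) -> (forall x, D x -> 0 < f1 x) ->
  forall x y, D x -> D y -> x < y -> f x < f y.
Proof.
  intros Hc Hf Hp x y Hx Hy Hxy.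
  destruct (MVT_gen f x y f1) as [t [Ht E]].
  - intros t. rewrite Rmin_left, Rmax_right by lra. intros Ht. apply Hf, (Hc x t y); auto; lra.
  - intros t. rewrite Rmin_left, Rmax_right by lra. intros Ht.
    apply is_derive_continuity_pt with (f1 t). apply Hf, (Hc x t y); auto; lra.
  - rewrite Rmin_left, Rmax_right in Ht by lra.
    assert (0 < f1 t) by (apply Hp, (Hc x t y); auto; lra). nra.
Qed.

Lemma locally_interval (D : R -> Prop) (x e : R) : 0 < e -> locally x D ->
  exists d, 0 < d < e /\ forall y, x - d <= y <= x + d -> D y.
Proof.
  intros He [d Hd]. exists (Rmin d e / 2). assert (H := cond_pos d).
  assert (H1 : 0 < Rmin d e) by (apply Rmin_pos; auto).
  assert (Rmin d e <= d) by apply Rmin_l. assert (Rmin d e <= e) by apply Rmin_r.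
  split; [lra|]. intros y Hy. apply Hd. apply Rabs_lt_between'. lra.
Qed.

(** The intermediate value theorem gives preimages near [x] of all values near
    [f x], and [g] returns them. *)
Lemma inverse_continuous (D : R -> Prop) (f f1 g : R -> R) :
  (forall x, D x -> locally x D) ->
  (forall x y z, D x -> D z -> x <= y <= z -> D y) ->
  (forall x, D x -> is_derive f x (f1 x)) -> (forall x, D x -> 0 < f1 x) ->
  (forall x, D x -> g (f x) = x) ->
  forall x, D x -> forall e, 0 < e ->
    locally (f x) (fun y => D (g y) /\ f (g y) = y /\ Rabs (g y - x) < e).
Proof.
  intros Ho Hc Hf Hp Hg x Hx e He.
  destruct (locally_interval D x e He (Ho x Hx)) as (d & Hd & HD).
  assert (Hl : f (x - d) < f x) by (apply (strictly_increasing_on D f f1); auto; try apply HD; lra).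
  assert (Hr : f x < f (x + d)) by (apply (strictly_increasing_on D f f1); auto; try apply HD; lra).
  assert (Hm : 0 < Rmin (f x - f (x - d)) (f (x + d) - f x)) by (apply Rmin_pos; lra).
  exists (mkposreal _ Hm). intros y Hy. simpl in Hy.
  change (Rabs (y - f x) < Rmin (f x - f (x - d)) (f (x + d) - f x)) in Hy.
  assert (Rmin (f x - f (x - d)) (f (x + d) - f x) <= f x - f (x - d)) by apply Rmin_l.
  assert (Rmin (f x - f (x - d)) (f (x + d) - f x) <= f (x + d) - f x) by apply Rmin_r.
  apply Rabs_lt_between in Hy.
  destruct (IVT_interv (fun t => f t - y) (x - d) (x + d)) as [z [Hz Ez]]; try lra.
  - intros t Ht. apply is_derive_continuity_pt with (f1 t - 0).
    apply (is_derive_minus f (fun _ => y)); [apply Hf, HD; lra | auto_derive; auto].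
  - assert (Ey : y = f z) by lra.
    assert (Hne1 : z <> x - d) by (intros E; subst z; lra).
    assert (Hne2 : z <> x + d) by (intros E; subst z; lra).
    assert (Dz : D z) by (apply HD; lra).
    rewrite Ey, Hg by auto. split; [auto|]. split; [auto|]. apply Rabs_lt_between. lra.
Qed.

Lemma is_derive_inverse (D : R -> Prop) (f f1 g : R -> R) :
  (forall x, D x -> locally x D) ->
  (forall x y z, D x -> D z -> x <= y <= z -> D y) ->
  (forall x, D x -> is_derive f x (f1 x)) -> (forall x, D x -> 0 < f1 x) ->
  (forall x, D x -> g (f x) = x) ->
  forall x, D x -> is_derive g (f x) (/ f1 x).
Proof.
  intros Ho Hc Hf Hp Hg x Hx.
  assert (Hp' := Hp x Hx). set (l := f1 x) in *.
  split; [apply is_linear_scal_l|].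
  intros y0 Hy0 eps. apply (@is_filter_lim_locally_unique R_AbsRing R_NormedModule) in Hy0. subst y0.
  assert (He := cond_pos eps).
  (* a relative error m of f, once m <= l / 2, is one of at most 2 m / l ^ 2 for g *)
  assert (Hm : 0 < Rmin (l / 2) (eps * l ^ 2 / 2)).
  { apply Rmin_pos; [lra|]. assert (0 < l ^ 2) by (apply pow_lt; lra). nra. }
  assert (Hm1 := Rmin_l (l / 2) (eps * l ^ 2 / 2)). assert (Hm2 := Rmin_r (l / 2) (eps * l ^ 2 / 2)).
  set (m := Rmin (l / 2) (eps * l ^ 2 / 2)) in *.
  destruct (Hf x Hx) as [_ Hd].
  destruct (Hd x (fun P H => H) (mkposreal _ Hm)) as [d Hd'].
  generalize (inverse_continuous D f f1 g Ho Hc Hf Hp Hg x Hx d (cond_pos d)).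
  apply filter_imp. intros y (Dy & Ey & Hy).
  specialize (Hd' (g y) Hy).
  change (Rabs ((f (g y) - f x) - (g y - x) * l) <= m * Rabs (g y - x)) in Hd'.
  change (Rabs ((g y - g (f x)) - (y - f x) * / l) <= eps * Rabs (y - f x)).
  rewrite Ey in Hd'. rewrite (Hg x Hx).
  set (k := g y - x) in *. set (q := y - f x) in *.
  assert (H1 : l * Rabs k <= Rabs q + m * Rabs k).
  { replace (l * Rabs k) with (Rabs (q - (q - k * l))).
    - apply Rle_trans with (1 := Rabs_triang _ _). rewrite Rabs_Ropp. lra.
    - replace (q - (q - k * l)) with (l * k) by ring. rewrite Rabs_mult, (Rabs_pos_eq l); lra. }
  assert (Hk := Rabs_pos k). assert (Hq := Rabs_pos q).
  assert (H2 : Rabs k * l <= 2 * Rabs q) by nra.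
  replace (k - q * / l) with (- (q - k * l) * / l) by (field; lra).
  rewrite Rabs_mult, Rabs_Ropp, (Rabs_pos_eq (/ l)) by (apply Rlt_le, Rinv_0_lt_compat; lra).
  apply Rmult_le_reg_r with (l * l); [nra|].
  replace (Rabs (q - k * l) * / l * (l * l)) with (Rabs (q - k * l) * l) by (field; lra).
  apply Rle_trans with (m * Rabs k * l); [apply Rmult_le_compat_r; lra|].
  assert (H3 : m * (Rabs k * l) <= eps * l ^ 2 / 2 * (2 * Rabs q)).
  { apply Rmult_le_compat; try lra. apply Rmult_le_pos; lra. }
  lra.
Qed.

Lemma inverse_second_derivative (D : R -> Prop) (f f1 f2 g : R -> R) :
  (forall x, D x -> locally x D) ->
  (forall x y z, D x -> D z -> x <= y <= z -> D y) ->
  (forall x, D x -> is_derive f x (f1 x)) -> (forall x, D x -> is_derive f1 x (f2 x)) ->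
  (forall x, D x -> 0 < f1 x) ->
  (forall x, D x -> g (f x) = x) ->
  forall x, D x ->
    locally (f x) (fun y => is_derive g y (/ f1 (g y))) /\
    is_derive (fun y => / f1 (g y)) (f x) (- f2 x / f1 x ^ 3).
Proof.
  intros Ho Hc Hf Hf1 Hp Hg x Hx. assert (Hpx := Hp x Hx). split.
  - generalize (inverse_continuous D f f1 g Ho Hc Hf Hp Hg x Hx 1 Rlt_0_1).
    apply filter_imp. intros y (Dy & Ey & _).
    rewrite <- Ey at 1. apply (is_derive_inverse D); auto.
  - assert (Dg := is_derive_inverse D f f1 g Ho Hc Hf Hp Hg x Hx).
    assert (Dc : is_derive (fun y => f1 (g y)) (f x) (/ f1 x * f2 x)).
    { apply (is_derive_comp f1 g); [rewrite Hg; auto | exact Dg]. }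
    apply is_derive_eq with (- (/ f1 x * f2 x) / f1 (g (f x)) ^ 2).
    + apply (is_derive_inv (fun y => f1 (g y))); [exact Dc|]. rewrite Hg; auto; lra.
    + rewrite Hg by auto. field. lra.
Qed.

(** The function [energy] is only specified on the image of the energy range, so
    its derivatives are obtained from the left-inverse property there. *)
Lemma energy_second_derivative (G : R -> R) (N : nat) (theta : nat -> R) (i : nat)
    (D : R -> Prop) (f1 f2 : R -> R) :
  (forall E, energy_range G N theta i E <-> D E) ->
  (forall E, D E -> locally E D) ->
  (forall x y z, D x -> D z -> x <= y <= z -> D y) ->
  (forall E, D E -> is_derive (action G N theta i) E (f1 E)) ->
  (forall E, D E -> is_derive f1 E (f2 E)) ->
  (forall E, D E -> 0 < f1 E) ->
  forall E, D E ->
    twice_derivable (energy G N theta i) (action G N theta i E) /\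
    Derive_n (energy G N theta i) 2 (action G N theta i E) = - f2 E / f1 E ^ 3.
Proof.
  intros HD Ho Hc Hf Hf1 Hp E HE.
  assert (Hinj : forall x y, D x -> D y -> action G N theta i x = action G N theta i y -> x = y).
  { intros x y Hx Hy Exy. destruct (Rtotal_order x y) as [H|[H|H]]; auto; exfalso.
    - assert (K := strictly_increasing_on D _ f1 Hc Hf Hp x y Hx Hy H). lra.
    - assert (K := strictly_increasing_on D _ f1 Hc Hf Hp y x Hy Hx H). lra. }
  assert (Hg : forall x, D x -> energy G N theta i (action G N theta i x) = x).
  { intros x Hx. unfold energy.
    destruct (epsilon_spec (inhabits 0) (fun E => energy_range G N theta i E /\
      action G N theta i E = action G N theta i x)) as [H1 H2].
    - exists x. split; [apply HD; auto | auto].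
    - apply Hinj; auto. apply HD; auto. }
  destruct (inverse_second_derivative D _ f1 f2 _ Ho Hc Hf Hf1 Hp Hg E HE) as [H1 H2].
  assert (H2' : is_derive (Derive (energy G N theta i)) (action G N theta i E) (- f2 E / f1 E ^ 3)).
  { apply is_derive_ext_loc with (2 := H2). revert H1. apply filter_imp.
    intros y Hy. symmetry. apply is_derive_unique, Hy. }
  split; [split|].
  - revert H1. apply filter_imp. intros y Hy. eexists; exact Hy.
  - eexists; exact H2'.
  - simpl. rewrite (Derive_ext _ (Derive (energy G N theta i))) by (intros; apply Derive_ext; reflexivity).
    apply is_derive_unique, H2'.
Qed.

Lemma cubic_tangent (x m : R) : 0 <= x -> 0 <= m -> 3 * m ^ 2 * x - 2 * m ^ 3 <= x ^ 3.
Proof.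
  intros Hx Hm. assert (0 <= (x - m) ^ 2 * (x + 2 * m)) by (apply Rmult_le_pos; [apply pow2_ge_0 | lra]).
  replace (x ^ 3) with (3 * m ^ 2 * x - 2 * m ^ 3 + (x - m) ^ 2 * (x + 2 * m)) by ring. lra.
Qed.

Lemma RInt_Rmult_l (f : R -> R) (a b k : R) :
  ex_RInt f a b -> RInt (fun x => k * f x) a b = k * RInt f a b.
Proof. intros H. exact (RInt_scal (V := R_CompleteNormedModule) f a b k H). Qed.

(** Jensen's inequality for the cube, by integrating the tangent inequality at
    the mean. *)
Lemma cube_mean_le (f : R -> R) (a b : R) : a < b ->
  (forall x, a <= x <= b -> continuous f x) -> (forall x, a <= x <= b -> 0 <= f x) ->
  (/ (b - a) * RInt f a b) ^ 3 <= / (b - a) * RInt (fun x => f x ^ 3) a b.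
Proof.
  intros Hab Hc Hp.
  assert (I1 : ex_RInt f a b).
  { apply (ex_RInt_continuous (V := R_CompleteNormedModule)). intros x. rewrite Rmin_left, Rmax_right by lra. auto. }
  assert (I3 : ex_RInt (fun x => f x ^ 3) a b).
  { apply (ex_RInt_continuous (V := R_CompleteNormedModule)). intros x. rewrite Rmin_left, Rmax_right by lra. intros Hx.
    apply (continuous_comp f (fun y => y ^ 3)); [auto|]. apply (ex_derive_continuous (fun y => y ^ 3)). auto_derive; auto. }
  assert (Hi : 0 < / (b - a)) by (apply Rinv_0_lt_compat; lra).
  set (m := / (b - a) * RInt f a b).
  assert (Hm : 0 <= m).
  { apply Rmult_le_pos; [lra|]. apply RInt_ge_0; auto; [lra|]. intros; apply Hp; lra. }
  assert (IT := is_RInt_minus (V := R_NormedModule) _ _ _ _ _ _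
    (is_RInt_scal (V := R_NormedModule) f a b (3 * m ^ 2) _ (RInt_correct (V := R_CompleteNormedModule) f a b I1))
    (is_RInt_const (V := R_NormedModule) a b (2 * m ^ 3))).
  assert (HT : RInt (fun x => 3 * m ^ 2 * f x - 2 * m ^ 3) a b = 3 * m ^ 2 * RInt f a b - (b - a) * (2 * m ^ 3)).
  { apply (is_RInt_unique (V := R_CompleteNormedModule)). exact IT. }
  assert (HL : RInt (fun x => 3 * m ^ 2 * f x - 2 * m ^ 3) a b <= RInt (fun x => f x ^ 3) a b).
  { apply RInt_le; auto; [lra|eexists; exact IT|]. intros x Hx. apply cubic_tangent; auto. apply Hp; lra. }
  rewrite HT in HL. apply Rmult_le_compat_l with (r := / (b - a)) in HL; [|lra].
  apply Rle_trans with (2 := HL). right.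
  replace (/ (b - a) * (3 * m ^ 2 * RInt f a b - (b - a) * (2 * m ^ 3))) with (3 * m ^ 2 * (/ (b - a) * RInt f a b) - 2 * m ^ 3) by (field; lra).
  fold m. ring.
Qed.

Lemma is_derive_RInt_shift (phi phi1 G : R -> R) (a b E : R) :
  (forall x, continuous G x) -> (forall u, 0 < u -> is_derive phi u (phi1 u)) ->
  (forall u, 0 < u -> continuous phi1 u) ->
  (exists m, m < E /\ forall x, G x <= m) ->
  is_derive (fun E => RInt (fun x => phi (E - G x)) a b) E (RInt (fun x => phi1 (E - G x)) a b).
Proof.
  intros HG Hphi Hc (m & HmE & Hm).
  assert (Hloc : locally E (fun s => m < s)) by (apply (open_gt m); auto).
  assert (Dd : forall s t, m < s -> is_derive (fun u => phi (u - G t)) s (phi1 (s - G t))).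
  { intros s t Hs. apply is_derive_eq with (1 * phi1 (s - G t)); [|ring].
    apply (is_derive_comp phi (fun u => u - G t)); [apply Hphi; generalize (Hm t); lra | auto_derive; auto; ring]. }
  rewrite (RInt_ext (fun t => phi1 (E - G t)) (fun t => Derive (fun u => phi (u - G t)) E)).
  2:{ intros t _. symmetry. apply is_derive_unique; auto. }
  apply is_derive_RInt_param.
  - revert Hloc. apply filter_imp. intros s Hs t _. eexists; apply Dd; auto.
  - intros t _. apply continuity_2d_pt_ext_loc with (fun u v => phi1 (u - G v)).
    + destruct Hloc as [d Hd]. exists d. intros u v Hu _. symmetry. apply is_derive_unique, Dd, Hd, Hu.
    + apply continuity_1d_2d_pt_comp.
      * apply continuity_pt_filterlim, Hc. generalize (Hm t); lra.
      * apply continuity_2d_pt_minus; [apply continuity_2d_pt_id1|].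
        apply (continuity_1d_2d_pt_comp G (fun _ v => v)); [apply continuity_pt_filterlim, HG | apply continuity_2d_pt_id2].
  - revert Hloc. apply filter_imp. intros s Hs.
    apply (ex_RInt_continuous (V := R_CompleteNormedModule)). intros t _.
    apply (continuous_comp (fun x => s - G x) phi).
    + apply (continuous_minus (fun _ => s) G); [apply continuous_const | apply HG].
    + apply (ex_derive_continuous phi). eexists; apply Hphi. generalize (Hm t); lra.
Qed.

(** With [h = (E - G) ^ (-1/2)] the two derivatives of the action are [<h> / 2]
    and [- <h ^ 3> / 4], and [<h> ^ 3 <= <h ^ 3>]. *)
Lemma rotation_energy_convex (G : R -> R) (N : nat) (theta : nat -> R) (i : nat) :
  (forall x, continuous G x) -> (forall x, G x <= G (theta i)) ->
  i = 0%nat \/ i = (2 * N)%nat ->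
  forall E, G (theta i) < E ->
    twice_derivable (energy G N theta i) (action G N theta i E) /\
    Derive_n (energy G N theta i) 2 (action G N theta i E) >= 2.
Proof.
  intros HG Hmax Hi E HE. assert (HPI := PI_RGT_0).
  assert (Ha : forall E, action G N theta i E = / (2 * PI) * RInt (fun x => sqrt (E - G x)) 0 (2 * PI)).
  { intros e. unfold action. destruct Hi as [->| ->]; [reflexivity|]. rewrite Nat.eqb_refl, orb_true_r. reflexivity. }
  set (f1 := fun E => / (2 * PI) * RInt (fun x => / (2 * sqrt (E - G x))) 0 (2 * PI)).
  set (f2 := fun E => / (2 * PI) * RInt (fun x => - / (4 * sqrt (E - G x) ^ 3)) 0 (2 * PI)).
  set (h := fun E x => / sqrt (E - G x)).
  assert (Hs : forall E x, G (theta i) < E -> 0 < sqrt (E - G x)).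
  { intros e x He. apply sqrt_lt_R0. generalize (Hmax x); lra. }
  assert (Cs : forall u, 0 < u -> continuous (fun u => / (2 * sqrt u)) u).
  { intros u Hu. apply (ex_derive_continuous (fun u => / (2 * sqrt u))). auto_derive.
    assert (0 < sqrt u) by (apply sqrt_lt_R0; auto). split; auto. split; auto; lra. }
  assert (Ch : forall E, G (theta i) < E -> forall x, continuous (h E) x).
  { intros e He x. apply (continuous_comp (fun x => e - G x) (fun u => / sqrt u)).
    - apply (continuous_minus (fun _ => e) G); [apply continuous_const | apply HG].
    - apply (ex_derive_continuous (fun u => / sqrt u)). auto_derive. specialize (Hs e x He).
      split; [generalize (Hmax x); lra|]. split; auto; lra. }
  assert (R1 : forall E, G (theta i) < E -> f1 E = (/ (2 * PI - 0) * RInt (h E) 0 (2 * PI)) / 2).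
  { intros e He. unfold f1.
    rewrite (RInt_ext _ (fun x => / 2 * h e x)).
    - rewrite (RInt_Rmult_l (h e)).
      + field. lra.
      + apply (ex_RInt_continuous (V := R_CompleteNormedModule)). intros; apply Ch; auto.
    - intros x _. unfold h. specialize (Hs e x He).
      real_eq. field. lra. }
  assert (R2 : forall E, G (theta i) < E -> f2 E = - (/ (2 * PI - 0) * RInt (fun x => h E x ^ 3) 0 (2 * PI)) / 4).
  { intros e He. unfold f2.
    rewrite (RInt_ext _ (fun x => - / 4 * h e x ^ 3)).
    - rewrite (RInt_Rmult_l (fun x => h e x ^ 3)).
      + field. lra.
      + apply (ex_RInt_continuous (V := R_CompleteNormedModule)). intros x _.
        apply (continuous_comp (h e) (fun y => y ^ 3)); [apply Ch; auto|].
        apply (ex_derive_continuous (fun y => y ^ 3)). auto_derive; auto.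
    - intros x _. unfold h. specialize (Hs e x He).
      real_eq. field. lra. }
  assert (P1 : forall E, G (theta i) < E -> 0 < f1 E).
  { intros e He. rewrite R1 by auto. apply Rdiv_lt_0_compat; [|lra].
    apply Rmult_lt_0_compat; [apply Rinv_0_lt_compat; lra|].
    apply RInt_gt_0; [lra| |].
    - intros x _. apply Rinv_0_lt_compat, Hs; auto.
    - intros; apply Ch; auto. }
  destruct (energy_second_derivative G N theta i (fun E => G (theta i) < E) f1 f2) with E as [H1 H2]; auto.
  - intros e. split; [intros [H _]; exact H|]. intros H; split; auto.
  - intros e He. apply (open_gt (G (theta i))); auto.
  - intros; lra.
  - intros e He. apply is_derive_ext with (fun e => / (2 * PI) * RInt (fun x => sqrt (e - G x)) 0 (2 * PI)); [intros; symmetry; apply Ha|].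
    apply is_derive_scal. apply (is_derive_RInt_shift sqrt (fun u => / (2 * sqrt u))); auto; [|eauto].
    intros u Hu. auto_derive; [auto|]. assert (0 < sqrt u) by (apply sqrt_lt_R0; auto). field. lra.
  - intros e He. 
    apply is_derive_scal. apply (is_derive_RInt_shift (fun u => / (2 * sqrt u)) (fun u => - / (4 * sqrt u ^ 3))); auto; [| |eauto].
    + intros u Hu. assert (0 < sqrt u) by (apply sqrt_lt_R0; auto). auto_derive; [split; auto; split; auto; lra|]. field. lra.
    + intros u Hu. assert (0 < sqrt u) by (apply sqrt_lt_R0; auto).
      apply (ex_derive_continuous (fun u => - / (4 * sqrt u ^ 3))). auto_derive. split; auto; split; auto.
      apply Rgt_not_eq. repeat apply Rmult_lt_0_compat; lra.
  - split; [exact H1|]. rewrite H2. specialize (P1 E HE). rewrite R1 in P1 |- * by auto. rewrite R2 by auto.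
    assert (J := cube_mean_le (h E) 0 (2 * PI) ltac:(lra) ltac:(intros; apply Ch; auto)
      ltac:(intros; apply Rlt_le, Rinv_0_lt_compat, Hs; auto)).
    set (m := / (2 * PI - 0) * RInt (h E) 0 (2 * PI)) in *.
    set (q := / (2 * PI - 0) * RInt (fun x => h E x ^ 3) 0 (2 * PI)) in *.
    assert (0 < m) by lra. assert (0 < m ^ 3) by (apply pow_lt; auto).
    apply Rle_ge. apply Rmult_le_reg_r with ((m / 2) ^ 3); [apply pow_lt; lra|].
    replace (- (- q / 4) / (m / 2) ^ 3 * (m / 2) ^ 3) with (q / 4) by (field; lra).
    replace (2 * (m / 2) ^ 3) with (m ^ 3 / 4) by field. lra.
Qed.

(** * The square-root coordinate in a well *)

Lemma continuity_2d_pt_segment (w f : R -> R) (c x t : R) :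
  continuous w t -> (forall y, continuous f y) ->
  continuity_2d_pt (fun x t => w t * f (c + t * (x - c))) x t.
Proof.
  intros Hw Hf. apply continuity_2d_pt_mult.
  - apply (continuity_1d_2d_pt_comp w (fun _ v => v)); [apply continuity_pt_filterlim, Hw | apply continuity_2d_pt_id2].
  - apply continuity_1d_2d_pt_comp; [apply continuity_pt_filterlim, Hf|].
    apply continuity_2d_pt_plus; [apply continuity_2d_pt_const|].
    apply continuity_2d_pt_mult; [apply continuity_2d_pt_id2|].
    apply continuity_2d_pt_minus; [apply continuity_2d_pt_id1 | apply continuity_2d_pt_const].
Qed.

Lemma is_derive_RInt_segment (w f f1 : R -> R) (c x : R) :
  (forall t, continuous w t) -> (forall y, is_derive f y (f1 y)) -> (forall y, continuous f1 y) ->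
  is_derive (fun x => RInt (fun t => w t * f (c + t * (x - c))) 0 1) x
    (RInt (fun t => (w t * t) * f1 (c + t * (x - c))) 0 1).
Proof.
  intros Hw Hf Hf1.
  assert (Dd : forall s t, is_derive (fun u => w t * f (c + t * (u - c))) s ((w t * t) * f1 (c + t * (s - c)))).
  { intros s t. apply is_derive_eq with (w t * (t * f1 (c + t * (s - c)))); [|ring].
    apply is_derive_scal. apply (is_derive_comp f (fun u => c + t * (u - c))); [apply Hf | auto_derive; auto; ring]. }
  rewrite (RInt_ext (fun t => (w t * t) * f1 (c + t * (x - c))) (fun t => Derive (fun u => w t * f (c + t * (u - c))) x)).
  2:{ intros t _. symmetry. apply is_derive_unique, Dd. }
  apply is_derive_RInt_param.
  - apply filter_forall. intros s t _. eexists; apply Dd.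
  - intros t _. apply continuity_2d_pt_ext with (fun s t => (w t * t) * f1 (c + t * (s - c))).
    + intros s v. symmetry. apply is_derive_unique, Dd.
    + apply (continuity_2d_pt_segment (fun t => w t * t)); auto.
      apply (continuous_mult w (fun t => t)); [apply Hw | apply continuous_id].
  - apply filter_forall. intros s. apply (ex_RInt_continuous (V := R_CompleteNormedModule)). intros t _.
    apply (continuous_mult w (fun t => f (c + t * (s - c)))); [apply Hw|].
    apply (continuous_comp (fun t => c + t * (s - c)) f).
    + apply (ex_derive_continuous (fun t => c + t * (s - c))). auto_derive; auto.
    + apply (ex_derive_continuous f). eexists; apply Hf.
Qed.

(** Hadamard's form of the Taylor remainder: it exhibits [G x - G c], at a
    critical point [c], as [(x - c) ^ 2] times a function as smooth as [G2]. *)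
Lemma taylor_RInt (G G1 G2 : R -> R) (c x : R) :
  (forall y, is_derive G y (G1 y)) -> (forall y, is_derive G1 y (G2 y)) -> (forall y, continuous G2 y) ->
  (x - c) ^ 2 * RInt (fun t => (1 - t) * G2 (c + t * (x - c))) 0 1 = G x - G c - (x - c) * G1 c.
Proof.
  intros H1 H2 Hc.
  assert (C : forall t, continuous (fun t => (1 - t) * G2 (c + t * (x - c))) t).
  { intros t. apply (continuous_mult (fun t => 1 - t) (fun t => G2 (c + t * (x - c)))).
    - apply (ex_derive_continuous (fun t => 1 - t)). auto_derive; auto.
    - apply (continuous_comp (fun t => c + t * (x - c)) G2); [|apply Hc].
      apply (ex_derive_continuous (fun t => c + t * (x - c))). auto_derive; auto. }
  rewrite <- (RInt_Rmult_l (fun t => (1 - t) * G2 (c + t * (x - c)))).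
  2:{ apply (ex_RInt_continuous (V := R_CompleteNormedModule)). auto. }
  apply (is_RInt_unique (V := R_CompleteNormedModule)).
  replace (G x - G c - (x - c) * G1 c) with
    (minus ((fun t => (1 - t) * (x - c) * G1 (c + t * (x - c)) + G (c + t * (x - c))) 1)
           ((fun t => (1 - t) * (x - c) * G1 (c + t * (x - c)) + G (c + t * (x - c))) 0)).
  2:{ unfold minus, plus, opp; simpl. replace (c + 1 * (x - c)) with x by ring.
      replace (c + 0 * (x - c)) with c by ring. ring. }
  apply (is_RInt_derive (V := R_CompleteNormedModule) (fun t => (1 - t) * (x - c) * G1 (c + t * (x - c)) + G (c + t * (x - c)))).
  - intros t _. 
    assert (L : is_derive (fun t => c + t * (x - c)) t (x - c)) by (auto_derive; auto; ring).
    assert (K1 : is_derive (fun t => G1 (c + t * (x - c))) t ((x - c) * G2 (c + t * (x - c)))).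
    { apply (is_derive_comp G1 (fun t => c + t * (x - c))); auto. }
    assert (K0 : is_derive (fun t => G (c + t * (x - c))) t ((x - c) * G1 (c + t * (x - c)))).
    { apply (is_derive_comp G (fun t => c + t * (x - c))); auto. }
    assert (KL : is_derive (fun t => (1 - t) * (x - c)) t (- (x - c))) by (auto_derive; auto; ring).
    refine (is_derive_eq _ _ _ _ (is_derive_plus (V := R_NormedModule) _ _ _ _ _ (is_derive_mult _ _ _ _ _ KL K1 _) K0) _).
    + intros; apply Rmult_comm.
    + real_eq.
      unfold plus, mult; simpl. ring.
  - intros t _. apply (continuous_scal_r ((x - c) ^ 2) (fun t => (1 - t) * G2 (c + t * (x - c)))), C.
Qed.

Lemma increasing_of_derive_pos (f f1 : R -> R) (a b : R) : a < b ->
  (forall x, a <= x <= b -> is_derive f x (f1 x)) -> (forall x, a < x < b -> 0 < f1 x) -> f a < f b.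
Proof.
  intros Hab Hf Hp. destruct (MVT_cor2 f f1 a b Hab) as [t [E Ht]].
  - intros t Ht. apply is_derive_Reals, Hf, Ht.
  - specialize (Hp t Ht). nra.
Qed.

Lemma decreasing_of_derive_neg (f f1 : R -> R) (a b : R) : a < b ->
  (forall x, a <= x <= b -> is_derive f x (f1 x)) -> (forall x, a < x < b -> f1 x < 0) -> f b < f a.
Proof.
  intros Hab Hf Hp. destruct (MVT_cor2 f f1 a b Hab) as [t [E Ht]].
  - intros t Ht. apply is_derive_Reals, Hf, Ht.
  - specialize (Hp t Ht). nra.
Qed.

(** The coordinate is [(x - c) sqrt Q] with [Q] the Hadamard quotient, which is
    smooth across [c] where the square root of [G - G c] itself is not. *)
Lemma sqrt_coordinate (G G1 G2 G3 G4 G5 : R -> R) (a c b : R) :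
  a < c < b ->
  (forall y, is_derive G y (G1 y)) -> (forall y, is_derive G1 y (G2 y)) -> (forall y, is_derive G2 y (G3 y)) ->
  (forall y, is_derive G3 y (G4 y)) -> (forall y, is_derive G4 y (G5 y)) -> (forall y, continuous G5 y) ->
  G1 c = 0 -> 0 < G2 c ->
  (forall x, c < x < b -> 0 < G1 x) -> (forall x, a < x < c -> G1 x < 0) ->
  exists U U1 U2 : R -> R,
    U c = 0 /\
    (forall x, a <= x <= b -> U x ^ 2 = G x - G c) /\
    (forall x, a <= x <= b -> is_derive U x (U1 x)) /\
    (forall x, a <= x <= b -> is_derive U1 x (U2 x)) /\
    (forall x, a <= x <= b -> continuous U2 x) /\
    (forall x, a < x < b -> 2 * U x * U1 x = G1 x) /\
    (forall x, a < x < b -> 0 < U1 x) /\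
    (forall x, c < x <= b -> 0 < U x) /\ (forall x, a <= x < c -> U x < 0).
Proof.
  intros Hacb D1 D2 D3 D4 D5 C5 Hc1 Hc2 Hpos Hneg.
  assert (Cc : forall f f' : R -> R, (forall y, is_derive f y (f' y)) -> forall y, continuous f y).
  { intros f f' H y. apply (ex_derive_continuous f). eexists; apply H. }
  set (w := fun t : R => 1 - t). set (w1 := fun t => w t * t). set (w2 := fun t => w1 t * t). set (w3 := fun t => w2 t * t).
  assert (Cw : forall t, continuous w t) by (intros t; apply (ex_derive_continuous w); unfold w; auto_derive; auto).
  assert (Cw1 : forall t, continuous w1 t) by (intros t; apply (ex_derive_continuous w1); unfold w1, w; auto_derive; auto).
  assert (Cw2 : forall t, continuous w2 t) by (intros t; apply (ex_derive_continuous w2); unfold w2, w1, w; auto_derive; auto).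
  set (Q := fun x => RInt (fun t => w t * G2 (c + t * (x - c))) 0 1).
  set (Q1 := fun x => RInt (fun t => w1 t * G3 (c + t * (x - c))) 0 1).
  set (Q2 := fun x => RInt (fun t => w2 t * G4 (c + t * (x - c))) 0 1).
  assert (DQ : forall x, is_derive Q x (Q1 x)) by (intros x; apply is_derive_RInt_segment; eauto).
  assert (DQ1 : forall x, is_derive Q1 x (Q2 x)) by (intros x; apply is_derive_RInt_segment; eauto).
  assert (DQ2 : forall x, is_derive Q2 x (RInt (fun t => w3 t * G5 (c + t * (x - c))) 0 1)) by (intros x; apply is_derive_RInt_segment; eauto).
  assert (HQ : forall x, (x - c) ^ 2 * Q x = G x - G c).
  { intros x. unfold Q, w. rewrite (taylor_RInt G G1 G2); eauto. rewrite Hc1; ring. }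
  assert (HQc : Q c = G2 c / 2).
  { unfold Q. rewrite (RInt_ext _ (fun t => G2 c * w t)).
    2:{ intros t _. replace (c + t * (c - c)) with c by ring. apply Rmult_comm. }
    rewrite RInt_Rmult_l by (apply (ex_RInt_continuous (V := R_CompleteNormedModule)); auto).
    replace (RInt w 0 1) with (1 / 2); [real_eq; field|]. symmetry.
    apply (is_RInt_unique (V := R_CompleteNormedModule)).
    replace (1 / 2) with (minus ((fun t => t - t ^ 2 / 2) 1) ((fun t => t - t ^ 2 / 2) 0)) by (unfold minus, plus, opp; simpl; real_eq; field).
    apply (is_RInt_derive (fun t => t - t ^ 2 / 2)); auto.
    intros t _. unfold w. auto_derive; auto. real_eq. field. }
  assert (HGr : forall x, c < x <= b -> G c < G x).
  { intros x Hx. apply (increasing_of_derive_pos G G1); auto; [lra|]. intros; apply Hpos; lra. }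
  assert (HGl : forall x, a <= x < c -> G c < G x).
  { intros x Hx. apply (decreasing_of_derive_neg G G1); auto; [lra|]. intros; apply Hneg; lra. }
  assert (PQ : forall x, a <= x <= b -> 0 < Q x).
  { intros x Hx. destruct (Req_dec x c) as [->|E]; [rewrite HQc; lra|].
    assert (0 < G x - G c).
    { destruct (Rlt_or_le x c); [specialize (HGl x)|specialize (HGr x)]; lra. }
    assert (0 < (x - c) ^ 2) by (apply pow2_gt_0; lra).
    specialize (HQ x). apply Rnot_le_lt. intros K. nra. }
  set (U := fun x => (x - c) * sqrt (Q x)).
  set (U1 := fun x => sqrt (Q x) + (x - c) * (Q1 x / (2 * sqrt (Q x)))).
  set (U2 := fun x => Q1 x / sqrt (Q x) + (x - c) * (Q2 x / (2 * sqrt (Q x)) - Q1 x ^ 2 / (4 * sqrt (Q x) ^ 3))).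
  assert (PS : forall x, a <= x <= b -> 0 < sqrt (Q x)) by (intros; apply sqrt_lt_R0; auto).
  assert (HU : forall x, a <= x <= b -> U x ^ 2 = G x - G c).
  { intros x Hx. unfold U. rewrite <- HQ, Rpow_mult_distr, pow2_sqrt; auto. apply Rlt_le; auto. }
  assert (XQ : forall x, ex_derive Q x) by (eexists; apply DQ).
  assert (XQ1 : forall x, ex_derive Q1 x) by (eexists; apply DQ1).
  assert (XQ2 : forall x, ex_derive Q2 x) by (eexists; apply DQ2).
  assert (EQ : forall x, Derive (fun x => Q x) x = Q1 x) by (intros; apply is_derive_unique, DQ).
  assert (EQ1 : forall x, Derive (fun x => Q1 x) x = Q2 x) by (intros; apply is_derive_unique, DQ1).
  assert (DU : forall x, a <= x <= b -> is_derive U x (U1 x)).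
  { intros x Hx. specialize (PQ x Hx). specialize (PS x Hx). unfold U, U1.
    auto_derive; [auto|]. rewrite EQ. field. lra. }
  assert (DU1 : forall x, a <= x <= b -> is_derive U1 x (U2 x)).
  { intros x Hx. specialize (PQ x Hx). specialize (PS x Hx). unfold U1, U2.
    auto_derive; [repeat split; auto; lra|]. rewrite EQ, EQ1. field. lra. }
  (* differentiate U ^ 2 = G - G c *)
  assert (HUU : forall x, a < x < b -> 2 * U x * U1 x = G1 x).
  { intros x Hx. assert (A1 : is_derive (fun y => U y ^ 2) x (2 * U x * U1 x)).
    { apply is_derive_eq with (INR 2 * U1 x * U x ^ 1); [|simpl; ring]. apply (is_derive_pow U 2), DU; lra. }
    assert (A2 : is_derive (fun y => U y ^ 2) x (G1 x)).
    { apply is_derive_ext_loc with (fun y => G y - G c).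
      - assert (Hd : 0 < Rmin (x - a) (b - x)) by (apply Rmin_pos; lra).
        exists (mkposreal _ Hd). intros y Hy. symmetry. apply HU.
        change (Rabs (y - x) < Rmin (x - a) (b - x)) in Hy. apply Rabs_lt_between in Hy.
        generalize (Rmin_l (x - a) (b - x)) (Rmin_r (x - a) (b - x)). lra.
      - apply is_derive_eq with (G1 x - 0); [|ring].
        apply (is_derive_minus G (fun _ => G c)); [apply D1 | auto_derive; auto]. }
    rewrite <- (is_derive_unique _ _ _ A1). apply is_derive_unique, A2. }
  exists U, U1, U2.
  split; [unfold U; ring|]. split; [exact HU|]. split; [exact DU|]. split; [exact DU1|].
  split; [|split; [exact HUU|split; [|split]]].
  - intros x Hx. specialize (PQ x Hx). specialize (PS x Hx). apply (ex_derive_continuous U2). unfold U2.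
    auto_derive. repeat split; auto; try lra. apply Rgt_not_eq. repeat apply Rmult_lt_0_compat; lra.
  - intros x Hx. destruct (Req_dec x c) as [E|E].
    + unfold U1. rewrite E, Rminus_diag. specialize (PS c). lra.
    + assert (K := HUU x Hx).
      assert (PSx := PS x ltac:(lra)).
      destruct (Rlt_or_le x c) as [H|H].
      * assert (G1 x < 0) by (apply Hneg; lra). assert (U x < 0) by (unfold U; nra). nra.
      * assert (0 < G1 x) by (apply Hpos; lra). assert (0 < U x) by (unfold U; nra). nra.
  - intros x Hx. specialize (PS x ltac:(lra)). unfold U. nra.
  - intros x Hx. specialize (PS x ltac:(lra)). unfold U. nra.
Qed.

Lemma locally_open_interval (a b x : R) : a < x < b -> locally x (fun y => a < y < b).
Proof.
  intros Hx. apply filter_and; [apply (open_gt a) | apply (open_lt b)]; lra.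
Qed.

(** [X] inverts the square-root coordinate.  The last conjunct comes from
    differentiating [G (X u) = G c + u ^ 2] twice; at [u = 0] its right-hand sides
    are of the form 0/0, which is why [X1] and [X2] are not defined by them. *)
Lemma inverse_coordinate (G G1 G2 G3 G4 G5 : R -> R) (a c b : R) :
  a < c < b ->
  (forall y, is_derive G y (G1 y)) -> (forall y, is_derive G1 y (G2 y)) -> (forall y, is_derive G2 y (G3 y)) ->
  (forall y, is_derive G3 y (G4 y)) -> (forall y, is_derive G4 y (G5 y)) -> (forall y, continuous G5 y) ->
  G1 c = 0 -> 0 < G2 c ->
  (forall x, c < x < b -> 0 < G1 x) -> (forall x, a < x < c -> G1 x < 0) ->
  exists (X X1 X2 : R -> R) (A B : R),
    A < 0 < B /\ A ^ 2 = G a - G c /\ B ^ 2 = G b - G c /\ X 0 = c /\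
    (forall u, A < u < B -> a < X u < b /\ G (X u) = G c + u ^ 2 /\
       is_derive X u (X1 u) /\ is_derive X1 u (X2 u) /\ continuous X2 u /\ 0 < X1 u) /\
    (forall u, A < u < B -> u <> 0 -> G1 (X u) <> 0 /\ X1 u = 2 * u / G1 (X u) /\
       X2 u = 2 * (G1 (X u) ^ 2 - 2 * u ^ 2 * G2 (X u)) / G1 (X u) ^ 3).
Proof.
  intros Hacb D1 D2 D3 D4 D5 C5 Hc1 Hc2 Hpos Hneg.
  destruct (sqrt_coordinate G G1 G2 G3 G4 G5 a c b) as
    (U & U1 & U2 & Hc & HU & DU & DU1 & CU2 & HUU & PU1 & Pr & Pl); auto.
  set (D := fun x => a < x < b).
  assert (Do : forall x, D x -> locally x D) by (intros x Hx; apply locally_open_interval, Hx).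
  assert (Dc : forall x y z, D x -> D z -> x <= y <= z -> D y) by (unfold D; intros; lra).
  assert (DU' : forall x, D x -> is_derive U x (U1 x)) by (unfold D; intros; apply DU; lra).
  assert (DU1' : forall x, D x -> is_derive U1 x (U2 x)) by (unfold D; intros; apply DU1; lra).
  set (X := fun u => epsilon (inhabits 0) (fun x => D x /\ U x = u)).
  assert (HX : forall x, D x -> X (U x) = x).
  { intros x Hx. unfold X.
    destruct (epsilon_spec (inhabits 0) (fun y => D y /\ U y = U x)) as [H1 H2]; [eauto|].
    match goal with |- ?y = x => set (z := y) in * end.
    destruct (Rtotal_order z x) as [H|[H|H]]; auto; exfalso.
    - assert (K := strictly_increasing_on D U U1 Dc DU' PU1 z x H1 Hx H). lra.
    - assert (K := strictly_increasing_on D U U1 Dc DU' PU1 x z Hx H1 H). lra. }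
  assert (Hsurj : forall u, U a < u < U b -> D (X u) /\ U (X u) = u).
  { intros u Hu. destruct (IVT_interv (fun t => U t - u) a b) as [z [Hz Ez]]; try lra.
    - intros t Ht. apply is_derive_continuity_pt with (U1 t - 0).
      apply (is_derive_minus U (fun _ => u)); [apply DU; lra | auto_derive; auto].
    - assert (Eu : u = U z) by lra.
      assert (z <> a) by (intros E; subst z; lra). assert (z <> b) by (intros E; subst z; lra).
      assert (Dz : D z) by (unfold D; lra). rewrite Eu, HX; auto. }
  assert (Inv := inverse_second_derivative D U U1 U2 X Do Dc DU' DU1' PU1 HX).
  exists X, (fun u => / U1 (X u)), (fun u => - U2 (X u) / U1 (X u) ^ 3), (U a), (U b).
  split; [generalize (Pr b ltac:(lra)) (Pl a ltac:(lra)); lra|].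
  split; [apply HU; lra|]. split; [apply HU; lra|].
  split; [rewrite <- Hc; apply HX; exact Hacb|]. split.
  - intros u Hu. destruct (Hsurj u Hu) as [Dx Ex]. assert (Px := PU1 _ Dx).
    split; [exact Dx|]. split.
    { rewrite <- Ex at 2. rewrite HU by (unfold D in Dx; lra). ring. }
    destruct (Inv (X u) Dx) as [I1 I2]. rewrite Ex in I1, I2.
    assert (DX : is_derive X u (/ U1 (X u))) by (apply locally_singleton in I1; exact I1).
    split; [exact DX|]. split; [exact I2|]. split.
    + assert (CX : continuous X u) by (apply (ex_derive_continuous X); eexists; exact DX).
      apply (continuous_comp X (fun x => - U2 x / U1 x ^ 3)); [exact CX|].
      apply (continuous_mult (fun x => - U2 x) (fun x => / U1 x ^ 3)).
      * apply (continuous_opp U2), CU2. unfold D in Dx; lra.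
      * apply (ex_derive_continuous (fun x => / U1 x ^ 3)). auto_derive. split.
        -- eexists; apply DU1; unfold D in Dx; lra.
        -- split; auto. apply Rgt_not_eq. repeat apply Rmult_lt_0_compat; lra.
    + apply Rinv_0_lt_compat; auto.
  - intros u Hu Hu0. destruct (Hsurj u Hu) as [Dx Ex]. assert (Px := PU1 _ Dx).
    set (x := X u) in *.
    assert (K1 := HUU x Dx). rewrite Ex in K1.
    assert (K2 : 2 * (U1 x ^ 2 + u * U2 x) = G2 x).
    { assert (A1 : is_derive (fun y => 2 * U y * U1 y) x (2 * (U1 x ^ 2 + u * U2 x))).
      { refine (is_derive_eq _ _ _ _ (is_derive_mult (fun y => 2 * U y) U1 x (2 * U1 x) (U2 x) _ _ _) _).
        - apply is_derive_scal. apply DU'; auto.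
        - apply DU1'; auto.
        - intros; apply Rmult_comm.
        - change (2 * U1 x * U1 x + 2 * U x * U2 x = 2 * (U1 x ^ 2 + u * U2 x)). rewrite Ex. ring. }
      rewrite <- (is_derive_unique _ _ _ A1). apply is_derive_unique.
      apply is_derive_ext_loc with G1; [|apply D2].
      generalize (Do x Dx). apply filter_imp. intros y Hy. symmetry. apply HUU, Hy. }
    assert (N : G1 x <> 0).
    { rewrite <- K1. apply Rmult_integral_contrapositive_currified; [|lra].
      apply Rmult_integral_contrapositive_currified; lra. }
    split; [exact N|]. 
    assert (NU : U1 x <> 0) by lra.
    split; rewrite <- K1.
    + field. lra.
    + rewrite <- K2. field. lra.
Qed.

(** * The action integral in the coordinate r sin t *)

Lemma ex_RInt_cont (f : R -> R) (a b : R) : (forall x, continuous f x) -> ex_RInt f a b.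
Proof. intros H. apply (ex_RInt_continuous (V := R_CompleteNormedModule)). auto. Qed.

Lemma RInt_Rplus (f g : R -> R) (a b : R) :
  (forall x, continuous f x) -> (forall x, continuous g x) ->
  RInt (fun x => f x + g x) a b = RInt f a b + RInt g a b.
Proof.
  intros Hf Hg. exact (RInt_plus (V := R_CompleteNormedModule) f g a b (ex_RInt_cont f a b Hf) (ex_RInt_cont g a b Hg)).
Qed.

Lemma continuous_Rmult (f g : R -> R) (x : R) :
  continuous f x -> continuous g x -> continuous (fun t => f t * g t) x.
Proof. apply (continuous_mult f g). Qed.

Lemma continuous_of_derivable (f : R -> R) (x : R) : ex_derive f x -> continuous f x.
Proof. apply (ex_derive_continuous f). Qed.

Lemma continuous_sin_R (x : R) : continuous sin x.
Proof. apply continuous_of_derivable. auto_derive; auto. Qed.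

Lemma Rabs_mult_sin (r t : R) : Rabs (r * sin t) <= Rabs r.
Proof.
  rewrite Rabs_mult. rewrite <- (Rmult_1_r (Rabs r)) at 2.
  apply Rmult_le_compat_l; [apply Rabs_pos|]. apply Rabs_le, SIN_bound.
Qed.

Lemma continuous_comp_sin (f : R -> R) (rho r t : R) :
  (forall u, Rabs u < rho -> continuous f u) -> Rabs r < rho -> continuous (fun t => f (r * sin t)) t.
Proof.
  intros Hf Hr. apply (continuous_comp (fun t => r * sin t) f).
  - apply continuous_of_derivable. auto_derive; auto.
  - apply Hf. apply Rle_lt_trans with (2 := Hr), Rabs_mult_sin.
Qed.

Lemma is_derive_RInt_sin (p f f1 : R -> R) (rho r : R) :
  (forall t, continuous p t) -> (forall u, Rabs u < rho -> is_derive f u (f1 u)) ->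
  (forall u, Rabs u < rho -> continuous f1 u) -> Rabs r < rho ->
  is_derive (fun r => RInt (fun t => p t * f (r * sin t)) (- (PI / 2)) (PI / 2)) r
    (RInt (fun t => p t * (sin t * f1 (r * sin t))) (- (PI / 2)) (PI / 2)).
Proof.
  intros Hp Hf Hc Hr.
  assert (Hloc : locally r (fun s => Rabs s < rho)).
  { apply Rabs_lt_between in Hr. generalize (locally_open_interval (- rho) rho r Hr).
    apply filter_imp. intros y Hy. apply Rabs_lt_between, Hy. }
  assert (Hs : forall s t, Rabs s < rho -> Rabs (s * sin t) < rho).
  { intros s t H. apply Rle_lt_trans with (2 := H), Rabs_mult_sin. }
  assert (Dd : forall s t, Rabs s < rho -> is_derive (fun u => p t * f (u * sin t)) s (p t * (sin t * f1 (s * sin t)))).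
  { intros s t H. apply is_derive_scal.
    apply (is_derive_comp f (fun u => u * sin t)); [apply Hf; auto | auto_derive; auto; ring]. }
  rewrite (RInt_ext (fun t => p t * (sin t * f1 (r * sin t))) (fun t => Derive (fun u => p t * f (u * sin t)) r)).
  2:{ intros t _. symmetry. apply is_derive_unique; auto. }
  apply is_derive_RInt_param.
  - revert Hloc. apply filter_imp. intros s H t _. eexists; apply Dd; auto.
  - intros t _. apply continuity_2d_pt_ext_loc with (fun u v => p v * (sin v * f1 (u * sin v))).
    + destruct Hloc as [d Hd]. exists d. intros u v Hu _. symmetry. apply is_derive_unique, Dd, Hd, Hu.
    + apply continuity_2d_pt_mult; [apply (continuity_1d_2d_pt_comp p (fun _ v => v)); [apply continuity_pt_filterlim, Hp | apply continuity_2d_pt_id2]|].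
      assert (K : continuity_2d_pt (fun _ v => sin v) r t).
      { apply (continuity_1d_2d_pt_comp sin (fun _ v => v)); [apply continuity_sin | apply continuity_2d_pt_id2]. }
      apply continuity_2d_pt_mult; [exact K|].
      apply continuity_1d_2d_pt_comp; [apply continuity_pt_filterlim, Hc; auto|].
      apply continuity_2d_pt_mult; [apply continuity_2d_pt_id1 | exact K].
  - revert Hloc. apply filter_imp. intros s H. apply ex_RInt_cont. intros t.
    apply continuous_Rmult; auto. apply (continuous_comp_sin f rho); auto.
    intros u Hu. apply continuous_of_derivable. eexists; apply Hf; auto.
Qed.

(** Differentiating under the integral produces [f1]; it is removed by
    integrating by parts against [sin t cos t], whose boundary values vanish,
    and [2 cos ^ 2 - cos (2 t) = 1] remains. *)
Lemma is_derive_abel_integral (f f1 : R -> R) (rho r : R) :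
  (forall u, Rabs u < rho -> is_derive f u (f1 u)) ->
  (forall u, Rabs u < rho -> continuous f1 u) -> Rabs r < rho ->
  is_derive (fun r => r ^ 2 * RInt (fun t => cos t ^ 2 * f (r * sin t)) (- (PI / 2)) (PI / 2)) r
    (r * RInt (fun t => f (r * sin t)) (- (PI / 2)) (PI / 2)).
Proof.
  intros Hf Hc Hr.
  assert (Cf : forall u, Rabs u < rho -> continuous f u).
  { intros u Hu. apply continuous_of_derivable. eexists; apply Hf; auto. }
  assert (Cfs := fun t => continuous_comp_sin f rho r t Cf Hr).
  assert (Cf1s := fun t => continuous_comp_sin f1 rho r t Hc Hr).
  assert (Cc2 : forall t, continuous (fun t => cos t ^ 2) t) by (intros; apply continuous_of_derivable; auto_derive; auto).
  assert (D := is_derive_RInt_sin (fun t => cos t ^ 2) f f1 rho r Cc2 Hf Hc Hr).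
  set (P := RInt (fun t => cos t ^ 2 * f (r * sin t)) (- (PI / 2)) (PI / 2)).
  set (P1 := RInt (fun t => cos t ^ 2 * (sin t * f1 (r * sin t))) (- (PI / 2)) (PI / 2)) in *.
  (* the boundary terms of sin t cos t f (r sin t) vanish *)
  assert (I : RInt (fun t => 2 * (cos t ^ 2 * f (r * sin t)) + (- 1 * f (r * sin t) + r * (cos t ^ 2 * (sin t * f1 (r * sin t))))) (- (PI / 2)) (PI / 2) = 0).
  { apply (is_RInt_unique (V := R_CompleteNormedModule)).
    replace 0 with (minus ((fun t => sin t * cos t * f (r * sin t)) (PI / 2)) ((fun t => sin t * cos t * f (r * sin t)) (- (PI / 2)))).
    2:{ unfold minus, plus, opp; simpl. rewrite cos_neg, cos_PI2. ring. }
    apply (is_RInt_derive (V := R_CompleteNormedModule) (fun t => sin t * cos t * f (r * sin t))).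
    - intros t _.
      assert (H : Rabs (r * sin t) < rho) by (apply Rle_lt_trans with (2 := Hr), Rabs_mult_sin).
      assert (K1 : is_derive (fun t => f (r * sin t)) t ((r * cos t) * f1 (r * sin t))).
      { apply (is_derive_comp f (fun t => r * sin t)); [apply Hf; auto | auto_derive; auto; ring]. }
      assert (K2 : is_derive (fun t => sin t * cos t) t (cos t ^ 2 - sin t ^ 2)) by (auto_derive; auto; ring).
      refine (is_derive_eq _ _ _ _ (is_derive_mult _ _ _ _ _ K2 K1 _) _); [intros; apply Rmult_comm|].
      real_eq. unfold plus, mult; simpl.
      generalize (sin2_cos2 t). unfold Rsqr. intros E.
      replace (sin t * (sin t * 1)) with (1 - cos t * cos t) by lra. ring.
    - intros t _. apply (continuous_plus (fun t => 2 * (cos t ^ 2 * f (r * sin t))) (fun t => -1 * f (r * sin t) + r * (cos t ^ 2 * (sin t * f1 (r * sin t))))).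
      + apply continuous_Rmult; [apply continuous_const|]. apply continuous_Rmult; auto.
      + apply (continuous_plus (fun t => -1 * f (r * sin t)) (fun t => r * (cos t ^ 2 * (sin t * f1 (r * sin t))))).
        * apply continuous_Rmult; [apply continuous_const|auto].
        * apply continuous_Rmult; [apply continuous_const|]. apply continuous_Rmult; auto. apply continuous_Rmult; auto using continuous_sin_R. }
  rewrite !RInt_Rplus in I.
  2:{ intros; apply continuous_Rmult; [apply continuous_const|auto]. }
  2:{ intros; apply continuous_Rmult; [apply continuous_const|]. apply continuous_Rmult; auto. apply continuous_Rmult; auto using continuous_sin_R. }
  2:{ intros; apply continuous_Rmult; [apply continuous_const|]. apply continuous_Rmult; auto. }
  2:{ intros t. apply (continuous_plus (fun t => -1 * f (r * sin t)) (fun t => r * (cos t ^ 2 * (sin t * f1 (r * sin t))))).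
      - apply continuous_Rmult; [apply continuous_const|auto].
      - apply continuous_Rmult; [apply continuous_const|]. apply continuous_Rmult; auto. apply continuous_Rmult; auto using continuous_sin_R. }
  rewrite (RInt_Rmult_l (fun t => cos t ^ 2 * f (r * sin t))) in I by (apply ex_RInt_cont; intros; apply continuous_Rmult; auto).
  rewrite (RInt_Rmult_l (fun t => f (r * sin t))) in I by (apply ex_RInt_cont; auto).
  rewrite (RInt_Rmult_l (fun t => cos t ^ 2 * (sin t * f1 (r * sin t)))) in I
    by (apply ex_RInt_cont; intros; apply continuous_Rmult; auto; apply continuous_Rmult; auto using continuous_sin_R).
  fold P in I. fold P1 in I.
  refine (is_derive_eq _ _ _ _ (is_derive_mult (fun r => r ^ 2) _ r (2 * r) _ _ D _) _).
  - auto_derive; auto; ring.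
  - intros; apply Rmult_comm.
  - change (2 * r * P + r ^ 2 * P1 = r * RInt (fun t => f (r * sin t)) (- (PI / 2)) (PI / 2)).
    replace (RInt (fun t => f (r * sin t)) (- (PI / 2)) (PI / 2)) with (2 * P + r * P1) by lra. ring.
Qed.

Lemma RInt_symmetrize (f : R -> R) (a : R) : (forall x, continuous f x) ->
  RInt f (- a) a = RInt (fun x => f x + f (- x)) 0 a.
Proof.
  intros Hf.
  assert (Hm : forall x, continuous (fun x => f (- x)) x).
  { intros x. apply (continuous_comp (fun x => - x) f); [apply continuous_of_derivable; auto_derive; auto | apply Hf]. }
  rewrite RInt_Rplus by auto.
  rewrite <- (RInt_Chasles (V := R_CompleteNormedModule) f (- a) 0 a) by (apply ex_RInt_cont; auto).
  change (RInt f (- a) 0 + RInt f 0 a = RInt f 0 a + RInt (fun x => f (- x)) 0 a).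
  rewrite Rplus_comm. f_equal.
  assert (K := RInt_correct (V := R_CompleteNormedModule) f (- a) 0 (ex_RInt_cont f _ _ Hf)).
  apply is_RInt_swap in K. rewrite <- Ropp_0 in K at 1.
  apply (is_RInt_comp_opp (V := R_NormedModule)), (is_RInt_opp (V := R_NormedModule)) in K.
  symmetry. apply (is_RInt_unique (V := R_CompleteNormedModule)).
  apply (is_RInt_ext (V := R_NormedModule)) with (f := fun y => opp (opp (f (- y)))).
  - intros x _. apply opp_opp.
  - rewrite <- (opp_opp (RInt f (- a) 0)). exact K.
Qed.

Lemma RInt_nonneg (f : R -> R) (a b : R) : a <= b -> (forall x, continuous f x) ->
  (forall x, a < x < b -> 0 <= f x) -> 0 <= RInt f a b.
Proof. intros H Hc Hp. apply RInt_ge_0; auto. apply ex_RInt_cont; auto. Qed.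

(** Chebyshev's inequality for the increasing functions [sin ^ 2] and
    [h (r sin t)]: their deviations from the values at [PI / 4] have the same
    sign, and [sin ^ 2] has mean [1/2]. *)
Lemma chebyshev_sin2 (h : R -> R) (rho r : R) :
  (forall u, Rabs u < rho -> continuous h u) -> 0 < r < rho ->
  (forall u v, 0 <= u <= v -> v < rho -> h u <= h v) ->
  / 2 * RInt (fun t => h (r * sin t)) 0 (PI / 2) <= RInt (fun t => sin t ^ 2 * h (r * sin t)) 0 (PI / 2).
Proof.
  intros Hc Hr Hm. assert (HPI := PI_RGT_0).
  assert (Hr' : Rabs r < rho) by (rewrite Rabs_pos_eq; lra).
  assert (Chs := fun t => continuous_comp_sin h rho r t Hc Hr').
  assert (Cs2 : forall t, continuous (fun t => sin t ^ 2) t) by (intros; apply continuous_of_derivable; auto_derive; auto).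
  set (s := sin (PI / 4)).
  assert (Hs : 0 < s < 1) by (unfold s; rewrite sin_PI4; generalize Rlt_sqrt2_0 sqrt2_neq_0 (pow2_sqrt 2 ltac:(lra)); intros; 
     split; [apply Rdiv_lt_0_compat; lra | apply Rmult_lt_reg_r with (sqrt 2); [lra|]; unfold Rdiv; rewrite Rmult_1_l, Rinv_l by lra; nra]).
  assert (Hs2 : s ^ 2 = / 2).
  { unfold s. rewrite sin_PI4. generalize (pow2_sqrt 2 ltac:(lra)) sqrt2_neq_0. intros E N.
    unfold Rdiv. rewrite Rmult_1_l, pow_inv, E. reflexivity. }
  set (k := h (r * s)).
  assert (Ca : forall t, continuous (fun t => sin t ^ 2 - / 2) t) by (intros; apply continuous_of_derivable; auto_derive; auto).
  assert (I0 : RInt (fun t => sin t ^ 2 - / 2) 0 (PI / 2) = 0).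
  { apply (is_RInt_unique (V := R_CompleteNormedModule)).
    replace 0 with (minus ((fun t => - (sin t * cos t) / 2) (PI / 2)) ((fun t => - (sin t * cos t) / 2) 0)) at 2.
    2:{ unfold minus, plus, opp; simpl. rewrite cos_PI2, sin_0. real_eq. field. }
    apply (is_RInt_derive (V := R_CompleteNormedModule) (fun t => - (sin t * cos t) / 2)); auto.
    intros t _. auto_derive; auto. generalize (sin2_cos2 t). unfold Rsqr. simpl. intros. real_eq. nra. }
  assert (I1 : 0 <= RInt (fun t => (sin t ^ 2 - / 2) * (h (r * sin t) - k)) 0 (PI / 2)).
  { apply RInt_nonneg; [lra| |].
    - intros t. apply (continuous_Rmult (fun t => sin t ^ 2 - / 2) (fun t => h (r * sin t) - k)); auto.
      apply (continuous_minus (fun t => h (r * sin t)) (fun _ => k)); auto. apply continuous_const.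
    - intros t Ht. assert (Hst : 0 <= sin t) by (apply sin_ge_0; lra).
      assert (Hst1 := SIN_bound t). rewrite <- Hs2.
      destruct (Rle_or_lt s (sin t)) as [H|H].
      + assert (k <= h (r * sin t)) by (apply Hm; [split; [nra|apply Rmult_le_compat_l; lra]|nra]).
        apply Rmult_le_pos; [simpl; nra|lra].
      + assert (h (r * sin t) <= k) by (apply Hm; [split; [nra|apply Rmult_le_compat_l; lra]|nra]).
        replace ((sin t ^ 2 - s ^ 2) * (h (r * sin t) - k)) with ((s ^ 2 - sin t ^ 2) * (k - h (r * sin t))) by ring.
        apply Rmult_le_pos; [simpl; nra|lra]. }
  assert (E : RInt (fun t => (sin t ^ 2 - / 2) * (h (r * sin t) - k)) 0 (PI / 2)
    = RInt (fun t => sin t ^ 2 * h (r * sin t)) 0 (PI / 2) - / 2 * RInt (fun t => h (r * sin t)) 0 (PI / 2)).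
  { rewrite (RInt_ext _ (fun t => sin t ^ 2 * h (r * sin t) + (- / 2 * h (r * sin t) + - k * (sin t ^ 2 - / 2)))).
    2:{ intros t _. real_eq. ring. }
    rewrite !RInt_Rplus.
    - rewrite (RInt_Rmult_l (fun t => h (r * sin t))) by (apply ex_RInt_cont; auto).
      rewrite (RInt_Rmult_l (fun t => sin t ^ 2 - / 2)) by (apply ex_RInt_cont; auto). rewrite I0. real_eq; ring.
    - intros; apply continuous_Rmult; auto. apply continuous_const.
    - intros; apply (continuous_Rmult (fun _ => - k) (fun t => sin t ^ 2 - / 2)); auto. apply continuous_const.
    - intros; apply continuous_Rmult; auto.
    - intros t. apply (continuous_plus (fun t => - / 2 * h (r * sin t)) (fun t => - k * (sin t ^ 2 - / 2))).
      + apply continuous_Rmult; auto. apply continuous_const.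
      + apply (continuous_Rmult (fun _ => - k) (fun t => sin t ^ 2 - / 2)); auto. apply continuous_const. }
  lra.
Qed.

(** With [S] the even part of [X1], the hypothesis and the convexity of the cube
    give [S' u >= k u S u ^ 3]; Chebyshev's inequality removes the weight
    [sin ^ 2] at the cost of a factor [1/2], and Jensen's inequality finishes. *)
Lemma period_convexity (X1 X2 : R -> R) (rho k r : R) :
  (forall u, Rabs u < rho -> is_derive X1 u (X2 u)) ->
  (forall u, Rabs u < rho -> continuous X2 u) ->
  (forall u, Rabs u < rho -> 0 < X1 u) ->
  0 <= k ->
  (forall u, 0 < u < rho -> k * u * (X1 u ^ 3 + X1 (- u) ^ 3) <= X2 u - X2 (- u)) ->
  0 < r < rho ->
  k * r * RInt (fun t => X1 (r * sin t)) (- (PI / 2)) (PI / 2) ^ 3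
    <= 2 * PI ^ 2 * RInt (fun t => sin t * X2 (r * sin t)) (- (PI / 2)) (PI / 2).
Proof.
  intros HD HC HP Hk Hineq Hr. assert (HPI := PI_RGT_0).
  assert (Hr' : Rabs r < rho) by (rewrite Rabs_pos_eq; lra).
  assert (C1 : forall u, Rabs u < rho -> continuous X1 u).
  { intros u Hu. apply continuous_of_derivable. eexists; apply HD; auto. }
  set (S := fun u => (X1 u + X1 (- u)) / 2).
  set (S1 := fun u => (X2 u - X2 (- u)) / 2).
  assert (Hopp : forall u, Rabs u < rho -> Rabs (- u) < rho) by (intros; rewrite Rabs_Ropp; auto).
  assert (DS : forall u, Rabs u < rho -> is_derive S u (S1 u)).
  { intros u Hu. apply is_derive_div_const. apply is_derive_eq with (X2 u + -1 * X2 (- u)); [|ring].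
    apply (is_derive_plus X1 (fun u => X1 (- u))); [apply HD; auto|].
    apply (is_derive_comp X1 (fun u => - u)); [apply HD; auto | auto_derive; auto]. }
  assert (CS : forall u, Rabs u < rho -> continuous S u).
  { intros u Hu. apply continuous_of_derivable. eexists; apply DS; auto. }
  assert (PS : forall u, Rabs u < rho -> 0 < S u).
  { intros u Hu. unfold S. generalize (HP u Hu) (HP (- u) (Hopp u Hu)). lra. }
  assert (HS1 : forall u, 0 < u < rho -> k * u * S u ^ 3 <= S1 u).
  { intros u Hu. assert (Hu' : Rabs u < rho) by (rewrite Rabs_pos_eq; lra).
    assert (p := HP u Hu'). assert (q := HP (- u) (Hopp u Hu')). specialize (Hineq u Hu).
    unfold S, S1. set (x := X1 u) in *. set (y := X1 (- u)) in *.
    assert (J : ((x + y) / 2) ^ 3 <= (x ^ 3 + y ^ 3) / 2).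
    { assert (0 <= (x + y) * (x - y) ^ 2) by (apply Rmult_le_pos; [lra | apply pow2_ge_0]).
      replace ((x ^ 3 + y ^ 3) / 2) with (((x + y) / 2) ^ 3 + 3 / 8 * ((x + y) * (x - y) ^ 2)) by field. lra. }
    apply Rmult_le_compat_l with (r := k * u) in J; [|apply Rmult_le_pos; lra]. lra. }
  assert (HSmono : forall u v, 0 <= u <= v -> v < rho -> S u <= S v).
  { intros u v Huv Hv.
    apply (le_of_derive_le (fun _ => S u) S (fun _ => 0) S1 u); try lra.
    - intros; auto_derive; auto.
    - intros t Ht. apply DS. rewrite Rabs_pos_eq; lra.
    - intros t Ht. destruct (Req_dec t 0) as [->|E].
      + unfold S1. rewrite Ropp_0. lra.
      + refine (Rle_trans _ _ _ _ (HS1 t _)); [|lra].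
        apply Rmult_le_pos; [apply Rmult_le_pos; lra|]. apply pow_le, Rlt_le, PS. rewrite Rabs_pos_eq; lra. }
  assert (CSs := fun t => continuous_comp_sin S rho r t CS Hr').
  assert (CS3 : forall u, Rabs u < rho -> continuous (fun u => S u ^ 3) u).
  { intros u Hu. apply (continuous_comp S (fun y => y ^ 3)); auto. apply continuous_of_derivable. auto_derive; auto. }
  assert (CS3s := fun t => continuous_comp_sin (fun u => S u ^ 3) rho r t CS3 Hr'). cbv beta in CS3s.
  assert (Cs2 : forall t, continuous (fun t => sin t ^ 2) t) by (intros; apply continuous_of_derivable; auto_derive; auto).
  assert (CS1 : forall u, Rabs u < rho -> continuous S1 u).
  { intros u Hu. apply (continuous_Rmult (fun u => X2 u - X2 (- u)) (fun _ => / 2)); [|apply continuous_const].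
    apply (continuous_minus X2 (fun u => X2 (- u))); auto.
    apply (continuous_comp (fun u => - u) X2); auto. apply continuous_of_derivable. auto_derive; auto. }
  assert (CS1s := fun t => continuous_comp_sin S1 rho r t CS1 Hr').
  assert (EM : RInt (fun t => X1 (r * sin t)) (- (PI / 2)) (PI / 2) = 2 * RInt (fun t => S (r * sin t)) 0 (PI / 2)).
  { rewrite RInt_symmetrize by (intros; apply (continuous_comp_sin X1 rho); auto).
    rewrite <- (RInt_Rmult_l (fun t => S (r * sin t))) by (apply ex_RInt_cont; auto).
    apply RInt_ext. intros t _. real_eq. unfold S. rewrite sin_neg, Ropp_mult_distr_r_reverse. field. }
  assert (EM1 : RInt (fun t => sin t * X2 (r * sin t)) (- (PI / 2)) (PI / 2) = 2 * RInt (fun t => sin t * S1 (r * sin t)) 0 (PI / 2)).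
  { rewrite RInt_symmetrize.
    2:{ intros; apply continuous_Rmult; [apply continuous_sin_R | apply (continuous_comp_sin X2 rho); auto]. }
    rewrite <- (RInt_Rmult_l (fun t => sin t * S1 (r * sin t))).
    2:{ apply ex_RInt_cont; intros; apply continuous_Rmult; auto using continuous_sin_R. }
    apply RInt_ext. intros t _. real_eq. unfold S1. rewrite sin_neg, Ropp_mult_distr_r_reverse. field. }
  assert (L1 : (k * r) * RInt (fun t => sin t ^ 2 * S (r * sin t) ^ 3) 0 (PI / 2) <= RInt (fun t => sin t * S1 (r * sin t)) 0 (PI / 2)).
  { rewrite <- (RInt_Rmult_l (fun t => sin t ^ 2 * S (r * sin t) ^ 3)) by (apply ex_RInt_cont; intros; apply continuous_Rmult; auto).
    apply RInt_le; [lra| | |].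
    - apply ex_RInt_cont; intros; apply continuous_Rmult; [apply continuous_const|]. apply continuous_Rmult; auto.
    - apply ex_RInt_cont; intros; apply continuous_Rmult; auto using continuous_sin_R.
    - intros t Ht. assert (Hst : 0 < sin t) by (apply sin_gt_0; lra). assert (Hst1 := SIN_bound t).
      assert (K := HS1 (r * sin t) ltac:(split; nra)).
      apply Rmult_le_compat_l with (r := sin t) in K; [|lra].
      apply Rle_trans with (2 := K). right. ring. }
  assert (L2 := chebyshev_sin2 (fun u => S u ^ 3) rho r CS3 Hr).
  cbv beta in L2.
  assert (L2' : / 2 * RInt (fun t => S (r * sin t) ^ 3) 0 (PI / 2) <= RInt (fun t => sin t ^ 2 * S (r * sin t) ^ 3) 0 (PI / 2)).
  { apply L2. intros u v Huv Hv. apply pow_incr. split; [|apply HSmono; auto].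
    apply Rlt_le, PS. rewrite Rabs_pos_eq; lra. }
  assert (L3 := cube_mean_le (fun t => S (r * sin t)) 0 (PI / 2) ltac:(lra) (fun t _ => CSs t)
    (fun t _ => Rlt_le _ _ (PS _ (Rle_lt_trans _ _ _ (Rabs_mult_sin r t) Hr')))).
  cbv beta in L3. rewrite EM, EM1.
  set (I := RInt (fun t => S (r * sin t)) 0 (PI / 2)) in *.
  set (I3 := RInt (fun t => S (r * sin t) ^ 3) 0 (PI / 2)) in *.
  set (J := RInt (fun t => sin t ^ 2 * S (r * sin t) ^ 3) 0 (PI / 2)) in *.
  set (J1 := RInt (fun t => sin t * S1 (r * sin t)) 0 (PI / 2)) in *.
  assert (L3' : I ^ 3 <= PI ^ 2 / 4 * I3).
  { apply Rmult_le_reg_l with ((/ (PI / 2 - 0)) ^ 3); [apply pow_lt, Rinv_0_lt_compat; lra|].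
    rewrite <- Rpow_mult_distr. apply Rle_trans with (1 := L3). right. field. lra. }
  assert (Hkr : 0 <= k * r) by (apply Rmult_le_pos; lra).
  apply Rle_trans with (k * r * (8 * (PI ^ 2 / 4 * I3))).
  - apply Rmult_le_compat_l; auto. replace ((2 * I) ^ 3) with (8 * I ^ 3) by ring. lra.
  - assert (Hp2 : 0 < PI ^ 2) by (apply pow_lt; auto).
    apply Rle_trans with (PI ^ 2 * 4 * (k * r * J)).
    + apply Rle_trans with (PI ^ 2 * 4 * (k * r * (/ 2 * I3))); [right; field|].
      apply Rmult_le_compat_l; [lra|]. apply Rmult_le_compat_l; auto.
    + apply Rle_trans with (PI ^ 2 * 4 * J1); [apply Rmult_le_compat_l; lra | right; ring].
Qed.

Lemma well_bounds (G : R -> R) (E c xl xr : R) :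
  xl <= c <= xr ->
  (forall x, xl <= x <= xr -> G x <= E) ->
  (forall e, 0 < e -> exists x, xr < x < xr + e /\ E < G x) ->
  (forall e, 0 < e -> exists x, xl - e < x < xl /\ E < G x) ->
  well_left G E c = xl /\ well_right G E c = xr.
Proof.
  intros Hc Hin Hr Hl.
  assert (Hset : forall x, in_well G E c x <-> xl <= x <= xr).
  { intros x. split.
    - intros H. split.
      + apply Rnot_lt_le. intros Hx. destruct (Hl (xl - x)) as (y & Hy & HE); [lra|].
        specialize (H y). rewrite Rmin_right, Rmax_left in H by lra. specialize (H ltac:(lra)). lra.
      + apply Rnot_lt_le. intros Hx. destruct (Hr (x - xr)) as (y & Hy & HE); [lra|].
        specialize (H y). rewrite Rmin_left, Rmax_right in H by lra. specialize (H ltac:(lra)). lra.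
    - intros Hx y Hy. apply Hin. destruct (Rle_or_lt c x).
      + rewrite Rmin_left, Rmax_right in Hy by lra. lra.
      + rewrite Rmin_right, Rmax_left in Hy by lra. lra. }
  split.
  - unfold well_left. rewrite (is_glb_Rbar_unique _ (Finite xl)); [reflexivity|]. split.
    + intros x Hx. apply Hset in Hx. simpl. lra.
    + intros l Hlb. apply Hlb. apply Hset. lra.
  - unfold well_right. rewrite (is_lub_Rbar_unique _ (Finite xr)); [reflexivity|]. split.
    + intros x Hx. apply Hset in Hx. simpl. lra.
    + intros l Hlb. apply Hlb. apply Hset. lra.
Qed.

(** * The energy of a well *)

(** The substitution [x = X (r sin t)] turns [E - G x] into [(r cos t) ^ 2]. *)
Lemma action_integral_sin (G X X1 : R -> R) (g0 rho r : R) :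
  (forall x, continuous G x) ->
  (forall u, Rabs u < rho -> is_derive X u (X1 u)) ->
  (forall u, Rabs u < rho -> continuous X1 u) ->
  (forall u, Rabs u < rho -> G (X u) = g0 + u ^ 2) ->
  0 <= r < rho ->
  RInt (fun x => sqrt (g0 + r ^ 2 - G x)) (X (- r)) (X r) =
    r ^ 2 * RInt (fun t => cos t ^ 2 * X1 (r * sin t)) (- (PI / 2)) (PI / 2).
Proof.
  intros HG HX HC HGX Hr. assert (HPI := PI_RGT_0).
  assert (Hr' : Rabs r < rho) by (rewrite Rabs_pos_eq; lra).
  assert (Hs : forall t, Rabs (r * sin t) < rho) by (intros t; apply Rle_lt_trans with (2 := Hr'), Rabs_mult_sin).
  assert (CX1s := fun t => continuous_comp_sin X1 rho r t HC Hr').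
  set (g := fun t => X (r * sin t)). set (dg := fun t => r * cos t * X1 (r * sin t)).
  replace (X (- r)) with (g (- (PI / 2))) by (unfold g; rewrite sin_neg, sin_PI2; f_equal; ring).
  replace (X r) with (g (PI / 2)) by (unfold g; rewrite sin_PI2; f_equal; ring).
  rewrite <- (RInt_comp (V := R_CompleteNormedModule) _ g dg).
  - rewrite <- (RInt_Rmult_l (fun t => cos t ^ 2 * X1 (r * sin t))).
    2:{ apply ex_RInt_cont. intros t. apply continuous_Rmult; auto. apply continuous_of_derivable. auto_derive; auto. }
    apply RInt_ext. intros t. rewrite Rmin_left, Rmax_right by lra. intros Ht.
    change (dg t * sqrt (g0 + r ^ 2 - G (g t)) = r ^ 2 * (cos t ^ 2 * X1 (r * sin t))).
    unfold dg, g. rewrite HGX by auto.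
    assert (Hct : 0 <= cos t) by (apply cos_ge_0; lra).
    replace (g0 + r ^ 2 - (g0 + (r * sin t) ^ 2)) with ((r * cos t) ^ 2).
    + rewrite sqrt_pow2 by (apply Rmult_le_pos; lra). ring.
    + generalize (sin2_cos2 t). unfold Rsqr. intros E.
      transitivity (r ^ 2 * (sin t * sin t + cos t * cos t) - r ^ 2 * (sin t * sin t)); [ring|rewrite E; ring].
  - intros t _. apply (continuous_comp (fun x => g0 + r ^ 2 - G x) sqrt).
    + apply (continuous_minus (fun _ => g0 + r ^ 2) G); [apply continuous_const | apply HG].
    + apply continuity_pt_filterlim, continuity_pt_sqrt. unfold g. rewrite HGX by auto.
      generalize (sin2_cos2 t). unfold Rsqr. intros E.
      assert (0 <= (r * cos t) ^ 2) by apply pow2_ge_0.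
      replace (g0 + r ^ 2 - (g0 + (r * sin t) ^ 2)) with ((r * cos t) ^ 2); auto.
      transitivity (r ^ 2 * (sin t * sin t + cos t * cos t) - r ^ 2 * (sin t * sin t)); [ring|rewrite E; ring].
  - intros t _. split.
    + unfold g, dg. apply (is_derive_comp X (fun t => r * sin t)); [apply HX; auto | auto_derive; auto; ring].
    + unfold dg. apply continuous_Rmult; auto. apply continuous_of_derivable. auto_derive; auto.
Qed.

(** The hypothesis on pairs [x], [y] of equal energy is [period_convexity]'s
    pointwise inequality, rewritten through [X1 u = 2 u / G1] and
    [X2 u = 2 W / G1 ^ 3]. *)
Lemma well_energy_concave (G G1 G2 G3 G4 G5 : R -> R) (N : nat) (theta : nat -> R) (i : nat) (a b k : R) :
  let c := theta i in
  a < c < b ->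
  (forall y, is_derive G y (G1 y)) -> (forall y, is_derive G1 y (G2 y)) -> (forall y, is_derive G2 y (G3 y)) ->
  (forall y, is_derive G3 y (G4 y)) -> (forall y, is_derive G4 y (G5 y)) -> (forall y, continuous G5 y) ->
  G1 c = 0 -> 0 < G2 c ->
  (forall x, c < x < b -> 0 < G1 x) -> (forall x, a < x < c -> G1 x < 0) ->
  G b <= G a -> i <> 0%nat -> i <> (2 * N)%nat ->
  (forall E, energy_range G N theta i E <-> G c < E < G b) ->
  0 <= k ->
  (forall x y, c < x < b -> a < y < c -> G x = G y ->
     0 <= (G1 x ^ 2 - 2 * (G x - G c) * G2 x - 4 * k * (G x - G c) ^ 2) / G1 x ^ 3
        - (G1 y ^ 2 - 2 * (G y - G c) * G2 y - 4 * k * (G y - G c) ^ 2) / G1 y ^ 3) ->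
  forall E, G c < E < G b ->
    twice_derivable (energy G N theta i) (action G N theta i E) /\
    Derive_n (energy G N theta i) 2 (action G N theta i E) <= - k.
Proof.
  intros c Hacb D1 D2 D3 D4 D5 C5 Hc1 Hc2 Hpos Hneg Hab Hi0 HiN Hrange Hk Hineq E HE.
  assert (HPI := PI_RGT_0).
  destruct (inverse_coordinate G G1 G2 G3 G4 G5 a c b) as
    (X & X1 & X2 & A & B & HAB & HA & HB & HX0 & HX & HXf); auto.
  assert (HBA : A <= - B) by nra.
  assert (HX' : forall u, Rabs u < B -> a < X u < b /\ G (X u) = G c + u ^ 2 /\
       is_derive X u (X1 u) /\ is_derive X1 u (X2 u) /\ continuous X2 u /\ 0 < X1 u).
  { intros u Hu. apply HX. apply Rabs_lt_between in Hu. lra. }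
  assert (HXmono : forall u v, Rabs u < B -> Rabs v < B -> u < v -> X u < X v).
  { intros u v Hu Hv Huv. apply (strictly_increasing_on (fun u => Rabs u < B) X X1); auto.
    - intros x y z Hx Hz Hxyz. apply Rabs_lt_between in Hx. apply Rabs_lt_between in Hz. apply Rabs_lt_between. lra.
    - intros; apply HX'; auto.
    - intros; apply HX'; auto. }
  assert (C0 : forall x, continuous G x) by (intros; apply continuous_of_derivable; eexists; apply D1).
  assert (CX1 : forall u, Rabs u < B -> continuous X1 u).
  { intros u Hu. apply continuous_of_derivable. eexists; apply HX'; auto. }
  assert (H0B : Rabs 0 < B) by (rewrite Rabs_R0; lra).
  assert (Hact : forall E, G c < E < G b -> action G N theta i E =
     / PI * (sqrt (E - G c) ^ 2 * RInt (fun t => cos t ^ 2 * X1 (sqrt (E - G c) * sin t)) (- (PI / 2)) (PI / 2))).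
  { intros e He. set (r := sqrt (e - G c)).
    assert (Hr2 : r ^ 2 = e - G c) by (apply pow2_sqrt; lra).
    assert (Hr0 : 0 < r) by (apply sqrt_lt_R0; lra).
    assert (HrB : r < B) by nra.
    assert (HrB' : Rabs r < B) by (rewrite Rabs_pos_eq; lra).
    assert (HrB'' : Rabs (- r) < B) by (rewrite Rabs_Ropp; auto).
    assert (Xr : c < X r) by (rewrite <- HX0; apply HXmono; auto).
    assert (Xl : X (- r) < c) by (rewrite <- HX0; apply HXmono; auto; lra).
    destruct (HX' r HrB') as (Ir & Gr & _). destruct (HX' (- r) HrB'') as (Il & Gl & _).
    destruct (well_bounds G e c (X (- r)) (X r)) as [El Er].
    - lra.
    - intros x Hx. destruct (Rle_or_lt c x) as [H|H].
      + apply Rle_trans with (G (X r)); [|lra].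
        destruct (Rle_lt_or_eq_dec x (X r)) as [Hlt| ->]; [lra| |lra].
        apply Rlt_le, (increasing_of_derive_pos G G1); auto; intros; apply Hpos; lra.
      + apply Rle_trans with (G (X (- r))); [|replace ((- r) ^ 2) with (r ^ 2) in Gl by ring; lra].
        destruct (Rle_lt_or_eq_dec (X (- r)) x) as [Hlt| <-]; [lra| |lra].
        apply Rlt_le, (decreasing_of_derive_neg G G1); auto; intros; apply Hneg; lra.
    - intros d Hd. exists (X r + Rmin d (b - X r) / 2).
      assert (H1 := Rmin_l d (b - X r)). assert (H2 := Rmin_r d (b - X r)).
      assert (H3 : 0 < Rmin d (b - X r)) by (apply Rmin_pos; lra).
      split; [lra|]. apply Rle_lt_trans with (G (X r)); [lra|].
      apply (increasing_of_derive_pos G G1); auto; [lra|]. intros; apply Hpos; lra.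
    - intros d Hd. exists (X (- r) - Rmin d (X (- r) - a) / 2).
      assert (H1 := Rmin_l d (X (- r) - a)). assert (H2 := Rmin_r d (X (- r) - a)).
      assert (H3 : 0 < Rmin d (X (- r) - a)) by (apply Rmin_pos; lra).
      split; [lra|]. apply Rle_lt_trans with (G (X (- r))); [replace ((- r) ^ 2) with (r ^ 2) in Gl by ring; lra|].
      apply (decreasing_of_derive_neg G G1); auto; [lra|]. intros; apply Hneg; lra.
    - unfold action. fold c. rewrite El, Er.
      rewrite (proj2 (Nat.eqb_neq i 0) Hi0), (proj2 (Nat.eqb_neq i (2 * N)) HiN). simpl orb. cbv iota.
      f_equal. rewrite <- (action_integral_sin G X X1 (G c) B r); auto; try (intros; apply HX'; auto); [|lra].
      rewrite Hr2. apply RInt_ext. intros x _. real_eq. f_equal. ring. }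
  set (M := fun r => RInt (fun t => X1 (r * sin t)) (- (PI / 2)) (PI / 2)).
  set (M1 := fun r => RInt (fun t => sin t * X2 (r * sin t)) (- (PI / 2)) (PI / 2)).
  assert (DM : forall r, Rabs r < B -> is_derive M r (M1 r)).
  { intros r Hr. unfold M, M1.
    assert (Dp := is_derive_RInt_sin (fun _ => 1) X1 X2 B r (fun t => continuous_const 1 t)
      (fun u Hu => proj1 (proj2 (proj2 (proj2 (HX' u Hu)))))
      (fun u Hu => proj1 (proj2 (proj2 (proj2 (proj2 (HX' u Hu)))))) Hr).
    rewrite (RInt_ext (fun t => sin t * X2 (r * sin t)) (fun t => 1 * (sin t * X2 (r * sin t)))) by (intros; real_eq; ring).
    apply is_derive_ext with (2 := Dp). intros s. apply RInt_ext. intros; real_eq; ring. }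
  set (rt := fun E => sqrt (E - G c)).
  assert (Hrt : forall E, G c < E < G b -> 0 < rt E < B).
  { intros e He. unfold rt. assert (Hr2 : sqrt (e - G c) ^ 2 = e - G c) by (apply pow2_sqrt; lra).
    assert (Hr0 : 0 < sqrt (e - G c)) by (apply sqrt_lt_R0; lra). split; auto. nra. }
  assert (Hrt' : forall E, G c < E < G b -> Rabs (rt E) < B).
  { intros e He. specialize (Hrt e He). rewrite Rabs_pos_eq; lra. }
  assert (Drt : forall E, G c < E < G b -> is_derive rt E (/ (2 * rt E))).
  { intros e He. specialize (Hrt e He). unfold rt in *. auto_derive; [lra|]. change (e + - G c) with (e - G c). field. lra. }
  assert (PM : forall r, Rabs r < B -> 0 < M r).
  { intros r Hr. apply RInt_gt_0; [lra| |].
    - intros t _. apply HX'. apply Rle_lt_trans with (2 := Hr), Rabs_mult_sin.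
    - intros t _. apply (continuous_comp_sin X1 B); auto. }
  set (f1 := fun E => M (rt E) / (2 * PI)).
  set (f2 := fun E => / (2 * rt E) * M1 (rt E) / (2 * PI)).
  destruct (energy_second_derivative G N theta i (fun E => G c < E < G b) f1 f2) with E as [T1 T2]; auto.
  - intros e He. apply locally_open_interval, He.
  - intros; lra.
  - intros e He.
    apply is_derive_ext_loc with (fun E => / PI * (rt E ^ 2 * RInt (fun t => cos t ^ 2 * X1 (rt E * sin t)) (- (PI / 2)) (PI / 2))).
    { generalize (locally_open_interval _ _ _ He). apply filter_imp. intros y Hy. symmetry. apply Hact, Hy. }
    assert (K := is_derive_abel_integral X1 X2 B (rt e)
      (fun u Hu => proj1 (proj2 (proj2 (proj2 (HX' u Hu)))))
      (fun u Hu => proj1 (proj2 (proj2 (proj2 (proj2 (HX' u Hu)))))) (Hrt' e He)).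
    assert (K2 := is_derive_comp _ rt e _ _ K (Drt e He)).
    apply is_derive_eq with (/ PI * (/ (2 * rt e) * (rt e * M (rt e)))).
    + apply is_derive_scal. exact K2.
    + unfold f1. specialize (Hrt e He). real_eq. field. lra.
  - intros e He. unfold f1, f2. apply is_derive_div_const.
    exact (is_derive_comp M rt e _ _ (DM _ (Hrt' e He)) (Drt e He)).
  - intros e He. apply Rdiv_lt_0_compat; [apply PM; auto | lra].
  - split; [exact T1|]. rewrite T2.
    assert (PC : k * rt E * M (rt E) ^ 3 <= 2 * PI ^ 2 * M1 (rt E)).
    { apply (period_convexity X1 X2 B k (rt E)); auto; try (intros; apply HX'; auto).
      intros u Hu.
      assert (Hu1 : Rabs u < B) by (rewrite Rabs_pos_eq; lra).
      assert (Hu2 : Rabs (- u) < B) by (rewrite Rabs_Ropp; auto).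
      assert (Xr : c < X u) by (rewrite <- HX0; apply HXmono; auto; lra).
      assert (Xl : X (- u) < c) by (rewrite <- HX0; apply HXmono; auto; lra).
      destruct (HX' u Hu1) as (Ir & Gr & _). destruct (HX' (- u) Hu2) as (Il & Gl & _).
      replace ((- u) ^ 2) with (u ^ 2) in Gl by ring.
      destruct (HXf u) as (Nr & E1r & E2r); try lra.
      destruct (HXf (- u)) as (Nl & E1l & E2l); try lra.
      replace ((- u) ^ 2) with (u ^ 2) in E2l by ring.
      specialize (Hineq (X u) (X (- u)) ltac:(lra) ltac:(lra) ltac:(lra)).
      rewrite Gr, Gl in Hineq.
      replace (G c + u ^ 2 - G c) with (u ^ 2) in Hineq by ring.
      rewrite E1r, E2r, E1l, E2l. clear E1r E2r E1l E2l.
      set (p := G1 (X u)) in *. set (q := G1 (X (- u))) in *.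
      set (p2 := G2 (X u)) in *. set (q2 := G2 (X (- u))) in *.
      replace (2 * (p ^ 2 - 2 * u ^ 2 * p2) / p ^ 3 - 2 * (q ^ 2 - 2 * u ^ 2 * q2) / q ^ 3) with
        (k * u * ((2 * u / p) ^ 3 + (2 * - u / q) ^ 3) +
         2 * ((p ^ 2 - 2 * u ^ 2 * p2 - 4 * k * (u ^ 2) ^ 2) / p ^ 3 - (q ^ 2 - 2 * u ^ 2 * q2 - 4 * k * (u ^ 2) ^ 2) / q ^ 3))
        by (field; auto).
      lra. }
    specialize (Hrt E HE). specialize (PM _ (Hrt' E HE)). unfold f1, f2.
    set (r := rt E) in *. set (m := M r) in *. set (m1 := M1 r) in *.
    assert (Hm3 : 0 < r * m ^ 3) by (apply Rmult_lt_0_compat; [lra | apply pow_lt; auto]).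
    apply Rmult_le_reg_r with (r * m ^ 3); auto.
    replace (- (/ (2 * r) * m1 / (2 * PI)) / (m / (2 * PI)) ^ 3 * (r * m ^ 3)) with (- (2 * PI ^ 2 * m1)) by (field; lra).
    lra.
Qed.

(** * The first well of a cosine-like potential *)

Lemma derive_pos_of_nonvanishing (f f1 f2 : R -> R) (p q : R) : p < q ->
  (forall x, is_derive f x (f1 x)) -> (forall x, is_derive f1 x (f2 x)) ->
  (forall x, p < x < q -> f1 x <> 0) -> f p < f q -> forall x, p < x < q -> 0 < f1 x.
Proof.
  intros Hpq D1 D2 Hnz Hf x Hx.
  destruct (MVT_cor2 f f1 p q Hpq) as [t [E Ht]].
  { intros t _. apply is_derive_Reals, D1. }
  assert (Pt : 0 < f1 t) by nra.
  apply Rnot_le_lt. intros [K|K]; [|apply (Hnz x Hx K)].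
  assert (Cc : forall s, continuity_pt f1 s) by (intros s; apply is_derive_continuity_pt with (f2 s), D2).
  destruct (Rtotal_order x t) as [H|[H|H]].
  - destruct (IVT_interv f1 x t) as [z [Hz Ez]]; auto. apply (Hnz z); auto; lra.
  - subst x; lra.
  - destruct (IVT_interv (fun s => - f1 s) t x) as [z [Hz Ez]]; auto; try lra.
    + intros s _. apply (continuity_pt_opp f1), Cc.
    + apply (Hnz z); lra.
Qed.

Lemma derive_nonneg_of_right_pos (f : R -> R) (c b l : R) : c < b ->
  is_derive f c l -> f c = 0 -> (forall x, c < x < b -> 0 < f x) -> 0 <= l.
Proof.
  intros Hcb D H0 Hp. apply Rnot_lt_le. intros Hl.
  apply is_derive_Reals in D. destruct (D (- l)) as [d Hd]; [lra|].
  assert (Hdp := cond_pos d).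
  assert (H1 := Rmin_l (d / 2) ((b - c) / 2)). assert (H2 := Rmin_r (d / 2) ((b - c) / 2)).
  assert (H3 : 0 < Rmin (d / 2) ((b - c) / 2)) by (apply Rmin_pos; lra).
  set (s := Rmin (d / 2) ((b - c) / 2)) in *.
  specialize (Hd s ltac:(lra)). rewrite Rabs_pos_eq in Hd by lra. specialize (Hd ltac:(lra)).
  rewrite H0, Rminus_0_r in Hd. apply Rabs_lt_between in Hd.
  assert (0 < f (c + s) / s) by (apply Rdiv_lt_0_compat; [apply Hp|]; lra). lra.
Qed.

Lemma critical_points_mono (G : R -> R) (N : nat) (theta : nat -> R) : critical_points G N theta ->
  forall i j, (i < j)%nat -> (j <= 2 * N)%nat -> theta i < theta j.
Proof.
  intros (_ & _ & Hinc & _) i j Hij. induction Hij as [|j Hij IH]; intros Hj.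
  - apply Hinc. lia.
  - apply Rlt_trans with (theta j); [apply IH; lia | apply Hinc; lia].
Qed.

Lemma critical_points_gap (G : R -> R) (N : nat) (theta : nat -> R) (i : nat) (x : R) :
  critical_points G N theta -> (i < 2 * N)%nat -> theta i < x < theta (S i) -> ~ critical G x.
Proof.
  intros H Hi Hx Hc. assert (Hm := critical_points_mono G N theta H).
  destruct H as (_ & _ & _ & Hend & Hcrit).
  assert (H0i : theta 0%nat <= theta i).
  { destruct i; [lra|]. apply Rlt_le, Hm; lia. }
  assert (Hi2 : theta (S i) <= theta (2 * N)%nat).
  { destruct (Nat.eq_dec (S i) (2 * N)) as [->|Hne]; [lra|]. apply Rlt_le, Hm; lia. }
  destruct (proj1 (Hcrit x ltac:(lra)) Hc) as (j & Hj & ->).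
  destruct (Nat.lt_trichotomy j i) as [K|[K|K]].
  - specialize (Hm j i K ltac:(lia)). lra.
  - subst j. lra.
  - destruct (Nat.eq_dec j (S i)) as [->|Hne]; [lra|].
    specialize (Hm (S i) j ltac:(lia) Hj). lra.
Qed.

(** [theta 0] is the absolute maximum, so a well around [theta 1] that grows with
    the energy reaches [theta 2] no later than [theta 0]. *)
Lemma energy_range_first_well (G : R -> R) (N : nat) (theta : nat -> R) : critical_points G N theta ->
  (1 <= N)%nat -> (forall x, theta 1%nat < x < theta 2%nat -> G x < G (theta 2%nat)) ->
  G (theta 1%nat) < G (theta 2%nat) ->
  forall E, energy_range G N theta 1 E <-> G (theta 1%nat) < E < G (theta 2%nat).
Proof.
  intros H HN Hinc H12 E. assert (Hm := critical_points_mono G N theta H).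
  assert (L01 := Hm 0%nat 1%nat ltac:(lia) ltac:(lia)). assert (L12 := Hm 1%nat 2%nat ltac:(lia) ltac:(lia)).
  split.
  - intros [H1 H2]. split; auto. apply Rnot_le_lt. intros K.
    specialize (H2 2%nat ltac:(lia)). 
    assert (in_well G E (theta 1%nat) (theta 2%nat)); [|specialize (H2 H0); lra].
    intros y. rewrite Rmin_left, Rmax_right by lra. intros Hy.
    destruct (Req_dec y (theta 1%nat)) as [->|N1]; [lra|].
    destruct (Req_dec y (theta 2%nat)) as [->|N2]; [lra|].
    specialize (Hinc y ltac:(lra)). lra.
  - intros HE. split; [lra|]. intros j Hj Hw.
    destruct j as [|[|j]].
    + specialize (Hw (theta 0%nat)). rewrite Rmin_right, Rmax_left in Hw by lra. specialize (Hw ltac:(lra)).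
      destruct H as (_ & Hmax & _). specialize (Hmax (theta 2%nat)). lra.
    + lra.
    + assert (L2j : theta 2%nat <= theta (S (S j))).
      { destruct j; [lra|]. apply Rlt_le, Hm; lia. }
      specialize (Hw (theta 2%nat)). rewrite Rmin_left, Rmax_right in Hw by lra. specialize (Hw ltac:(lra)). lra.
Qed.

Theorem proposition5p1 :
  forall (G : R -> R) (N : nat) (theta : nat -> R),
    reference_potential G ->
    critical_points G N theta ->
    (forall i : nat, i = 0%nat \/ i = (2 * N)%nat ->
       forall E : R, G (theta i) < E ->
         twice_derivable (energy G N theta i) (action G N theta i E) /\
         Derive_n (energy G N theta i) 2 (action G N theta i E) >= 2) /\
    (forall g : R, cosine_like g G -> g <= / 2 ^ 40 ->
       forall E : R, G (theta 1%nat) < E < G (theta 2%nat) ->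
         twice_derivable (energy G N theta 1) (action G N theta 1 E) /\
         Derive_n (energy G N theta 1) 2 (action G N theta 1 E) <= - (1 / 27)).
Proof.
  intros G N theta (_ & _ & beta & _ & HC2 & Hper & _) Hcp.
  assert (HPI := PI_RGT_0). split.
  - intros i Hi. apply rotation_energy_convex; auto.
    + intros x. apply continuous_of_derivable, HC2.
    + destruct Hcp as (_ & Hmax & _ & Hend & _). destruct Hi as [->| ->]; auto.
      intros x. rewrite Hend, Hper. auto.
  - intros g Hg Hg40 E HE.
    assert (HN : (1 <= N)%nat).
    { destruct N; [|lia]. destruct Hcp as (_ & _ & _ & Hend & _). simpl in Hend. lra. }
    assert (Hm := critical_points_mono G N theta Hcp).
    assert (L01 := Hm 0%nat 1%nat ltac:(lia) ltac:(lia)). assert (L12 := Hm 1%nat 2%nat ltac:(lia) ltac:(lia)).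
    assert (L2 : theta 2%nat <= theta 0%nat + 2 * PI).
    { destruct Hcp as (_ & _ & _ & <- & _). destruct (Nat.eq_dec 2 (2 * N)) as [<-|Hne]; [lra|].
      apply Rlt_le, Hm; lia. }
    destruct (cosine_like_derivatives G g Hg Hg40) as (eta & th & D & He & HD0 & HD & Hclose).
    assert (D1 : forall x, is_derive G x (D 1%nat x)).
    { intros x. apply is_derive_ext with (D 0%nat); auto. }
    assert (Hcr : forall x, critical G x <-> D 1%nat x = 0).
    { intros x. unfold critical. now rewrite (is_derive_unique _ _ _ (D1 x)). }
    assert (Hmax : forall x, G x <= G (theta 0%nat)) by apply Hcp.
    assert (Hpos : forall x, theta 1%nat < x < theta 2%nat -> 0 < D 1%nat x).
    { apply (derive_pos_of_nonvanishing G (D 1%nat) (D 2%nat)); auto; [|lra].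
      intros x Hx K. apply (critical_points_gap G N theta 1 x); auto; [lia|]. now apply Hcr. }
    assert (Hneg : forall x, theta 0%nat < x < theta 1%nat -> D 1%nat x < 0).
    { intros x Hx.
      assert (0 < - D 1%nat x); [|lra].
      apply (derive_pos_of_nonvanishing (fun x => - G x) (fun x => - D 1%nat x) (fun x => - D 2%nat x) (theta 0%nat) (theta 1%nat)); auto.
      - intros y. apply (is_derive_opp G), D1.
      - intros y. apply (is_derive_opp (D 1%nat)), HD.
      - intros y Hy K. apply (critical_points_gap G N theta 0 y); auto; [lia|]. apply Hcr. lra.
      - specialize (Hmax (theta 2%nat)). lra. }
    assert (Hc1 : D 1%nat (theta 1%nat) = 0).
    { apply Hcr. destruct Hcp as (_ & _ & _ & _ & Hcrit). apply Hcrit; [lra|]. exists 1%nat. split; [lia|auto]. }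
    assert (Hc2 : 0 <= D 2%nat (theta 1%nat)).
    { apply (derive_nonneg_of_right_pos (D 1%nat) (theta 1%nat) (theta 2%nat)); auto. }
    assert (W := ncw_of_close D eta th (theta 1%nat) He HD Hclose Hc1 Hc2).
    assert (Hc2' : 0 < D 2%nat (theta 1%nat)).
    { destruct W as [_ _ _ _ _ _ W2 _ _ _]. apply Rabs_le_between in W2.
      replace (D 2%nat (theta 1%nat)) with (D 2%nat (theta 1%nat) / eta * eta) by (field; lra).
      apply Rmult_lt_0_compat; lra. }
    replace (- (1 / 27)) with (- / 27) by field.
    apply (well_energy_concave G (D 1%nat) (D 2%nat) (D 3%nat) (D 4%nat) (D 5%nat) N theta 1 (theta 0%nat) (theta 2%nat)); auto; try lra; try lia.
    + intros y. apply continuous_of_derivable. eexists; apply HD.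
    + apply energy_range_first_well; auto; [|lra].
      intros x Hx. apply (increasing_of_derive_pos G (D 1%nat)); auto; [lra|]. intros; apply Hpos; lra.
    + intros x y Hx Hy Hxy.
      assert (T := ncw_two_sided _ _ _ _ _ (theta 0%nat) (theta 1%nat) (theta 2%nat) W).
      cbv beta in T. rewrite !HD0 in T.
      specialize (T ltac:(intros; apply Rdiv_lt_0_compat; auto)).
      specialize (T ltac:(intros z Hz; specialize (Hneg z Hz); assert (0 < - D 1%nat z / eta) by (apply Rdiv_lt_0_compat; lra); lra)).
      specialize (T ltac:(lra) ltac:(lra) x y Hx Hy).
      rewrite !HD0, Hxy in T. specialize (T eq_refl). rewrite Hxy.
      specialize (Hpos x Hx). specialize (Hneg y Hy).
      match goal with |- 0 <= ?A - ?B => match type of T with 0 <= ?A' - ?B' =>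
        replace (A - B) with (/ eta * (A' - B')) end end.
      * apply Rmult_le_pos; auto. apply Rlt_le, Rinv_0_lt_compat, He.
      * field. lra.
Qed.
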